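(* For every $n\in\mathbb{N}$ let $P_n(x)=\sum_{k=0}^n a_{k:n}x^k$ be a polynomial of degree at most $n$ (not identically zero) with nonnegative coefficients. Suppose that the sequence $(P_n)_{n\in\mathbb{N}}$ possesses an exponential profile $g:(\underline{m},\overline{m})\to\mathbb{R}$, where $(\underline m,\overline m)\subseteq[0,1]$ is a nonempty interval. If, additionally, all roots of $P_n$ are nonpositive for all sufficiently large $n$, then the following hold. (a) The measures $[\![P_n]\!]_n$ converge weakly, as $n\to\infty$, as probability measures on $[-\infty,0]$, to some probability measure $\mu$ on $[-\infty,0]$. (b) The measure $\mu$ is uniquely determined by $g$ as follows. If $G_\mu$ denotes the Cauchy transform of $\mu$, then $t\mapsto tG_\mu(t)$, $t>0$, is the inverse of the function $\alpha\mapsto e^{-g'(\alpha)}$, $\alpha\in(\underline m,\overline m)$ (the derivative $g'$ exists on $(\underline m,\overline m)$ by part (d)). The function $t\mapsto tG_\mu(t)$ is a strictly increasing continuous bijection between $(0,+\infty)$ and $(\underline m,\overline m)$. (c) Furthermore, $$\lim_{n\to\infty}\frac{\log P_n(1)}{n}=\sup_{\alpha\in(\underline m,\overline m)}g(\alpha)=:M_g,$$ and the function $-g(\cdot)+M_g$ is the Legendre transform of $u\mapsto\Psi(e^u)$, where $$\Psi(t)=\int_{(-\infty,0]}\log\left(\frac{t-z}{1-z}\right)\mu(dz),\qquad t>0.$$ This means that $g(\alpha)=M_g+\inf_{u\in\mathbb{R}}(\Psi(e^u)-\alpha u)$ for all $\alpha\in(\underline m,\overline m)$. (d) The function $g$ is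 infinitely differentiable and strictly concave on $(\underline m,\overline m)$. Moreover, even the function $\alpha\mapsto g(\alpha)+\alpha\log\alpha$ is strictly concave on $(\underline m,\overline m)$. (e) It holds that $\mu(\{0\})=\underline m$ and $\mu(\{-\infty\})=1-\overline m$.
   Context: Empirical zero distribution: for a polynomial $P\not\equiv0$ with real coefficients and $\deg P\le n$, $$[\![P]\!]_n:=\frac1n\sum_{z\in\mathbb{C}:P(z)=0}\delta_z+\frac{n-\deg P}{n}\delta_\infty,$$ zeros being counted with multiplicity. When all roots are nonpositive, the point $\infty$ is identified with $-\infty$, so that $[\![P]\!]_n$ is a probability measure on the compact space $[-\infty,0]$. Exponential profile: a sequence of polynomials $P_n(x)=\sum_{k=0}^n a_{k:n}x^k$ of degree at most $n$ with coefficients $a_{k:n}\ge0$ has exponential profile $g$ if $g:(\underline m,\overline m)\to\mathbb{R}$ is a function on a nonempty interval $(\underline m,\overline m)\subseteq[0,1]$ such that $$\lim_{n\to\infty}\frac1n\log a_{\lfloor\alpha n\rfloor:n}=\begin{cases}g(\alpha),&\alpha\in(\underline m,\overline m),\\-\infty,&\alpha\in[0,\underline m)\cup(\overline m,1],\end{cases}$$ with the convention $\log0=-\infty$. Cauchy transform: for a probability measure $\mu$ on $[-\infty,0]$, $G_\mu(t)=\int_{(-\infty,0]}\frac{\mu(dz)}{t-z}$ (an atom at $-\infty$ contributes $0$). *)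

(* Defs.v *)
From HB Require Import structures.
From mathcomp Require Import all_boot all_order all_algebra.
From mathcomp Require Import complex.
From mathcomp Require Import all_classical all_reals all_analysis.
From mathcomp Require Import measurable_realfun.

Set Implicit Arguments.
Unset Strict Implicit.
Unset Printing Implicit Defensive.

Import Order.TTheory GRing.Theory Num.Theory.
Import numFieldNormedType.Exports.

Local Open Scope classical_set_scope.
Local Open Scope ring_scope.

Definition embedC (R : realType) (p : {poly R}) : {poly R[i]} :=
  map_poly (real_complex R) p.

(* For [p != 0]: all complex zeros, repeated according to multiplicity. *)
Definition zeros (R : realType) (p : {poly R}) : seq R[i] :=
  sval (closed_field_poly_normal (embedC p)).

(* The order of [R[i]] is partial: [z <= 0] means that [z] is a nonpositive
   real number. *)
Definition nonpos_rooted (R : realType) (p : {poly R}) : Prop :=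
  forall z : R[i], root (embedC p) z -> z <= 0.

(* The compact interval [-oo, 0] and its finite part, as subsets of the
   extended real line. *)
Definition nonpos (R : realType) : set (\bar R) := [set x | (x <= 0)%E].

Definition fin_nonpos (R : realType) : set (\bar R) :=
  [set x | (-oo < x <= 0)%E].

(* A zero [z] is recorded as the point [Re z], which is [z] itself when [p] is
   [nonpos_rooted], and the point at infinity of the Riemann sphere as [-oo].
   The measure is only meaningful for [nonpos_rooted p], [0 < n], [p != 0] and
   [deg p <= n]. *)
Definition zero_distribution (R : realType) (n : nat) (p : {poly R})
    : {measure set (\bar R) -> \bar R} :=
  measure_add
    (mscale (n%:R^-1 : R)%:nng
       (msum (fun i => \d_((complex.Re (nth 0 (zeros p) i))%:E : \bar R))
             (size (zeros p))))
    (mscale ((n - (size p).-1)%:R / n%:R : R)%:nng (\d_(-oo%E : \bar R))).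

(* Boundedness of the test functions is automatic since [nonpos] is compact. *)
Definition weak_cvg_nonpos (R : realType)
    (mun : nat -> {measure set (\bar R) -> \bar R})
    (mu : {measure set (\bar R) -> \bar R}) : Prop :=
  forall f : \bar R -> R, {within @nonpos R, continuous f} ->
    (\int[mun n]_(x in @nonpos R) f x)%R @[n --> \oo]
      --> (\int[mu]_(x in @nonpos R) f x)%R.

(* [Num.truncn x] is the floor of [x >= 0] as a natural number, and
   [lne 0 = -oo]. Only the values of [g] on the open interval matter. *)
Definition exponential_profile (R : realType) (P : nat -> {poly R})
    (m M : R) (g : R -> R) : Prop :=
  let u (alpha : R) (n : nat) : \bar R :=
    ((n%:R^-1)%:E * lne ((P n)`_(Num.truncn (alpha * n%:R)))%:E)%E in
  [/\ [/\ 0 <= m, m < M & M <= 1],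
      {in `]m, M[, forall alpha, u alpha n @[n --> \oo] --> (g alpha)%:E} &
      forall alpha, (0 <= alpha < m) || (M < alpha <= 1) ->
        u alpha n @[n --> \oo] --> -oo%E].

Definition cauchy_transform (R : realType)
    (mu : {measure set (\bar R) -> \bar R}) (t : R) : R :=
  (\int[mu]_(x in @fin_nonpos R) (t - fine x)^-1)%R.

Definition Psi (R : realType)
    (mu : {measure set (\bar R) -> \bar R}) (t : R) : R :=
  (\int[mu]_(x in @fin_nonpos R) ln ((t - fine x) / (1 - fine x)))%R.

Definition legendre (R : realType) (f : R -> R) (alpha : R) : \bar R :=
  ereal_sup (range (fun u : R => (alpha * u - f u)%:E)).

Definition inverse_on (R : realType) (A B : set R) (f h : R -> R) : Prop :=
  [/\ set_fun A B f, set_fun B A h, {in A, cancel f h} & {in B, cancel h f}].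

Definition smooth_on (R : realType) (A : interval R) (f : R -> R) : Prop :=
  forall k : nat, {in A, forall x, derivable (derive1n k f) x 1}.

Definition strictly_concave_on (R : realType) (A : interval R) (f : R -> R)
    : Prop :=
  {in A &, forall x y, x != y -> forall s : R, 0 < s < 1 ->
     s * f x + (1 - s) * f y < f (s * x + (1 - s) * y)}.

(* Main.v *)
Require Import Defs.
From HB Require Import structures.
From mathcomp Require Import all_boot all_order all_algebra.
From mathcomp Require Import complex.
From mathcomp Require Import all_classical all_reals all_analysis.
From mathcomp Require Import measurable_realfun.
From mathcomp Require Import ring lra.

Set Implicit Arguments.
Unset Strict Implicit.
Unset Printing Implicit Defensive.

Import Order.TTheory GRing.Theory Num.Theory.
Import numFieldNormedType.Exports.

Local Open Scope classical_set_scope.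
Local Open Scope ring_scope.

(** Write a polynomial with nonpositive zeros z_i, of degree at most n, as

      P_n(x) = P_n(1) * prod_(i < n) (1 - s_i + s_i x),   s_i = 1 / (1 - z_i),

    with s_i = 0 for the zeros at infinity. The coefficients of P_n / P_n(1) are
    then the law of a sum of independent Bernoulli variables of parameters s_i,
    and the exponential profile is a large deviation rate function for these
    sums. The whole theorem rests on this reading.

    Existence of limits. Work along an ultrafilter U finer than n -> oo. The
    quantile functions of the empirical measures of the s_i are monotone with
    values in [0, 1], so they converge pointwise along U; comparison with Riemann
    sums on a fixed mesh shows that the moments, hence by Bernstein's theorem the
    integrals of all continuous functions, converge to those of the law mu with
    the limiting quantile function (quantile_limit).

    Identification. Let X be the parameter under mu, Psi(u) the expectation of
    ln (1 + (e^u - 1) X), which is the function of part (c) at t = e^u, and H the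
    derivative of Psi. H(u) is the mean of the tilted parameter
    p = t X / (1 + (t - 1) X), and equals t G_mu(t). Chernoff's bound
    a_k t^k <= P_n(t) gives g(al) <= C + Psi(u) - al u for all u, where C is the
    limit of ln P_n(1) / n along U. Conversely, after tilting by t = e^u the sum
    concentrates near n H(u) by Chebyshev, so some coefficient with index near
    n H(u) is nearly as large as P_n(t) / t^k; since the tilted coefficients are
    log-concave, hence unimodal, two such indices on either side of n H(u) give
    the same lower bound at the index n H(u) itself (coef_lower_at). Therefore
    g(H(u)) = C + Psi(u) - H(u) u. Unimodality also bounds ln P_n(1) / n, which
    is what makes C finite (logmass_bounded). Outside the range of H the upper
    bound is -oo and inside it the lower bound is finite, so this range is
    ]m, M[; its end points, the limits of H at -oo and +oo, are mu({0}) and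
    1 - mu({-oo}) (profile_identification).

    Consequences. H is smooth with H' > 0, because p solves the logistic equation
    p' = p (1 - p) in u, and g is the Legendre dual of Psi up to sign and
    constant. So g' is minus the inverse of H, which is part (b), and is smooth
    and strictly decreasing. Adding al ln al to g adds ln al + 1 to the
    derivative, which becomes 1 + ln G_mu(t) at al = t G_mu(t), again strictly
    decreasing. The maximum of g is C, at u = 0.

    Uniqueness. The logistic equation expresses each moment of p through the
    previous one and its derivative, so H determines all moments of p; at u = 0
    these are the moments of X, which determine mu
    (probability_nonpos_unique). As H is the inverse of exp(-g') in the variable
    t, the law mu depends on g only. All ultrafilters thus give the same limits,
    which is convergence (ultra_cvg). *)

(** * Bernoulli generating functions *)

Definition in01 (R : realType) (l : seq R) : Prop :=
  {in l, forall s, 0 <= s <= 1}.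

(** The generating function of a sum of independent Bernoulli variables with
    parameters in l. A factor with parameter 1 / (1 - z) has z as its zero, and
    parameter 0, a constant factor, stands for a zero at infinity. *)
Definition bernoulli_gf (R : realType) (l : seq R) : {poly R} :=
  \prod_(s <- l) ((1 - s)%:P + s *: 'X).

(** The parameter of a Bernoulli law of parameter s after its two weights are
    multiplied by 1 and t and renormalised. *)
Definition tilt (R : realType) (t s : R) : R := t * s / (1 + (t - 1) * s).

(** Unlike the comparison of a i ^+ 2 with its two neighbours, this form rules
    out internal zeros. *)
Definition log_concave (R : realType) (a : nat -> R) : Prop :=
  forall i j, (i <= j)%N -> a i * a j.+1 <= a i.+1 * a j.

Section BernoulliGF.
Variable R : realType.
Implicit Types (l : seq R) (s t : R).

Lemma in01_cons s l : in01 (s :: l) -> 0 <= s <= 1 /\ in01 l.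
Proof.
move=> h; split; first by apply: h; rewrite inE eqxx.
by move=> x xl; apply: h; rewrite inE xl orbT.
Qed.

Lemma tilt_den_gt0 t s : 0 < t -> 0 <= s <= 1 -> 0 < 1 + (t - 1) * s.
Proof.
move=> t0 /andP[s0 s1].
have -> : 1 + (t - 1) * s = (1 - s) + t * s by ring.
have := mulr_ge0 (ltW t0) s0.
move: s1; rewrite le_eqVlt => /orP[/eqP ->|s1] ts; first by lra.
by lra.
Qed.

Lemma tilt01 t s : 0 < t -> 0 <= s <= 1 -> 0 <= tilt t s <= 1.
Proof.
move=> t0 s01; have d0 := tilt_den_gt0 t0 s01; case/andP: s01 => s0 s1.
rewrite /tilt divr_ge0 ?mulr_ge0 ?(ltW t0) ?(ltW d0)//=.
by rewrite ler_pdivrMr// mul1r; lra.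
Qed.

Lemma bernoulli_gf_nil : bernoulli_gf [::] = 1 :> {poly R}.
Proof. by rewrite /bernoulli_gf big_nil. Qed.

Lemma bernoulli_gf_cons s l :
  bernoulli_gf (s :: l) = ((1 - s)%:P + s *: 'X) * bernoulli_gf l.
Proof. by rewrite /bernoulli_gf big_cons. Qed.

Lemma bernoulli_gf_coef0 s l :
  (bernoulli_gf (s :: l))`_0 = (1 - s) * (bernoulli_gf l)`_0.
Proof.
by rewrite bernoulli_gf_cons mulrDl -scalerAl coefD coefCM coefZ coefXM mulr0 addr0.
Qed.

Lemma bernoulli_gf_coefS s l k : (bernoulli_gf (s :: l))`_k.+1 =
  (1 - s) * (bernoulli_gf l)`_k.+1 + s * (bernoulli_gf l)`_k.
Proof. by rewrite bernoulli_gf_cons mulrDl -scalerAl coefD coefCM coefZ coefXM. Qed.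

Lemma bernoulli_gf_coef_ge0 l k : in01 l -> 0 <= (bernoulli_gf l)`_k.
Proof.
elim: l k => [k _|s l IH k /in01_cons[/andP[s0 s1] hl]].
  by rewrite bernoulli_gf_nil coef1 ler0n.
case: k => [|k]; first by rewrite bernoulli_gf_coef0 mulr_ge0 ?IH// subr_ge0.
by rewrite bernoulli_gf_coefS addr_ge0 ?mulr_ge0 ?IH// subr_ge0.
Qed.

Lemma horner_bernoulli_gf l t :
  (bernoulli_gf l).[t] = \prod_(s <- l) (1 + (t - 1) * s).
Proof.
rewrite /bernoulli_gf horner_prod; apply: eq_bigr => s _.
by rewrite !hornerE; ring.
Qed.

Lemma bernoulli_gf1 l : (bernoulli_gf l).[1] = 1.
Proof.
by rewrite horner_bernoulli_gf big1_seq// => s _; rewrite subrr mul0r addr0.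
Qed.

Lemma size_bernoulli_gf l : (size (bernoulli_gf l) <= (size l).+1)%N.
Proof.
elim: l => [|s l IH]; first by rewrite bernoulli_gf_nil size_poly1.
rewrite bernoulli_gf_cons (leq_trans (size_polyMleq _ _))//=.
have h : (size ((1 - s)%:P + s *: 'X : {poly R})%R <= 2)%N.
  rewrite (leq_trans (size_polyD _ _))// geq_max.
  rewrite (leq_trans (size_polyC_leq1 _))//=.
  by rewrite (leq_trans (size_scale_leq _ _))// size_polyX.
rewrite -subn1 leq_subLR.
by rewrite -[(1 + _)%N]/(2 + (size l).+1)%N leq_add.
Qed.

(** The exponential change of measure, factor by factor: weighting outcome k of
    the sum by t^k amounts to tilting every summand. *)
Lemma bernoulli_gf_tilt l t k : 0 < t -> in01 l ->
  (bernoulli_gf l)`_k * t ^+ k =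
  (bernoulli_gf l).[t] * (bernoulli_gf (map (tilt t) l))`_k.
Proof.
move=> t0; elim: l k => [k _|s l IH k /in01_cons[s01 hl]].
  rewrite /= bernoulli_gf_nil hornerC mul1r coef1.
  by case: k => [|k]; rewrite ?expr0 ?mulr1// mul0r.
have d0 : 1 + (t - 1) * s != 0 by rewrite gt_eqF// tilt_den_gt0.
have hE : (bernoulli_gf (s :: l)).[t] =
    (1 + (t - 1) * s) * (bernoulli_gf l).[t].
  by rewrite !horner_bernoulli_gf big_cons.
rewrite hE /=; case: k => [|k].
  rewrite !bernoulli_gf_coef0 -mulrA (IH 0%N hl) /tilt; field; exact: d0.
rewrite !bernoulli_gf_coefS mulrDl -!mulrA (IH k.+1 hl).
rewrite exprS [_ * (t * _)]mulrCA (IH k hl) /tilt; field; exact: d0.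
Qed.

Lemma in01_tilt t (l : seq R) : 0 < t -> in01 l -> in01 (map (tilt t) l).
Proof. by move=> t0 hl _ /mapP[s sl ->]; exact/tilt01/hl. Qed.

(** Convolution with a Bernoulli law preserves log-concavity: the 2 x 2 minors
    of the new sequence are nonnegative combinations of old ones. *)
Lemma log_concave_step (a b : nat -> R) s : 0 <= s <= 1 ->
  (forall k, 0 <= a k) -> log_concave a ->
  b 0%N = (1 - s) * a 0%N ->
  (forall k, b k.+1 = (1 - s) * a k.+1 + s * a k) -> log_concave b.
Proof.
move=> /andP[s0 s1] a0 lca b0 bS i j ij.
have r0 : 0 <= 1 - s by rewrite subr_ge0.
have rr := mulr_ge0 r0 r0; have ss := mulr_ge0 s0 s0; have rs := mulr_ge0 r0 s0.
case: i ij => [|i] ij.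
  case: j ij => [|j] _; first by rewrite mulrC.
  rewrite b0 !bS.
  have h1 := lca 0%N j.+1 (leq0n _).
  rewrite -subr_ge0.
  set D := (X in 0 <= X).
  have -> : D = (1 - s) * (1 - s) * (a 1%N * a j.+1 - a 0%N * a j.+2) +
     (1 - s) * s * (a 1%N * a j) + s * s * (a 0%N * a j) by rewrite /D; ring.
  by rewrite !addr_ge0 ?mulr_ge0// subr_ge0.
case: j ij => [//|j]; rewrite ltnS => ij.
rewrite !bS.
have h1 := lca i.+1 j.+1 ij; have h2 := lca i j ij.
have h3 : a i * a j.+2 <= a i.+2 * a j.
  move: ij; rewrite leq_eqVlt => /predU1P[->|ij]; first by rewrite mulrC.
  apply: (le_trans (lca i j.+1 (leqW (ltnW ij)))).
  by apply: (le_trans (lca i.+1 j ij)).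
rewrite -subr_ge0.
set D := (X in 0 <= X).
have -> : D = (1 - s) * (1 - s) * (a i.+2 * a j.+1 - a i.+1 * a j.+2) +
   s * s * (a i.+1 * a j - a i * a j.+1) +
   (1 - s) * s * (a i.+2 * a j - a i * a j.+2) by rewrite /D; ring.
by rewrite !addr_ge0 ?mulr_ge0// subr_ge0.
Qed.

Lemma bernoulli_gf_log_concave l : in01 l ->
  log_concave (fun k => (bernoulli_gf l)`_k).
Proof.
elim: l => [_ i j ij|s l IH /in01_cons[s01 hl]].
  by rewrite bernoulli_gf_nil !coef1 /= mulr0 mul0r.
apply: (log_concave_step s01 _ (IH hl)).
- by move=> k; exact: bernoulli_gf_coef_ge0.
- exact: bernoulli_gf_coef0.
- exact: bernoulli_gf_coefS.
Qed.

(** After its first strict descent a log-concave sequence can only decrease. *)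
Lemma log_concave_min (a : nat -> R) i k j : (forall n, 0 <= a n) ->
  log_concave a -> (i <= k <= j)%N -> Num.min (a i) (a j) <= a k.
Proof.
move=> a0 lca /andP[ik kj]; rewrite ge_min.
have [//|aki /=] := leP (a i) (a k).
have [n nk an] : exists2 n, (n < k)%N & a n.+1 < a n.
  elim: k ik {kj} aki => [|k IH]; first by rewrite leqn0 => /eqP ->; rewrite ltxx.
  rewrite leq_eqVlt => /predU1P[->|]; first by rewrite ltxx.
  rewrite ltnS => ik aki.
  have [h|h] := ltP (a k) (a i).
    by have [n nk an] := IH ik h; exists n => //; exact: ltnW.
  by exists k => //; apply: lt_le_trans h.
have dec q : (n <= q)%N -> a q.+1 <= a q.
  move=> nq; have n0 : 0 < a n by apply: le_lt_trans an.
  rewrite -(ler_pM2l n0); apply: (le_trans (lca n q nq)).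
  by apply: ler_wpM2r => //; exact: ltW.
move: kj; move=> /subnKC <-; elim: (j - k)%N => [|q IH]; first by rewrite addn0.
by rewrite addnS (le_trans _ IH)// dec// (leq_trans (ltnW nk))// leq_addr.
Qed.

(** Tilting preserves log-concavity, so the tilted coefficients are unimodal as
    well. *)
Lemma bernoulli_gf_tilt_min l t i k j : 0 <= t -> in01 l -> (i <= k <= j)%N ->
  Num.min ((bernoulli_gf l)`_i * t ^+ i) ((bernoulli_gf l)`_j * t ^+ j)
    <= (bernoulli_gf l)`_k * t ^+ k.
Proof.
move=> t0 hl.
apply: (@log_concave_min (fun k => (bernoulli_gf l)`_k * t ^+ k)).
  by move=> n; rewrite mulr_ge0 ?exprn_ge0// bernoulli_gf_coef_ge0.
move=> p q pq; have h := bernoulli_gf_log_concave hl pq.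
rewrite -subr_ge0 !exprS.
set D := (X in 0 <= X).
have -> : D = ((bernoulli_gf l)`_p.+1 * (bernoulli_gf l)`_q -
  (bernoulli_gf l)`_p * (bernoulli_gf l)`_q.+1) * (t * (t ^+ p * t ^+ q)).
  by rewrite /D; ring.
by rewrite mulr_ge0 ?subr_ge0// !mulr_ge0// exprn_ge0.
Qed.

Lemma coef_bernoulli_gf_big l n k : (size l < n)%N -> (n <= k)%N ->
  (bernoulli_gf l)`_k = 0.
Proof.
by move=> ln nk; rewrite nth_default// (leq_trans (size_bernoulli_gf l))//
  (leq_trans ln).
Qed.

Lemma sum_bernoulli_gf l (f : nat -> R) n : (size l < n)%N ->
  \sum_(k < n) f k * (bernoulli_gf l)`_k =
  \sum_(k < (size l).+1) f k * (bernoulli_gf l)`_k.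
Proof.
move=> ln; rewrite -!(big_mkord xpredT (fun k => f k * (bernoulli_gf l)`_k)).
rewrite (big_cat_nat (n := (size l).+1))//= [X in _ + X]big_nat_cond.
rewrite [X in _ + X]big1 ?addr0// => k /andP[/andP[lk _] _].
by rewrite (coef_bernoulli_gf_big (n := (size l).+1))// mulr0.
Qed.

Lemma sum_bernoulli_gf_cons s l (f : nat -> R) :
  \sum_(k < (size l).+2) f k * (bernoulli_gf (s :: l))`_k =
  (1 - s) * (\sum_(k < (size l).+1) f k * (bernoulli_gf l)`_k) +
  s * (\sum_(k < (size l).+1) f k.+1 * (bernoulli_gf l)`_k).
Proof.
rewrite big_ord_recl bernoulli_gf_coef0.
rewrite -(@sum_bernoulli_gf l f (size l).+2)// [in RHS]big_ord_recl.
rewrite mulrDr !mulr_sumr -addrA -big_split /=; congr (_ + _); first by ring.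
by apply: eq_bigr => k _; rewrite /bump /= add1n bernoulli_gf_coefS; ring.
Qed.

Lemma bernoulli_gf_sum l : \sum_(k < (size l).+1) (bernoulli_gf l)`_k = 1.
Proof.
rewrite -(bernoulli_gf1 l) (horner_coef_wide _ (size_bernoulli_gf l)).
by apply: eq_bigr => k _; rewrite expr1n mulr1.
Qed.

Lemma bernoulli_gf_coef_le1 (l : seq R) k : in01 l -> (bernoulli_gf l)`_k <= 1.
Proof.
move=> hl; have [kl|kl] := ltnP k (size l).+1; last first.
  by rewrite (coef_bernoulli_gf_big (n := (size l).+1)).
rewrite -(bernoulli_gf_sum l) (bigD1 (Ordinal kl))//= lerDl sumr_ge0// => i _.
exact: bernoulli_gf_coef_ge0.
Qed.

(** The coefficients are the law of a sum of independent Bernoulli variables: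
    the mean square distance to c is the variance plus the squared bias. The
    induction conditions on one variable. *)
Lemma bernoulli_gf_variance l (c : R) :
  \sum_(k < (size l).+1) (k%:R - c) ^+ 2 * (bernoulli_gf l)`_k =
  \sum_(s <- l) s * (1 - s) + (\sum_(s <- l) s - c) ^+ 2.
Proof.
elim: l c => [|s l IH] c.
  by rewrite big_ord1 bernoulli_gf_nil coef1 !big_nil /=; ring.
rewrite /= (sum_bernoulli_gf_cons s l (fun k => (k%:R - c) ^+ 2)) IH.
under [in X in _ + s * X]eq_bigr => k _.
  have -> : (k.+1%:R - c) ^+ 2 = (k%:R - (c - 1)) ^+ 2 :> R.
    by rewrite -natr1; ring.
  over.
by rewrite IH !big_cons; ring.
Qed.

(** Chebyshev puts half of the mass within d of c, on at most size l + 1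
    indices, so one of them carries its share. *)
Lemma bernoulli_gf_chebyshev l (c d : R) : 0 < d -> in01 l ->
  (\sum_(s <- l) s * (1 - s) + (\sum_(s <- l) s - c) ^+ 2) < d ^+ 2 / 2 ->
  exists2 k, (k <= size l)%N & `|k%:R - c| < d /\
     1 <= 2 * (size l).+1%:R * (bernoulli_gf l)`_k.
Proof.
move=> d0 hl hv; apply/not_exists2P => hk.
have : \sum_(k < (size l).+1) (bernoulli_gf l)`_k <=
   \sum_(k < (size l).+1) (((k%:R - c) ^+ 2 * (bernoulli_gf l)`_k) / d ^+ 2
      + (2 * (size l).+1%:R)^-1).
  apply: ler_sum => k _.
  have b0 := bernoulli_gf_coef_ge0 k hl.
  have n0 : 0 < 2 * (size l).+1%:R :> R by rewrite mulr_gt0.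
  have [kl|kl] := ltP (`|k%:R - c|) d; last first.
    rewrite -[leLHS]addr0; apply: lerD; last by rewrite invr_ge0 ltW.
    rewrite mulrAC ler_peMl// ler_pdivlMr ?exprn_gt0// mul1r.
    rewrite -[leRHS]real_normK ?num_real//.
    by apply: lerXn2r => //; rewrite nnegrE ?ltW.
  rewrite -[leLHS]add0r; apply: lerD.
    by apply: divr_ge0; [apply: mulr_ge0 => //; exact: sqr_ge0|exact: sqr_ge0].
  have [hkn|/not_andP[//|/negP]] := hk k.
    by case: hkn; rewrite -ltnS.
  by rewrite -ltNge => h; rewrite -[leRHS]mul1r ler_pdivlMr// mulrC ltW.
rewrite bernoulli_gf_sum big_split /= -mulr_suml bernoulli_gf_variance.
rewrite sumr_const card_ord.
set V := \sum_(s <- l) s * (1 - s) + _ in hv *.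
have d20 : 0 < d ^+ 2 by rewrite exprn_gt0.
have : V / d ^+ 2 < 2^-1 by rewrite ltr_pdivrMr// [ltRHS]mulrC.
have -> : (2 * (size l).+1%:R)^-1 *+ (size l).+1 = 2^-1 :> R.
  by rewrite -[LHS]mulr_natr invfM -mulrA mulVf ?mulr1// pnatr_eq0.
lra.
Qed.

End BernoulliGF.

(** * Bernstein approximation on [0, 1] *)

Section Bernstein.
Variable R : realType.
Implicit Types (f : R -> R) (e x : R).

Local Notation I01 := (`[(0:R), 1]%classic).

Lemma within_continuousP f : {within I01, continuous f} <->
  forall x e : R, 0 <= x <= 1 -> 0 < e ->
    \forall y \near x, 0 <= y <= 1 -> `|f x - f y| < e.
Proof.
split=> [/subspace_continuousP cf x e x01 e0|h].
  have Ax : I01 x by rewrite /= in_itv.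
  have /cvgrPdist_lt /(_ _ e0) := cf x Ax; rewrite near_withinE.
  by apply: filterS => y h y01; apply: h; rewrite /= in_itv.
apply/subspace_continuousP => x Ax.
apply/cvgrPdist_lt => e e0; rewrite near_withinE.
have x01 : 0 <= x <= 1 by move: Ax; rewrite /= in_itv.
apply: filterS (h x e x01 e0) => y hy /=; rewrite in_itv/=; exact: hy.
Qed.

(** Heine's theorem, from the filter form of the compactness of [0, 1]. *)
Lemma within_unif_continuous f e : {within I01, continuous f} -> 0 < e ->
  exists2 d : R, 0 < d & forall x y : R, 0 <= x <= 1 -> 0 <= y <= 1 -> `|x - y| < d ->
    `|f x - f y| < e.
Proof.
move=> /within_continuousP cf e0.
have := @segment_compact R 0 1 => /compact_near_coveringP.
move=> /(_ R (0^'+) (fun d x => 0 <= x <= 1 -> forall y, 0 <= y <= 1 ->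
   `|x - y| < d -> `|f x - f y| < e)) h.
have : \forall d \near (0:R)^'+, forall x, I01 x -> 0 <= x <= 1 ->
   forall y, 0 <= y <= 1 -> `|x - y| < d -> `|f x - f y| < e.
  apply: h => x; rewrite /= in_itv/= => x01.
  have e20 : 0 < e / 2 by rewrite divr_gt0.
  have /nbhs_ballP[r /= r0 hr] := cf x (e / 2) x01 e20.
  exists (ball x (r / 2), [set d | 0 < d < r / 2]) => /=.
    split; first by apply: nbhsx_ballx; rewrite divr_gt0.
    by near=> d; apply/andP; split; near: d;
      [exact: nbhs_right_gt|apply: nbhs_right_lt; rewrite divr_gt0].
  move=> [x' d] /= [xx' /andP[d0 dr]] x'01 y y01 xy.
  have h1 : `|f x - f x'| < e / 2.
    by apply: hr => //; apply: le_ball xx'; rewrite ler_pdivrMr// ler_peMr ?ltW// ltr1n.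
  have h2 : `|f x - f y| < e / 2.
    apply: hr => //; rewrite /ball/= in xx' *.
    have -> : x - y = (x - x') + (x' - y) by ring.
    by rewrite (le_lt_trans (ler_normD _ _))//; lra.
  have -> : f x' - f y = (f x - f y) - (f x - f x') by ring.
  by rewrite (le_lt_trans (ler_normB _ _))//; lra.
move=> hd.
near (0:R)^'+ => d.
have hd' : forall x, I01 x -> 0 <= x <= 1 -> forall y, 0 <= y <= 1 ->
  `|x - y| < d -> `|f x - f y| < e by near: d.
exists d; first by near: d; exact: nbhs_right_gt.
by move=> x y x01 y01; apply: hd' => //; rewrite /= in_itv.
Unshelve. all: by end_near. Qed.

Lemma within_bounded f : {within I01, continuous f} ->
  exists2 B : R, 0 < B & forall x : R, 0 <= x <= 1 -> `|f x| <= B.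
Proof.
move=> cf.
have := @continuous_compact _ _ f I01 cf (@segment_compact R 0 1).
move=> /compact_bounded[B [_ hB]].
exists (`|B| + 1) => [|x x01]; first by rewrite ltr_wpDl.
apply: (hB (`|B| + 1)); first by rewrite (le_lt_trans (ler_norm _))// ltrDl.
by exists x => //=; rewrite in_itv.
Qed.

(** This is what makes the Bernstein average of a function a polynomial. *)
Lemma bernoulli_gf_nseq_poly N : exists B : nat -> {poly R},
  forall k x, (B k).[x] = (bernoulli_gf (nseq N x))`_k.
Proof.
elim: N => [|N [B hB]].
  exists (fun k => ((k == 0%N)%:R)%:P) => k x.
  by rewrite bernoulli_gf_nil coef1 hornerC.
exists (fun k => (1 - 'X) * B k + if k is k'.+1 then 'X * B k' else 0) => k x.
case: k => [|k]; rewrite !hornerE !hB /=.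
  by rewrite bernoulli_gf_coef0.
by rewrite bernoulli_gf_coefS.
Qed.

Lemma in01_nseq N x : 0 <= x <= 1 -> in01 (nseq N x).
Proof. by move=> x01 s; rewrite mem_nseq => /andP[_ /eqP ->]. Qed.

(** Bernstein's argument: average f over a binomial law of parameter x. Near x
    use uniform continuity, and away from x Chebyshev's weight, whose total is
    the variance. *)
Theorem weierstrass_approx f e : {within I01, continuous f} -> 0 < e ->
  exists p : {poly R}, forall x, 0 <= x <= 1 -> `|f x - p.[x]| <= e.
Proof.
move=> cf e0.
have e20 : 0 < e / 2 by rewrite divr_gt0.
have [d d0 hd] := within_unif_continuous cf e20.
have [B B0 hB] := within_bounded cf.
have [n n0 hN] : exists2 n : nat, 0 < n%:R :> R & 4 * B / (d ^+ 2 * e) < n%:R.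
  exists (Num.truncn (4 * B / (d ^+ 2 * e))).+1 => //; exact: truncnS_gt.
have [b hb] := bernoulli_gf_nseq_poly n.
exists (\sum_(k < n.+1) (f (k%:R / n%:R))%:P * b k) => x x01.
pose l := nseq n x; have hl : in01 l := in01_nseq (N := n) x01.
have sl : size l = n by rewrite size_nseq.
have d20 : 0 < d ^+ 2 by rewrite exprn_gt0.
have sum1 := bernoulli_gf_sum l; rewrite sl in sum1.
have -> : f x = \sum_(k < n.+1) f x * (bernoulli_gf l)`_k.
  by rewrite -mulr_sumr sum1 mulr1.
rewrite horner_sum -sumrB.
apply: (le_trans (ler_norm_sum _ _ _)).
have : \sum_(k < n.+1) `|f x * (bernoulli_gf l)`_k -
     ((f (k%:R / n%:R))%:P * b k).[x]| <=
   \sum_(k < n.+1) (e / 2 * (bernoulli_gf l)`_k +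
      2 * B / (d * n%:R) ^+ 2 * ((k%:R - x * n%:R) ^+ 2 * (bernoulli_gf l)`_k)).
  apply: ler_sum => k _.
  have b0 := bernoulli_gf_coef_ge0 k hl.
  rewrite hornerM hornerC hb -mulrBl normrM (ger0_norm b0) mulrA -mulrDl.
  apply: ler_wpM2r => //.
  have kn01 : 0 <= (k%:R / n%:R : R) <= 1.
    by rewrite divr_ge0//= ler_pdivrMr// mul1r ler_nat -ltnS.
  have c0 : 0 <= 2 * B / (d * n%:R) ^+ 2 * (k%:R - x * n%:R) ^+ 2.
    by rewrite mulr_ge0 ?sqr_ge0// divr_ge0 ?sqr_ge0// mulr_ge0 ?ltW.
  have [h|h] := ltP `|x - k%:R / n%:R| d.
    by rewrite -[leLHS]addr0 lerD// ltW// hd.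
  apply: (@le_trans _ _ (2 * B)).
    rewrite (le_trans (ler_normB _ _))// mulrDl mul1r lerD// hB//.
  rewrite -[leLHS]add0r lerD//; first exact: ltW.
  rewrite -mulrA ler_peMr//; first by rewrite mulr_ge0 ?ltW.
  rewrite mulrC ler_pdivlMr ?exprn_gt0 ?mulr_gt0// mul1r.
  rewrite -[leRHS]real_normK ?num_real//.
  apply: lerXn2r; rewrite ?nnegrE ?normr_ge0 ?(ltW (mulr_gt0 d0 n0))//.
  have -> : k%:R - x * n%:R = - ((x - k%:R / n%:R) * n%:R).
    by field; rewrite gt_eqF.
  by rewrite normrN normrM (gtr0_norm n0) ler_wpM2r// ltW.
move=> /le_trans; apply.
rewrite big_split /= -!mulr_sumr.
rewrite sum1.
have := bernoulli_gf_variance l (x * n%:R); rewrite sl => ->.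
have -> : \sum_(s <- l) s = x * n%:R :> R.
  by rewrite big_nseq iter_addr_0 mulr_natr.
rewrite subrr expr0n /= addr0 mulr1.
have -> : \sum_(s <- l) s * (1 - s) = x * (1 - x) * n%:R :> R.
  by rewrite big_nseq iter_addr_0 mulr_natr.
have x1 : x * (1 - x) <= 1 by nra.
have : 2 * B / (d * n%:R) ^+ 2 * (x * (1 - x) * n%:R) <= 2 * B / (d ^+ 2 * n%:R).
  have -> : 2 * B / (d * n%:R) ^+ 2 * (x * (1 - x) * n%:R) =
    2 * B / (d ^+ 2 * n%:R) * (x * (1 - x)).
    by field; rewrite ?gt_eqF.
  by rewrite ler_piMr// divr_ge0// mulr_ge0 ?ltW.
have : 2 * B / (d ^+ 2 * n%:R) < e / 2.
  rewrite ltr_pdivrMr ?mulr_gt0//.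
  by move: hN; rewrite ltr_pdivrMr ?mulr_gt0//; lra.
lra.
Qed.

End Bernstein.

(** * Expectations of functions of a [0, 1]-valued variable *)

Section Mean.
Variables (R : realType) (d : measure_display) (T : measurableType d).
Variables (P : probability T R) (X : T -> R).
Hypothesis mX : measurable_fun setT X.
Hypothesis X01 : forall w, 0 <= X w <= 1.
Implicit Types (f g : R -> R) (u v x : R).

Local Notation I01 := (`[(0:R), 1]%classic).

Definition mean f : R := (\int[P]_w f (X w))%R.

Definition mean_integrable f : Prop := P.-integrable setT (fun w => (f (X w))%:E).

Lemma measurable_comp01 f : measurable_fun I01 f ->
  measurable_fun setT (fun w => f (X w)).
Proof.
move=> mf; apply: (measurable_comp _ _ mf) => //.
by move=> _ [w _ <-]; rewrite /= in_itv /= X01.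
Qed.

Lemma mean_integrable_bounded f (B : R) : measurable_fun I01 f ->
  (forall x, 0 <= x <= 1 -> `|f x| <= B) -> mean_integrable f.
Proof.
move=> mf fB; rewrite /mean_integrable.
apply: (@measurable_bounded_integrable _ _ _ P (f \o X)) => //.
- by rewrite (le_lt_trans (probability_le1 P measurableT))// ltry.
- exact: measurable_comp01.
- exists B; split; first by rewrite num_real.
  by move=> B' BB' w _ /=; rewrite (le_trans (fB _ (X01 w)))// ltW.
Qed.

Lemma mean_integrable_continuous f : {within I01, continuous f} -> mean_integrable f.
Proof.
move=> cf; have [B _ fB] := within_bounded cf.
by apply: (mean_integrable_bounded _ fB); exact: subspace_continuous_measurable_fun.
Qed.

Lemma mean_cst c : mean (fun=> c) = c.
Proof.
rewrite /mean Rintegral_cst//; set q := (X in fine X).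
by have -> : q = 1%E; [exact: probability_setT|rewrite mulr1].
Qed.

Lemma mean_integrableD f g : mean_integrable f -> mean_integrable g -> mean_integrable (fun x => f x + g x).
Proof. by move=> hf hg; have := integrableD measurableT hf hg. Qed.

Lemma mean_integrableZ c f : mean_integrable f -> mean_integrable (fun x => c * f x).
Proof. by move=> hf; have := integrableZl measurableT c hf. Qed.

Lemma meanD f g : mean_integrable f -> mean_integrable g ->
  mean (fun x => f x + g x) = mean f + mean g.
Proof. by move=> hf hg; rewrite /mean (RintegralD (f1 := f \o X) (f2 := g \o X)). Qed.

Lemma meanZ c f : mean_integrable f -> mean (fun x => c * f x) = c * mean f.
Proof. by move=> hf; rewrite /mean (RintegralZl (f := f \o X)). Qed.

Lemma eq_mean f g : (forall x, 0 <= x <= 1 -> f x = g x) -> mean f = mean g.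
Proof. by move=> fg; apply: eq_Rintegral => w _; rewrite fg. Qed.

Lemma mean_integrableB f g : mean_integrable f -> mean_integrable g -> mean_integrable (fun x => f x - g x).
Proof. by move=> hf hg; have := integrableB measurableT hf hg. Qed.

Lemma meanB f g : mean_integrable f -> mean_integrable g ->
  mean (fun x => f x - g x) = mean f - mean g.
Proof.
move=> hf hg; rewrite -(mulN1r (mean g)) -(meanZ _ hg) -meanD//.
  by apply: eq_mean => x _; rewrite mulN1r.
exact: mean_integrableZ.
Qed.

Lemma le_mean f g : mean_integrable f -> mean_integrable g ->
  (forall x, 0 <= x <= 1 -> f x <= g x) -> mean f <= mean g.
Proof.
by move=> hf hg fg; apply: (le_Rintegral (f1 := f \o X) (f2 := g \o X)) => // w _; exact: fg.
Qed.

Lemma mean_integrable_cst c : mean_integrable (fun=> c).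
Proof. by apply: mean_integrable_continuous; apply: continuous_subspaceT => x; exact: cvg_cst. Qed.

Lemma mean_norm_le f B : mean_integrable f ->
  (forall x, 0 <= x <= 1 -> `|f x| <= B) -> `|mean f| <= B.
Proof.
move=> hf fB.
have h : mean (fun=> - B) <= mean f <= mean (fun=> B).
  apply/andP; split; apply: le_mean => //; try exact: mean_integrable_cst.
  - by move=> x /fB; rewrite ler_norml => /andP[].
  - by move=> x /fB; rewrite ler_norml => /andP[].
by rewrite ler_norml; rewrite !mean_cst in h.
Qed.

Lemma mean_integrable_horner (p : {poly R}) : mean_integrable (fun x => p.[x]).
Proof. apply: mean_integrable_continuous; exact/continuous_subspaceT/continuous_horner. Qed.

Lemma mean_integrable_sum (I : Type) (r : seq I) (F : I -> R -> R) :
  (forall i, mean_integrable (F i)) -> mean_integrable (fun x => \sum_(i <- r) F i x).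
Proof.
move=> hF; elim: r => [|i r IH].
  rewrite (_ : (fun x => _) = fun=> 0); first exact: mean_integrable_cst.
  by apply/funext => x; rewrite big_nil.
rewrite (_ : (fun x => _) = fun x => F i x + \sum_(j <- r) F j x).
  exact: mean_integrableD.
by apply/funext => x; rewrite big_cons.
Qed.

Lemma mean_sum (I : Type) (r : seq I) (F : I -> R -> R) :
  (forall i, mean_integrable (F i)) ->
  mean (fun x => \sum_(i <- r) F i x) = \sum_(i <- r) mean (F i).
Proof.
move=> hF; elim: r => [|i r IH].
  by rewrite big_nil -[RHS](mean_cst 0); apply: eq_mean => x _; rewrite big_nil.
rewrite big_cons -IH -meanD//; last exact: mean_integrable_sum.
by apply: eq_mean => x _; rewrite big_cons.
Qed.

Lemma mean_horner (p : {poly R}) :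
  mean (fun x => p.[x]) = \sum_(i < size p) p`_i * mean (fun x => x ^+ i).
Proof.
have ok i : mean_integrable (fun x => x ^+ i).
  by apply: mean_integrable_continuous; apply: continuous_subspaceT; exact: exprn_continuous.
rewrite (@eq_mean (fun x => p.[x]) (fun x => \sum_(i < size p) p`_i * x ^+ i)).
  by rewrite mean_sum => [|i]; [apply: eq_bigr => i _; exact: meanZ|exact: mean_integrableZ].
by move=> x _; rewrite horner_coef.
Qed.

Lemma mean_dominated_cvg (f_ : nat -> R -> R) f (B : R) :
  (forall n, mean_integrable (f_ n)) -> mean_integrable f ->
  (forall n x, 0 <= x <= 1 -> `|f_ n x| <= B) ->
  (forall x, 0 <= x <= 1 -> f_ n x @[n --> \oo] --> f x) ->
  mean (f_ n) @[n --> \oo] --> mean f.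
Proof.
move=> okf_ okf bf cf.
have cv : {ae P, forall w, setT w ->
    (fun n => (f_ n (X w))%:E) @ \oo --> (f (X w))%:E}.
  apply: aeW => w _; apply: cvg_EFin; first exact: nearW.
  by apply: cf.
have bd : {ae P, forall w n, setT w -> (`|(f_ n (X w))%:E| <= cst B%:E w)%E}.
  by apply: aeW => w n _; rewrite lee_fin; exact: bf.
have mf_ n := measurable_int _ (okf_ n).
have [_ _ h] := dominated_convergence measurableT mf_ (measurable_int _ okf) cv
  (mean_integrable_cst B) bd.
apply: fine_cvg; rewrite fineK//.
exact: (integrable_fin_num measurableT okf).
Qed.

(** The uniform bound K on the derivative is the dominating function. *)
Lemma is_derive_mean (F F' : R -> R -> R) (K u : R) :
  (forall v, {within I01, continuous (F v)}) ->
  (forall v x, 0 <= x <= 1 -> is_derive v 1 (F^~ x) (F' v x)) ->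
  (forall v x, 0 <= x <= 1 -> `|F' v x| <= K) ->
  is_derive u 1 (fun v => mean (F v)) (mean (F' u)).
Proof.
move=> cF dF bF.
have uI : `](u - 1), (u + 1)[%classic u.
  by rewrite /= in_itv /= ltrBlDr !ltrDl ltr01.
have H0 v : `](u - 1), (u + 1)[%classic v ->
    P.-integrable setT (EFin \o (fun w => F v (X w))).
  by move=> _; exact: mean_integrable_continuous.
have dE v x : 0 <= x <= 1 -> derive1 (F^~ x) v = F' v x.
  by move=> x01; rewrite derive1E; have := dF v x x01 => -[_ ->].
have H1 v w : `](u - 1), (u + 1)[%classic v -> setT w ->
    derivable (fun v => F v (X w)) v 1.
  by move=> _ _; have [] := dF v _ (X01 w).
have H3 v w : `](u - 1), (u + 1)[%classic v -> setT w ->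
    `|derive1 (fun v => F v (X w)) v| <= `|K|.
  by move=> _ _; rewrite (dE _ _ (X01 w)) (le_trans (bF _ _ (X01 w)))// ler_norm.
have H2 : P.-integrable setT (EFin \o (fun w : T => `|K|)).
  exact: mean_integrable_cst.
have := @derivable_under_integral R _ _ P (fun v w => F v (X w)) setT measurableT
   u _ _ uI H0 H1 (fun=> `|K|) (fun=> normr_ge0 K) H2 H3.
have := @differentiation_under_integral R _ _ P (fun v w => F v (X w)) setT measurableT
   u _ _ uI H0 H1 (fun=> `|K|) (fun=> normr_ge0 K) H2 H3.
move=> h1 h2; apply: DeriveDef => //; rewrite -derive1E h1.
apply: eq_Rintegral => w _; rewrite /partial1of2; exact: dE.
Qed.

End Mean.

(** * Logistic kernels and tilted moments *)

Section PointwiseDerivatives.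
Variable R : realType.
Implicit Types (f g : R -> R) (x a b : R).

Lemma is_derive_add f g x a b : is_derive x 1 f a -> is_derive x 1 g b ->
  is_derive x 1 (fun y => f y + g y) (a + b).
Proof. by move=> hf hg; apply: is_deriveD. Qed.

Lemma is_derive_sub f g x a b : is_derive x 1 f a -> is_derive x 1 g b ->
  is_derive x 1 (fun y => f y - g y) (a - b).
Proof. by move=> hf hg; apply: is_deriveB. Qed.

Lemma is_derive_mul f g x a b : is_derive x 1 f a -> is_derive x 1 g b ->
  is_derive x 1 (fun y => f y * g y) (a * g x + f x * b).
Proof.
move=> hf hg; apply: (is_derive_eq (is_deriveM hf hg)).
by rewrite addrC; congr (_ + _); exact: mulrC.
Qed.

Lemma is_derive_inv f x a : f x != 0 -> is_derive x 1 f a ->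
  is_derive x 1 (fun y => (f y)^-1) (- (f x) ^- 2 * a).
Proof. exact: is_deriveV. Qed.

Lemma is_derive_comp f g x a b : is_derive (g x) 1 f a -> is_derive x 1 g b ->
  is_derive x 1 (fun y => f (g y)) (a * b).
Proof. by move=> hf hg; apply: (is_derive1_comp (f := f) (g := g)). Qed.

Lemma is_derive_continuous f x a : is_derive x 1 f a -> {for x, continuous f}.
Proof. by move=> -[df _]; exact/differentiable_continuous/derivable1_diffP. Qed.

Lemma is_derive1E f x a : is_derive x 1 f a -> derive1 f x = a.
Proof. by rewrite derive1E => -[_ ->]. Qed.

End PointwiseDerivatives.

Section Kernels.
Variable R : realType.
Implicit Types (u t x : R).

Local Notation I01 := (`[(0:R), 1]%classic).

Lemma tilt0 t : tilt t 0 = 0 :> R.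
Proof. by rewrite /tilt mulr0 mul0r. Qed.

Lemma tilt1 t : t != 0 -> tilt t 1 = 1 :> R.
Proof. by move=> t0; rewrite /tilt !mulr1 addrC subrK divff. Qed.

Lemma tilt1l x : tilt 1 x = x.
Proof. by rewrite /tilt subrr mul0r addr0 mul1r divr1. Qed.

Lemma is_derive_tilt_den x u :
  is_derive u 1 (fun v => 1 + (expR v - 1) * x) (expR u * x).
Proof.
have h1 := is_derive_sub (is_derive_expR u) (is_derive_cst (1 : R) u 1).
have h2 := is_derive_mul h1 (is_derive_cst x u 1).
apply: (is_derive_eq (is_derive_add (is_derive_cst (1 : R) u 1) h2)).
by rewrite subr0 mulr0 addr0 add0r.
Qed.

(** The tilted parameter solves the logistic equation in the log-parameter. *)
Lemma is_derive_tilt x u : 0 <= x <= 1 ->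
  is_derive u 1 (fun v => tilt (expR v) x)
    (tilt (expR u) x * (1 - tilt (expR u) x)).
Proof.
move=> x01; have d0 := tilt_den_gt0 (expR_gt0 u) x01.
have h1 := is_derive_mul (is_derive_expR u) (is_derive_cst x u 1).
have h2 := is_derive_inv (f := fun v => 1 + (expR v - 1) * x) (lt0r_neq0 d0) (is_derive_tilt_den x u).
rewrite /tilt; apply: (is_derive_eq (is_derive_mul h1 h2)).
by rewrite /cst; field; rewrite gt_eqF.
Qed.

Lemma is_derive_tilt_pow k x u : 0 <= x <= 1 ->
  is_derive u 1 (fun v => tilt (expR v) x ^+ k)
    (k%:R * (tilt (expR u) x ^+ k - tilt (expR u) x ^+ k.+1)).
Proof.
move=> x01; elim: k => [|k IH].
  by rewrite mul0r; apply: is_derive_cst.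
have -> : (fun v => tilt (expR v) x ^+ k.+1) =
    (fun v => tilt (expR v) x * tilt (expR v) x ^+ k).
  by apply/funext => v; rewrite exprS.
apply: (is_derive_eq (is_derive_mul (is_derive_tilt u x01) IH)).
by rewrite -natr1 !exprS; ring.
Qed.

Lemma is_derive_ln_tilt_den x u : 0 <= x <= 1 ->
  is_derive u 1 (fun v => ln (1 + (expR v - 1) * x)) (tilt (expR u) x).
Proof.
move=> x01; have d0 := tilt_den_gt0 (expR_gt0 u) x01.
apply: (is_derive_eq (is_derive_comp (g := fun v => 1 + (expR v - 1) * x)
  (is_derive1_ln d0) (is_derive_tilt_den x u))).
by rewrite mulrC.
Qed.

Lemma tilt_den_continuous t : continuous (fun x : R => 1 + (t - 1) * x).
Proof.
move=> x; apply: cvgD; first exact: cvg_cst.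
by apply: cvgM; [exact: cvg_cst|exact: cvg_id].
Qed.

Lemma tilt_continuous t : 0 < t -> {within I01, continuous (tilt t)}.
Proof.
move=> t0; apply: continuous_in_subspaceT => x; rewrite inE /= in_itv /= => x01.
apply: cvgM; first by apply: cvgM; [exact: cvg_cst|exact: cvg_id].
apply: cvgV; first by rewrite gt_eqF// tilt_den_gt0.
exact: tilt_den_continuous.
Qed.

Lemma tilt_pow_continuous t k : 0 < t ->
  {within I01, continuous (fun x => tilt t x ^+ k)}.
Proof.
move=> t0; elim: k => [|k IH].
  by apply: continuous_subspaceT => x; exact: cvg_cst.
have -> : (fun x => tilt t x ^+ k.+1) = (fun x => tilt t x * tilt t x ^+ k).
  by apply/funext => v; rewrite exprS.
by move=> x; apply: cvgM; [exact: tilt_continuous|exact: IH].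
Qed.

Lemma ln_tilt_den_continuous t : 0 < t ->
  {within I01, continuous (fun x => ln (1 + (t - 1) * x))}.
Proof.
move=> t0; apply: continuous_in_subspaceT => x; rewrite inE /= in_itv /= => x01.
apply: (continuous_comp (f := fun x => 1 + (t - 1) * x) (g := @ln R)).
  exact: tilt_den_continuous.
by apply: continuous_ln; exact: tilt_den_gt0.
Qed.

(** Exchanging the two outcomes of a Bernoulli variable reverses the tilt; this
    deduces statements at +oo from those at -oo. *)
Lemma tilt_compl u x : 0 <= x <= 1 ->
  tilt (expR (- u)) (1 - x) = 1 - tilt (expR u) x.
Proof.
move=> x01; have d0 := tilt_den_gt0 (expR_gt0 u) x01.
have e0 : expR u != 0 by rewrite gt_eqF// expR_gt0.
have d1 : expR u - (expR u - 1) * (1 - x) != 0.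
  by have -> : expR u - (expR u - 1) * (1 - x) = 1 + (expR u - 1) * x; [ring|rewrite gt_eqF].
rewrite expRN /tilt.
have -> : 1 + ((expR u)^-1 - 1) * (1 - x) = (1 + (expR u - 1) * x) / expR u.
  by field.
by field; rewrite e0 gt_eqF.
Qed.

End Kernels.

Section Transforms.
Variables (R : realType) (d : measure_display) (T : measurableType d).
Variables (P : probability T R) (X : T -> R).
Hypothesis mX : measurable_fun setT X.
Hypothesis X01 : forall w, 0 <= X w <= 1.
Implicit Types (u v x : R).

Local Notation I01 := (`[(0:R), 1]%classic).
Local Notation E := (mean P X).

(** For a sum S of n independent Bernoulli variables whose parameters are
    distributed as X, logmgf is the n-th part of ln E exp(u S), and
    tilted_moment 1 is the n-th part of the mean of S after tilting by exp u. *)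
Definition logmgf u : R := E (fun x => ln (1 + (expR u - 1) * x)).
Definition tilted_moment k u : R := E (fun x => tilt (expR u) x ^+ k).
Local Notation A := tilted_moment.

Let A_ok k u : mean_integrable P X (fun x => tilt (expR u) x ^+ k).
Proof.
by apply: mean_integrable_continuous => //; apply: tilt_pow_continuous; exact: expR_gt0.
Qed.

Lemma tilt_pow_norm_le1 k u x : 0 <= x <= 1 -> 0 <= tilt (expR u) x ^+ k <= 1.
Proof.
by move=> /(tilt01 (expR_gt0 u)) /andP[p0 p1]; rewrite exprn_ge0//= exprn_ile1.
Qed.

Lemma is_derive_tilted_moment k u :
  is_derive u 1 (A k) (k%:R * (A k u - A k.+1 u)).
Proof.
have -> : k%:R * (A k u - A k.+1 u) = E (fun x =>
    k%:R * (tilt (expR u) x ^+ k - tilt (expR u) x ^+ k.+1)).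
  rewrite meanZ; last first.
    by apply: mean_integrableB.
  by rewrite meanB.
apply: (@is_derive_mean _ _ _ P X mX X01 (fun u x => tilt (expR u) x ^+ k)
  (fun u x => k%:R * (tilt (expR u) x ^+ k - tilt (expR u) x ^+ k.+1)) k%:R).
- by move=> v; apply: tilt_pow_continuous; exact: expR_gt0.
- by move=> v x; exact: is_derive_tilt_pow.
- move=> v x x01; rewrite normrM normr_nat ler_piMr//.
  have /andP[a0 a1] := tilt_pow_norm_le1 k v x01.
  have /andP[b0 b1] := tilt_pow_norm_le1 k.+1 v x01.
  by rewrite ler_norml; apply/andP; split; lra.
Qed.

Lemma is_derive_logmgf u : is_derive u 1 logmgf (A 1 u).
Proof.
apply: (@is_derive_mean _ _ _ P X mX X01 (fun u x => ln (1 + (expR u - 1) * x))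
  (fun u x => tilt (expR u) x ^+ 1) 1).
- by move=> v; apply: ln_tilt_den_continuous; exact: expR_gt0.
- by move=> v x x01; rewrite expr1; exact: is_derive_ln_tilt_den.
- by move=> v x x01; have /andP[a0 a1] := tilt_pow_norm_le1 1 v x01; rewrite ger0_norm.
Qed.

Lemma logmgf0 : logmgf 0 = 0.
Proof.
rewrite /logmgf -[RHS](mean_cst P X 0); apply: eq_mean => // x _.
by rewrite expR0 subrr mul0r addr0 ln1.
Qed.

Lemma tilted_moment0 k : A k 0 = E (fun x => x ^+ k).
Proof. by apply: eq_mean => // x _; rewrite expR0 tilt1l. Qed.

End Transforms.

(** * Monotonicity and end points of the tilted mean *)

Section DerivativeSign.
Variable R : realType.
Implicit Types (f : R -> R).

Lemma MVT_R f (f' : R -> R) (a b : R) : (forall x : R, is_derive x 1 f (f' x)) -> a < b ->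
  exists2 c, a < c < b & f b - f a = f' c * (b - a).
Proof.
move=> df ab; have [c cab fE] := @MVT R f f' a b ab (fun x _ => df x)
  (continuous_subspaceT (fun x => is_derive_continuous (df x))).
by exists c => //; move: cab; rewrite in_itv.
Qed.

Lemma is_derive_gt0_homo f (f' : R -> R) : (forall x : R, is_derive x 1 f (f' x)) ->
  (forall x, 0 < f' x) -> {homo f : x y / x < y}.
Proof.
move=> df f'0 x y xy; have [c _ fE] := MVT_R df xy.
by rewrite -subr_gt0 fE mulr_gt0// subr_gt0.
Qed.

Lemma is_derive_homo_convex f (f' : R -> R) : (forall x : R, is_derive x 1 f (f' x)) ->
  {homo f' : x y / x <= y} -> forall x y, f x + f' x * (y - x) <= f y.
Proof.
move=> df f'i x y; rewrite addrC -lerBrDr.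
have [xy|yx|->] := ltgtP x y; last by rewrite !subrr mulr0.
- have [c /andP[xc _] ->] := MVT_R df xy.
  by apply: ler_wpM2r; [rewrite subr_ge0 ltW|exact/f'i/ltW].
- have [c /andP[_ cx] fE] := MVT_R df yx.
  have h : f' c * (x - y) <= f' x * (x - y).
    by apply: ler_wpM2r; [rewrite subr_ge0 ltW|exact/f'i/ltW].
  by lra.
Qed.

End DerivativeSign.

Section Endpoints.
Variables (R : realType) (d : measure_display) (T : measurableType d).
Variables (P : probability T R).
Implicit Types (X : T -> R) (u v x : R).

Local Notation I01 := (`[(0:R), 1]%classic).

Definition mass_at X (a : R) : R := fine (P (X @^-1` [set a])).

Lemma measurable_fiber X a : measurable_fun setT X -> measurable (X @^-1` [set a]).
Proof. by move=> mX; rewrite -[X in measurable X]setTI; exact: mX. Qed.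

Lemma mean_integrable_indic X (a : R) : measurable_fun setT X ->
  (forall w, 0 <= X w <= 1) -> mean_integrable P X (\1_[set a] : R -> R).
Proof.
move=> mX X01; apply: (@mean_integrable_bounded _ _ _ P X mX X01 _ 1) => //.
by move=> x _; rewrite indicE; case: (_ \in _); rewrite ?normr1 ?normr0.
Qed.

Lemma mean_indic X (a : R) : measurable_fun setT X ->
  mean P X (\1_[set a] : R -> R) = mass_at X a.
Proof.
move=> mX; rewrite /mean /Rintegral /mass_at.
rewrite (eq_integral (fun w => (\1_(X @^-1` [set a]) w)%:E)).
  by rewrite integral_indic// ?setIT//; exact: measurable_fiber.
by move=> w _; rewrite !indicE; congr ((nat_of_bool _)%:R%:E); apply/idP/idP; rewrite !inE.
Qed.

Lemma mass_at_ge0 X a : 0 <= mass_at X a.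
Proof. by rewrite fine_ge0. Qed.

Variable X : T -> R.
Hypothesis mX : measurable_fun setT X.
Hypothesis X01 : forall w, 0 <= X w <= 1.
Local Notation E := (mean P X).
Local Notation A := (tilted_moment P X).
Local Notation Psi := (logmgf P X).

Let ok1 := mean_integrable_indic 1 mX X01.
Let ok0 := mean_integrable_indic 0 mX X01.
Let okA k u : mean_integrable P X (fun x => tilt (expR u) x ^+ k).
Proof.
by apply: mean_integrable_continuous => //; apply: tilt_pow_continuous; exact: expR_gt0.
Qed.
Let okL u : mean_integrable P X (fun x => ln (1 + (expR u - 1) * x)).
Proof.
by apply: mean_integrable_continuous => //; apply: ln_tilt_den_continuous; exact: expR_gt0.
Qed.

Lemma indic1E (a x : R) : \1_[set a] x = (x == a)%:R :> R.
Proof.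
rewrite indicE; congr ((nat_of_bool _)%:R).
by apply/idP/eqP; rewrite inE.
Qed.

(** For u <= 0 the logarithm equals u where X = 1 and is at most 0 elsewhere. *)
Lemma logmgf_le_left u : u <= 0 -> Psi u <= u * mass_at X 1.
Proof.
move=> u0; rewrite -mean_indic// -meanZ//; apply: le_mean => //.
  exact: mean_integrableZ.
move=> x /andP[x0 x1]; rewrite indic1E; have [->|xn1] := eqVneq x 1.
  by rewrite !mulr1 addrC subrK expRK.
rewrite mulr0 ln_le0// gerDl mulr_le0_ge0// subr_le0.
by rewrite -expR0 ler_expR.
Qed.

(** For 0 <= u the logarithm is 0 where X = 0 and at most u elsewhere. *)
Lemma logmgf_le_right u : 0 <= u -> Psi u <= u * (1 - mass_at X 0).
Proof.
move=> u0; rewrite -mean_indic// -[X in X - _](mean_cst P X) -meanB//; last first.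
  exact: mean_integrable_cst.
have okB : mean_integrable P X (fun x => 1 - \1_[set 0] x).
  by apply: mean_integrableB => //; exact: mean_integrable_cst.
rewrite -meanZ//; apply: le_mean => //; first exact: mean_integrableZ.
move=> x /andP[x0 x1]; rewrite indic1E; have [->|xn1] := eqVneq x 0.
  by rewrite !mulr0 addr0 ln1 subrr mulr0.
rewrite subr0 mulr1 -[leRHS]expRK ler_ln ?posrE ?expR_gt0//.
  have : 0 <= expR u - 1 by rewrite subr_ge0 -expR0 ler_expR.
  by nra.
by apply: tilt_den_gt0; rewrite ?expR_gt0// x0.
Qed.

Lemma tilted_mean_ge u : mass_at X 1 <= A 1 u.
Proof.
rewrite -mean_indic//; apply: le_mean => // x x01.
have e0 := expR_gt0 u.
rewrite indic1E expr1; have [->|_] := eqVneq x 1; first by rewrite tilt1// gt_eqF.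
by have /andP[] := tilt01 e0 x01.
Qed.

(** As the tilt tends to 0, every parameter other than 1 is tilted to 0;
    conclude by dominated convergence. *)
Lemma tilted_mean_lim_left e : 0 < e -> exists u, A 1 u < mass_at X 1 + e.
Proof.
move=> e0.
have : A 1 (- n%:R) @[n --> \oo] --> mass_at X 1.
  rewrite -mean_indic//; apply: (mean_dominated_cvg mX X01 (B := 1)) => //.
    move=> n x x01; have /andP[p0 p1] := tilt_pow_norm_le1 1 (- n%:R : R) x01.
    by rewrite ger0_norm.
  move=> x /andP[x0 x1]; rewrite indic1E; have [->|xn1] := eqVneq x 1.
    apply: (@cvg_trans _ ((fun _ : nat => 1 : R) @ \oo)); last exact: cvg_cst.
    by apply: near_eq_cvg; apply: nearW => n; rewrite tilt1 ?expr1n// gt_eqF// expR_gt0.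
  have y0 : 0 < 1 - x by rewrite subr_gt0 lt_neqAle xn1.
  apply: (@squeeze_cvgr _ _ _ _ (fun=> 0) (fun n => (1 - x)^-1 * n.+1%:R^-1)).
  - apply: nearW => n; have en := expR_gt0 (- n%:R : R).
    have x01 : 0 <= x <= 1 by rewrite x0.
    rewrite expr1; have /andP[-> _] /= := tilt01 en x01.
    rewrite /tilt ler_pdivrMr ?tilt_den_gt0//.
    have h1 : expR (- n%:R) <= n.+1%:R^-1 :> R.
      by rewrite expRN lef_pV2 ?posrE ?expR_gt0// -natr1 addrC expR_ge1Dx.
    have h2 : 1 - x <= 1 + (expR (- n%:R) - 1) * x.
      by have := mulr_ge0 (ltW en) x0; lra.
    have h3 : expR (- n%:R) * x <= n.+1%:R^-1.
      by rewrite -[leRHS]mulr1 ler_pM// ltW.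
    rewrite (le_trans h3)// mulrAC ler_peMl ?invr_ge0//.
    by rewrite ler_pdivlMl// mulr1.
  - exact: cvg_cst.
  - rewrite -[X in _ --> X](mulr0 (1 - x)^-1).
    by apply: cvgM; [exact: cvg_cst|exact: cvg_harmonic].
move=> /cvgrPdist_lt /(_ _ e0) [N _ /(_ N (leqnn N))].
move=> hN; exists (- N%:R); move: hN; rewrite /= ltr_norml => /andP[hN _].
by lra.
Qed.

Lemma tilted_moment1_compl u :
  tilted_moment P (fun w => 1 - X w) 1 (- u) = 1 - A 1 u.
Proof.
rewrite -[X in X - _](mean_cst P X) -meanB//; last exact: mean_integrable_cst.
by apply: eq_Rintegral => w _; rewrite /= !expr1 tilt_compl.
Qed.

Lemma mass_at_compl : mass_at (fun w => 1 - X w) 1 = mass_at X 0.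
Proof.
rewrite /mass_at; congr (fine (P _)); apply/seteqP; split=> w /= h; lra.
Qed.
End Endpoints.

Section UpperEndpoint.
Variables (R : realType) (d : measure_display) (T : measurableType d).
Variables (P : probability T R) (X : T -> R).
Hypothesis mX : measurable_fun setT X.
Hypothesis X01 : forall w, 0 <= X w <= 1.
Local Notation E := (mean P X).
Local Notation A := (tilted_moment P X).
Local Notation Psi := (logmgf P X).

Let mXc : measurable_fun setT (fun w => 1 - X w).
Proof. by apply: measurable_funB. Qed.
Let Xc01 w : 0 <= 1 - X w <= 1.
Proof. by have /andP[] := X01 w; lra. Qed.

Lemma tilted_mean_le u : A 1 u <= 1 - mass_at P X 0.
Proof.
have := tilted_mean_ge P mXc Xc01 (- u).
by rewrite tilted_moment1_compl// mass_at_compl; lra.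
Qed.

Lemma tilted_mean_lim_right e : 0 < e -> exists u, 1 - mass_at P X 0 - e < A 1 u.
Proof.
move=> e0; have [u] := tilted_mean_lim_left P mXc Xc01 e0; exists (- u).
by move: p; rewrite -{1}(opprK u) tilted_moment1_compl// mass_at_compl; lra.
Qed.

(** The variance x (1 - x) vanishes only at 0 and 1, so a zero mean variance
    would put all the mass there. *)
Lemma mean_var_gt0 : mass_at P X 1 < 1 - mass_at P X 0 ->
  0 < E (fun x => x * (1 - x)).
Proof.
move=> h.
have c1 : {within `[(0:R), 1], continuous (fun x : R => x * (1 - x))}.
  apply: continuous_subspaceT => x; apply: cvgM; first exact: cvg_id.
  by apply: cvgB; [exact: cvg_cst|exact: cvg_id].
have okf := mean_integrable_continuous P mX X01 c1.
have f0 w : 0 <= X w * (1 - X w).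
  by have /andP[x0 x1] := X01 w; rewrite mulr_ge0// subr_ge0.
rewrite lt_neqAle Rintegral_ge0 ?andbT//; apply/eqP => E0.
have /integrableP[mf _] := okf.
have i0 : (\int[P]_w `|(X w * (1 - X w))%:E| = 0)%E.
  under eq_integral => w _ do rewrite gee0_abs ?lee_fin//.
  rewrite -[LHS]fineK; first by congr EFin; rewrite [RHS]E0.
  exact: (integrable_fin_num measurableT okf).
have /ae_eq_integral_abs := i0 => /(_ measurableT mf).
move=> [N [mN PN0 hN]].
have : P setT = 1%E := probability_setT P.
have -> : setT = (X @^-1` [set 0] `|` X @^-1` [set 1]) `|` N :> set T.
  apply/seteqP; split=> // w _.
  have [|/eqP] := eqVneq (X w) 0; first by left; left.
  have [|/eqP] := eqVneq (X w) 1; first by left; right.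
  move=> x1 x0; right; apply: hN => /=.
  move=> /(_ Logic.I) [] /eqP; rewrite mulf_eq0 subr_eq0 => /orP[/eqP//|/eqP/esym//].
have m0 := measurable_fiber 0 mX; have m1 := measurable_fiber 1 mX.
set S0 := X @^-1` [set 0]; set S1 := X @^-1` [set 1].
have hPN : P N = 0%E by exact: PN0.
have l1 : (P ((S0 `|` S1) `|` N) <= P (S0 `|` S1) + P N)%E.
  by apply: measureU2 => //; exact: measurableU.
have l2 : (P (S0 `|` S1) <= P S0 + P S1)%E by apply: measureU2.
have {l1}le : (P ((S0 `|` S1) `|` N) <= P S0 + P S1)%E.
  by apply: (le_trans l1); rewrite hPN adde0.
move=> e1; move: le; rewrite e1.
rewrite -[P S0]fineK ?fin_num_measure// -[P S1]fineK ?fin_num_measure//.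
by rewrite -EFinD lee_fin; move: h; rewrite /mass_at; lra.
Qed.

Lemma tilted_variance_ge (u x : R) : 0 <= x <= 1 ->
  expR u / (1 + expR u) ^+ 2 * (x * (1 - x)) <=
  tilt (expR u) x ^+ 1 - tilt (expR u) x ^+ 2.
Proof.
move=> x01; have d0 := tilt_den_gt0 (expR_gt0 u) x01; have e0 := expR_gt0 u.
have /andP[x0 x1] := x01.
have -> : tilt (expR u) x ^+ 1 - tilt (expR u) x ^+ 2 =
   expR u / (1 + (expR u - 1) * x) ^+ 2 * (x * (1 - x)).
  by rewrite /tilt; field; rewrite gt_eqF.
apply: ler_wpM2r; first by rewrite mulr_ge0// subr_ge0.
apply: ler_wpM2l; first exact: ltW.
have e10 : 0 < 1 + expR u by rewrite addr_gt0.
rewrite lef_pV2 ?posrE ?exprn_gt0//.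
apply: lerXn2r; rewrite ?nnegrE ?(ltW d0) ?(ltW e10)//.
by have := mulr_ge0 (ltW e0) x0; nra.
Qed.

Lemma tilted_variance_gt0 u : mass_at P X 1 < 1 - mass_at P X 0 ->
  0 < A 1 u - A 2 u.
Proof.
move=> h.
have okA k : mean_integrable P X (fun x => tilt (expR u) x ^+ k).
  by apply: mean_integrable_continuous => //; apply: tilt_pow_continuous; exact: expR_gt0.
have c1 : {within `[(0:R), 1], continuous (fun x : R => x * (1 - x))}.
  apply: continuous_subspaceT => x; apply: cvgM; first exact: cvg_id.
  by apply: cvgB; [exact: cvg_cst|exact: cvg_id].
have okf := mean_integrable_continuous P mX X01 c1.
rewrite -meanB//; apply: (@lt_le_trans _ _
   (E (fun x => expR u / (1 + expR u) ^+ 2 * (x * (1 - x))))).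
  rewrite (meanZ _ (f := fun x => x * (1 - x)))// mulr_gt0 ?mean_var_gt0//.
  by rewrite divr_gt0 ?exprn_gt0 ?addr_gt0 ?expR_gt0.
apply: le_mean => //.
- exact: (mean_integrableZ _ okf).
- exact: mean_integrableB.
- exact: tilted_variance_ge.
Qed.

Lemma tilted_mean_homo : mass_at P X 1 < 1 - mass_at P X 0 ->
  {homo A 1 : u v / u < v}.
Proof.
move=> h; apply: (is_derive_gt0_homo (f' := fun u => 1%:R * (A 1 u - A 2 u))).
  by move=> u; exact: is_derive_tilted_moment.
by move=> u; rewrite mul1r; exact: tilted_variance_gt0.
Qed.

(** The tangent inequality: the derivative of logmgf is the increasing tilted
    mean. *)
Lemma logmgf_convex : mass_at P X 1 < 1 - mass_at P X 0 ->
  forall u v, Psi u + A 1 u * (v - u) <= Psi v.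
Proof.
move=> h; apply: is_derive_homo_convex.
  by move=> u; exact: is_derive_logmgf.
by apply: ltW_homo; exact: tilted_mean_homo.
Qed.

End UpperEndpoint.

(** * Riemann sums of monotone functions *)

Section RiemannSums.
Variable R : realType.

Definition unif01 : probability _ R := uniform_prob (@ltr01 R).

Lemma unif01_itv (a b : R) : 0 <= a -> a <= b -> b <= 1 ->
  unif01 `[a, b[%classic = (b - a)%:E.
Proof.
move=> a0 ab b1; rewrite /unif01 /= /uniform_prob.
rewrite (eq_integral (cst 1%E)); last first.
  move=> x; rewrite inE /= in_itv/= => /andP[ax xb].
  by rewrite /uniform_pdf (le_trans a0 ax) (ltW (lt_le_trans xb b1))/= subr0 invr1.
rewrite integral_cst//= mul1e lebesgue_measure_itv/= lte_fin.
by move: ab; rewrite le_eqVlt => /predU1P[->|->]; rewrite ?ltxx ?subrr.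
Qed.

Lemma unif01_ge1 : unif01 `[1, +oo[%classic = 0%E.
Proof.
rewrite /unif01 /= /uniform_prob integral_uniform_pdf.
rewrite (_ : _ `&` _ = [set 1]) ?integral_set1//.
apply/seteqP; split=> x /=; rewrite !in_itv/= ?andbT.
  by move=> [x1 /andP[_ x2]]; apply/eqP; rewrite eq_le x1 x2.
by move=> ->; rewrite lexx ler01.
Qed.

Lemma unif01_lt0 : unif01 `]-oo, 0[%classic = 0%E.
Proof.
rewrite /unif01 /= /uniform_prob integral_uniform_pdf.
rewrite (_ : _ `&` _ = set0) ?integral_set0//.
apply/seteqP; split=> x //=; rewrite !in_itv/= => -[x1 /andP[x2 _]].
by move: x1; rewrite ltNge x2.
Qed.

Local Notation I := (fun f : R -> R => (\int[unif01]_y f y)%R).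

Let ok (f : R -> R) := unif01.-integrable setT (EFin \o f).

Lemma unif01_integrable (f : R -> R) (B : R) : measurable_fun setT f ->
  (forall x, `|f x| <= B) -> ok f.
Proof.
move=> mf fB; apply: measurable_bounded_integrable => //.
  by rewrite (le_lt_trans (probability_le1 unif01 measurableT))// ltry.
by exists B; split; [rewrite num_real|move=> B' BB' w _ /=; rewrite (le_trans (fB w))// ltW].
Qed.

Lemma unif01_indic (A : set R) : measurable A ->
  ok (\1_A : R -> R) /\ I (\1_A : R -> R) = fine (unif01 A).
Proof.
move=> mA; split.
  apply: (@unif01_integrable _ 1) => //.
  by move=> x; rewrite indicE; case: (_ \in _); rewrite ?normr1 ?normr0.
by rewrite /Rintegral integral_indic// setIT.
Qed.

Let okZ (f : R -> R) c : ok f -> ok (fun x => c * f x).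
Proof. by move=> hf; have := integrableZl measurableT c hf. Qed.
Let okD (f g : R -> R) : ok f -> ok g -> ok (fun x => f x + g x).
Proof. by move=> hf hg; have := integrableD measurableT hf hg. Qed.

Lemma unif01_sum n (a : nat -> R) (A : nat -> set R) :
  (forall i, measurable (A i)) ->
  ok (fun x => \sum_(i < n) a i * \1_(A i) x) /\
  I (fun x => \sum_(i < n) a i * \1_(A i) x) =
    \sum_(i < n) a i * fine (unif01 (A i)).
Proof.
move=> mA; elim: n => [|n [IH1 IH2]].
  rewrite big_ord0 (_ : (fun x => _) = fun=> 0); last first.
    by apply/funext => x; rewrite big_ord0.
  split; last by rewrite Rintegral_cst// mul0r.
  by apply: (@unif01_integrable _ 0) => // x; rewrite normr0.
have [h1 h2] := unif01_indic (mA n).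
rewrite big_ord_recr/= (_ : (fun x => _) =
  fun x => (\sum_(i < n) a i * \1_(A i) x) + a n * \1_(A n) x); last first.
  by apply/funext => x; rewrite big_ord_recr.
split; first by apply: okD => //; exact: okZ.
rewrite RintegralD//; last exact: okZ.
by rewrite IH2 RintegralZl// h2.
Qed.

(** The lower and upper Riemann sums of a monotone function differ by the mesh
    times its total oscillation, by telescoping. *)
Lemma riemann_sum_monotone (h : R -> R) (N : nat) : (0 < N)%N ->
  nondecreasing_fun h -> (forall y, 0 <= h y <= 1) ->
  `|I h - (\sum_(j < N) h (j%:R / N%:R)) / N%:R| <= N%:R^-1.
Proof.
move=> N0 hnd h01.
have Nr0 : 0 < N%:R :> R by rewrite ltr0n.
pose A (j : nat) := `[(j%:R / N%:R : R), j.+1%:R / N%:R[%classic.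
have mA j : measurable (A j) by exact: measurable_itv.
have hm : measurable_fun setT h by exact: nondecreasing_measurable.
have okh : ok h.
  by apply: (@unif01_integrable _ 1) => // x; have /andP[a b] := h01 x; rewrite ger0_norm.
have PA j : (j < N)%N -> fine (unif01 (A j)) = N%:R^-1.
  move=> jN; rewrite /A unif01_itv//=.
  - by rewrite -mulrBl -natr1 addrC addKr mul1r.
  - by rewrite ler_pM2r ?invr_gt0// ler_nat.
  - by rewrite ler_pdivrMr// mul1r ler_nat.
have sumP (a : nat -> R) : \sum_(j < N) a j * fine (unif01 (A j)) =
   (\sum_(j < N) a j) / N%:R.
  by rewrite mulr_suml; apply: eq_bigr => j _; rewrite PA.
have idx y : 0 <= y < 1 -> exists2 j, (j < N)%N & A j y.
  move=> /andP[y0 y1]; exists (Num.truncn (y * N%:R)).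
    rewrite truncn_lt_nat ?mulr_ge0 ?ler0n//.
    by rewrite -[ltRHS]mul1r ltr_pM2r.
  rewrite /A /= in_itv/=.
  have /andP[t1 t2] := truncn_itv (mulr_ge0 y0 (ltW Nr0)).
  by rewrite ler_pdivrMr// ltr_pdivlMr// t1.
have Auniq j i y : A j y -> A i y -> i = j.
  rewrite /A /= !in_itv/= !ler_pdivrMr// !ltr_pdivlMr// => /andP[a1 a2] /andP[b1 b2].
  apply/eqP; rewrite eqn_leq -ltnS -(ltr_nat R) (le_lt_trans b1 a2)/=.
  by rewrite -ltnS -(ltr_nat R) (le_lt_trans a1 b2).
have stepE (a : nat -> R) y j : (j < N)%N -> A j y ->
    \sum_(i < N) a i * \1_(A i) y = a j.
  move=> jN Aj; rewrite (bigD1 (Ordinal jN))//= indicE mem_set// mulr1.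
  rewrite big1 ?addr0// => i ij; rewrite indicE memNset ?mulr0// => Ai.
  by move: ij; rewrite -val_eqE/= (Auniq _ _ _ Aj Ai) eqxx.
have step0 (a : nat -> R) y : ~ (0 <= y < 1) ->
    \sum_(i < N) a i * \1_(A i) y = 0.
  move=> yn; rewrite big1// => i _; rewrite indicE memNset ?mulr0// => Ai.
  apply: yn; move: Ai; rewrite /A /= in_itv/= => /andP[y1 y2].
  rewrite (le_trans _ y1) ?divr_ge0//= (lt_le_trans y2)//.
  by rewrite ler_pdivrMr// mul1r ler_nat.
have [ok1 I1] := unif01_sum N (fun j => h (j%:R / N%:R)) mA.
have [ok2 I2] := unif01_sum N (fun j => h (j.+1%:R / N%:R)) mA.
rewrite (sumP (fun j => h (j%:R / N%:R))) in I1.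
rewrite (sumP (fun j => h (j.+1%:R / N%:R))) in I2.
(* The two null rays make the upper step function dominate h on the whole
   line. *)
have [ok3 I3] := unif01_indic (measurable_itv `[(1 : R), +oo[).
have [ok4 I4] := unif01_indic (measurable_itv `]-oo, (0 : R)[).
rewrite unif01_ge1/= in I3; rewrite unif01_lt0/= in I4.
have lower : (\sum_(j < N) h (j%:R / N%:R)) / N%:R <= I h.
  rewrite -I1; apply: le_Rintegral => // y _.
  have [/idx[j jN Aj]|yn] := pselect (0 <= y < 1).
    rewrite (stepE (fun j => h (j%:R / N%:R)) y j)//; apply: hnd.
    by move: Aj; rewrite /A /= in_itv/= => /andP[].
  by rewrite (step0 (fun j => h (j%:R / N%:R)))//; have /andP[] := h01 y.
have upper : I h <= (\sum_(j < N) h (j.+1%:R / N%:R)) / N%:R.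
  have -> : (\sum_(j < N) h (j.+1%:R / N%:R)) / N%:R =
     I (fun y => (\sum_(i < N) h (i.+1%:R / N%:R) * \1_(A i) y) +
      (\1_(`[(1 : R), +oo[%classic) y + \1_(`]-oo, (0:R)[%classic) y)).
    rewrite RintegralD//; last exact: okD.
    by rewrite RintegralD// I2 I3 I4 !addr0.
  apply: le_Rintegral => //; first by apply: okD => //; exact: okD.
  move=> y _; have [/idx[j jN Aj]|yn] := pselect (0 <= y < 1).
    rewrite (stepE (fun j => h (j.+1%:R / N%:R)) y j)//.
    rewrite -[leLHS]addr0 lerD ?addr_ge0 ?indicE//; apply: hnd.
    by move: Aj; rewrite /A /= in_itv/= => /andP[_ /ltW].
  rewrite (step0 (fun j => h (j.+1%:R / N%:R)))// add0r.
  have /andP[_ h1] := h01 y; rewrite (le_trans h1)//.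
  have [y0|y0] := leP 0 y.
    rewrite [X in X + _]indicE mem_set ?lerDl ?indicE//= in_itv/= andbT leNgt.
    by apply/negP => y1; apply: yn; rewrite y0 y1.
  by rewrite [X in _ + X]indicE mem_set ?lerDr ?indicE//= in_itv/=.
rewrite ger0_norm ?subr_ge0// (le_trans (lerB upper (lexx _)))//.
rewrite -mulrBl -sumrB ler_pdivrMr// mulVf ?gt_eqF//.
rewrite -(big_mkord xpredT (fun j => h (j.+1%:R / N%:R) - h (j%:R / N%:R))).
rewrite (telescope_sumr (fun j : nat => h (j%:R / N%:R)))//.
have /andP[a b] := h01 (N%:R / N%:R); have /andP[c e] := h01 (0%:R / N%:R).
lra.
Qed.

End RiemannSums.

(** * Quantile functions along an ultrafilter *)

Section QuantileLimit.
Variable R : realType.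

(** The limit is the supremum of the eventual lower bounds: an ultrafilter that
    does not contain x n >= sup + e contains its negation. *)
Lemma ultra_bounded_cvg (U : set_system nat) (x : nat -> R) (a b : R) :
  UltraFilter U -> (\forall n \near U, a <= x n <= b) -> exists l : R, x @ U --> l.
Proof.
move=> UU xab; pose E := [set c : R | U [set n | c <= x n]].
have Ea : E a by apply: filterS xab => n /andP[].
have Eb : ubound E b.
  move=> c Ec; have [n [cn /andP[_ nb]]] := filter_ex (filterI Ec xab).
  exact: le_trans nb.
have hs : has_sup E by split; [exists a|exists b].
exists (sup E); apply/cvgrPdist_le => e e0.
have [c Ec hc] := sup_adherent e0 hs.
have h2 : U [set n | x n < sup E + e].
  have [h|h] := in_ultra_setVsetC [set n | sup E + e <= x n] UU.
    have : sup E + e <= sup E by apply: ub_le_sup => //; exists b.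
    by rewrite gerDl leNgt e0.
  by apply: filterS h => n /=; rewrite ltNge => /negP.
apply: filterS2 Ec h2 => n /= h1 h2.
by rewrite ler_distlC; apply/andP; split; lra.
Qed.

Lemma cvg_sum_ord (F : set_system nat) (FF : Filter F) N (f : nat -> nat -> R)
    (l : nat -> R) : (forall i, f i @ F --> l i) ->
  (\sum_(i < N) f i n) @[n --> F] --> \sum_(i < N) l i.
Proof.
move=> hf; elim: N => [|N IH].
  rewrite big_ord0 (_ : (fun n => _) = fun=> 0); first exact: cvg_cst.
  by apply/funext => n; rewrite big_ord0.
rewrite big_ord_recr/= (_ : (fun n => _) =
   fun n => (\sum_(i < N) f i n) + f N n); first exact: cvgD.
by apply/funext => n; rewrite big_ord_recr.
Qed.

Lemma le_cvg_le (F : set_system nat) (FF : ProperFilter F) (u v : nat -> R) a b :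
  u @ F --> a -> v @ F --> b -> (\forall n \near F, u n <= v n) -> a <= b.
Proof.
move=> ua vb uv.
have := @ler_lim _ _ FF R u v (cvgP _ ua) (cvgP _ vb) uv.
by rewrite (cvg_lim _ ua)// (cvg_lim _ vb).
Qed.

Variables (U : set_system nat) (S : nat -> seq R).
Hypothesis UU : UltraFilter U.
Hypothesis sub_U : \oo `<=` U.
Hypothesis S01 : forall n, in01 (S n).
Hypothesis S_sorted : forall n, sorted <=%R (S n).
Hypothesis S_size : forall n, size (S n) = n.

(* The quantile function of the uniform law on the entries of S n; the default 1
   keeps it monotone for y >= 1. *)
Let qn n (y : R) : R := nth 1 (S n) (Num.truncn (y * n%:R)).

Let qn01 n y : 0 <= qn n y <= 1.
Proof.
rewrite /qn; have [h|h] := ltnP (Num.truncn (y * n%:R)) (size (S n)).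
  exact/S01/mem_nth.
by rewrite nth_default// lexx ler01.
Qed.

Let qn_nd n : nondecreasing_fun (qn n).
Proof.
move=> y z yz; rewrite {2}/qn.
have [h|h] := ltnP (Num.truncn (z * n%:R)) (size (S n)); last first.
  by rewrite nth_default//; have /andP[] := qn01 n y.
have le : (Num.truncn (y * n%:R) <= Num.truncn (z * n%:R))%N.
  by apply: le_truncn; rewrite ler_wpM2r.
rewrite /qn; apply: (sorted_leq_nth le_trans le_refl 1 (S_sorted n)) => //.
by rewrite inE (leq_ltn_trans le).
Qed.

(** Quantile functions of the empirical measures are monotone and bounded, so
    they converge pointwise along the ultrafilter; comparing both sides with
    Riemann sums over a fixed mesh turns this into convergence of moments. *)
Theorem quantile_limit : exists q : R -> R,
  [/\ nondecreasing_fun q, (forall y, 0 <= q y <= 1) &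
    forall f : R -> R, {within `[(0 : R), 1], continuous f} ->
      (\sum_(s <- S n) f s) / n%:R @[n --> U] --> mean (@unif01 R) q f].
Proof.
have PU : ProperFilter U by exact: ultra_proper.
have [q qlim] : exists q : R -> R, forall y, (fun n => qn n y) @ U --> q y.
  have h y : exists l : R, (fun n => qn n y) @ U --> l.
    by apply: (ultra_bounded_cvg UU); apply: nearW => n; exact: qn01.
  by exists (fun y => projT1 (cid (h y))) => y; exact: (projT2 (cid (h y))).
have q01 y : 0 <= q y <= 1.
  apply/andP; split.
    apply: (@le_cvg_le _ PU (fun=> 0) _ _ _ (cvg_cst _) (qlim y)).
    by apply: nearW => n; have /andP[] := qn01 n y.
  apply: (@le_cvg_le _ PU _ (fun=> 1) _ _ (qlim y) (cvg_cst _)).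
  by apply: nearW => n; have /andP[] := qn01 n y.
have qnd : nondecreasing_fun q.
  move=> y z yz; apply: (@le_cvg_le _ PU _ _ _ _ (qlim y) (qlim z)).
  by apply: nearW => n; exact: qn_nd.
have mq : measurable_fun setT q by exact: nondecreasing_measurable.
exists q; split => //.
have pow_nd (h : R -> R) k : nondecreasing_fun h -> (forall y, 0 <= h y <= 1) ->
    nondecreasing_fun (fun y => h y ^+ k) /\ (forall y, 0 <= h y ^+ k <= 1).
  move=> hnd h01; split=> [y z yz|y]; last first.
    by have /andP[a b] := h01 y; rewrite exprn_ge0//= exprn_ile1.
  have /andP[a b] := h01 y; have /andP[c d] := h01 z.
  by apply: lerXn2r; rewrite ?nnegrE//; exact: hnd.
have mom k : (\sum_(s <- S n) s ^+ k) / n%:R @[n --> U] -->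
    mean (@unif01 R) q (fun x => x ^+ k).
  apply/cvgrPdist_le => e e0.
  (* Three Riemann sum errors, with n points, with N points, and for q, plus
     the convergence at the N nodes. *)
  have [N N0 hN] : exists2 N, (0 < N)%N & 4 / e < N%:R.
    by exists (Num.truncn (4 / e)).+1 => //; exact: truncnS_gt.
  have Nr0 : 0 < N%:R :> R by rewrite ltr0n.
  have h4 : N%:R^-1 < e / 4.
    by rewrite -[e / 4]invrK invf_div ltf_pV2 ?posrE ?divr_gt0.
  have [nd1 b1] := pow_nd q k qnd q01.
  have r1 := riemann_sum_monotone N0 nd1 b1.
  pose G n := (\sum_(j < N) qn n (j%:R / N%:R) ^+ k) / N%:R.
  pose G0 := (\sum_(j < N) q (j%:R / N%:R) ^+ k) / N%:R.
  have Gc : G @ U --> G0.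
    apply: cvgM; last exact: cvg_cst.
    apply: (@cvg_sum_ord U _ N (fun j n => qn n (j%:R / N%:R) ^+ k)
      (fun j => q (j%:R / N%:R) ^+ k)) => j.
    have cX := @exprn_continuous R k (q (j%:R / N%:R)).
    exact: (continuous_cvg _ cX (qlim _)).
  have e40 : 0 < e / 4 by rewrite divr_gt0.
  have near1 : \forall n \near U, (N <= n)%N by apply: sub_U; exists N.
  have near2 : \forall n \near U, `|G0 - G n| <= e / 4.
    by move/cvgrPdist_le : Gc; exact.
  apply: filterS2 near1 near2 => n Nn hG.
  have n0 : (0 < n)%N by exact: leq_trans Nn.
  have [nd2 b2] := pow_nd (qn n) k (@qn_nd n) (qn01 n).
  have r2 := riemann_sum_monotone N0 nd2 b2.
  have r3 := riemann_sum_monotone n0 nd2 b2.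
  have nN : n%:R^-1 <= N%:R^-1 :> R by rewrite lef_pV2 ?posrE ?ltr0n// ler_nat.
  have sE : \sum_(j < n) qn n (j%:R / n%:R) ^+ k = \sum_(s <- S n) s ^+ k.
    rewrite [RHS](big_nth 1) S_size big_mkord; apply: eq_bigr => j _.
    by rewrite /qn divfK ?natrK// pnatr_eq0 -lt0n.
  rewrite sE in r3.
  have m1 : mean (@unif01 R) q (fun x => x ^+ k) = (\int[@unif01 R]_y q y ^+ k)%R by [].
  rewrite m1; rewrite -/(G n) in r2; rewrite -/G0 in r1.
  move: r1 r2 r3 hG; rewrite !ler_norml => /andP[? ?] /andP[? ?] /andP[? ?] /andP[? ?].
  by apply/andP; split; lra.
move=> f cf; apply/cvgrPdist_le => e e0.
have e30 : 0 < e / 3 by rewrite divr_gt0.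
have [p hp] := weierstrass_approx cf e30.
have hpoly : (\sum_(s <- S n) p.[s]) / n%:R @[n --> U] -->
    mean (@unif01 R) q (fun x => p.[x]).
  rewrite mean_horner// (_ : (fun n => _) = fun n =>
     \sum_(i < size p) p`_i * ((\sum_(s <- S n) s ^+ i) / n%:R)).
    apply: (@cvg_sum_ord U _ (size p)
      (fun i n => p`_i * ((\sum_(s <- S n) s ^+ i) / n%:R))
      (fun i => p`_i * mean (@unif01 R) q (fun x => x ^+ i))) => i.
    by apply: cvgM; [exact: cvg_cst|exact: mom].
  apply/funext => n.
  under [RHS]eq_bigr => i _ do rewrite mulrA mulr_sumr.
  rewrite -mulr_suml exchange_big/=; congr (_ / _).
  by apply: eq_bigr => s _; rewrite horner_coef.
have near1 : \forall n \near U, (0 < n)%N by apply: sub_U; exists 1%N.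
move/cvgrPdist_le : hpoly => /(_ _ e30).
apply: filterS2 near1 => n n0 hn.
have nr0 : 0 < n%:R :> R by rewrite ltr0n.
have okf := mean_integrable_continuous (@unif01 R) mq q01 cf.
have okp := mean_integrable_horner (@unif01 R) mq q01 p.
have h1 : `|mean (@unif01 R) q f - mean (@unif01 R) q (fun x => p.[x])| <= e / 3.
  rewrite -meanB//; apply: mean_norm_le => //; exact: mean_integrableB.
have h2 : `|(\sum_(s <- S n) p.[s]) / n%:R - (\sum_(s <- S n) f s) / n%:R| <= e / 3.
  rewrite -mulrBl -sumrB normrM (ger0_norm (x := n%:R^-1)) ?invr_ge0//.
  rewrite ler_pdivrMr// (le_trans (ler_norm_sum _ _ _))//.
  have -> : e / 3 * n%:R = \sum_(s <- S n) e / 3.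
    by rewrite big_const_seq count_predT S_size iter_addr_0 mulr_natr.
  rewrite !big_seq; apply: ler_sum => s sS; rewrite distrC; apply: hp.
  exact: S01 sS.
move: h1 h2 hn; rewrite !ler_norml => /andP[? ?] /andP[? ?] /andP[? ?].
by apply/andP; split; lra.
Qed.

End QuantileLimit.

(** * Exponential bounds on the coefficients *)

Section LargeDeviations.
Variables (R : realType) (d : measure_display) (T : measurableType d).
Variables (P : probability T R) (X : T -> R).
Hypothesis mX : measurable_fun setT X.
Hypothesis X01 : forall w, 0 <= X w <= 1.
Variables (U : set_system nat) (S : nat -> seq R) (c : nat -> R).
Hypothesis PU : ProperFilter U.
Hypothesis sub_U : \oo `<=` U.
Hypothesis S01 : forall n, in01 (S n).
Hypothesis S_size : forall n, size (S n) = n.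
Hypothesis c_gt0 : forall n, 0 < c n.
Hypothesis S_cvg : forall f : R -> R, {within `[(0 : R), 1], continuous f} ->
  (\sum_(s <- S n) f s) / n%:R @[n --> U] --> mean P X f.

Local Notation A := (tilted_moment P X).
Local Notation Psi := (logmgf P X).

Let a n k : R := c n * (bernoulli_gf (S n))`_k.
Let D n : R := ln (c n) / n%:R.
Let L u n : R := (\sum_(s <- S n) ln (1 + (expR u - 1) * s)) / n%:R.

Lemma near_gt (x : R) : \forall n \near U, x < n%:R.
Proof.
apply: sub_U; exists (Num.truncn x).+1 => // n /= h.
by rewrite (lt_le_trans (truncnS_gt x))// ler_nat.
Qed.

Let a_ge0 n k : 0 <= a n k.
Proof. by rewrite mulr_ge0 ?(ltW (c_gt0 n))// bernoulli_gf_coef_ge0. Qed.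

Lemma expR_logmass n : (0 < n)%N -> expR (n%:R * D n) = c n.
Proof.
move=> n0; rewrite /D mulrC divfK ?lnK ?posrE//.
by rewrite pnatr_eq0 -lt0n.
Qed.

Lemma expR_empirical_logmgf u n : (0 < n)%N ->
  expR (n%:R * L u n) = (bernoulli_gf (S n)).[expR u].
Proof.
move=> n0; rewrite /L mulrC divfK; last by rewrite pnatr_eq0 -lt0n.
rewrite expR_sum horner_bernoulli_gf !big_seq; apply: eq_bigr => s sS.
by rewrite lnK// posrE tilt_den_gt0 ?expR_gt0//; exact: S01 sS.
Qed.

Lemma empirical_logmgf_cvg u : L u @ U --> Psi u.
Proof. by apply: S_cvg; apply: ln_tilt_den_continuous; exact: expR_gt0. Qed.

Lemma coef_tilt u n k : (0 < n)%N -> a n k * expR u ^+ k =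
  expR (n%:R * (D n + L u n)) * (bernoulli_gf (map (tilt (expR u)) (S n)))`_k.
Proof.
move=> n0; rewrite /a -mulrA bernoulli_gf_tilt ?expR_gt0//.
by rewrite mulrDr expRD expR_logmass// expR_empirical_logmgf// mulrA.
Qed.

(** Chernoff's bound: one tilted coefficient is at most their sum. *)
Lemma coef_le u n k : (0 < n)%N ->
  a n k <= expR (n%:R * (D n + L u n) - k%:R * u).
Proof.
move=> n0; rewrite expRD expRN mulrC expRM_natl.
rewrite -ler_pdivrMl ?invr_gt0 ?exprn_gt0 ?expR_gt0// invrK mulrC coef_tilt//.
rewrite ger_pMr ?expR_gt0//; apply: bernoulli_gf_coef_le1.
by apply: in01_tilt => //; exact: expR_gt0.
Qed.

Lemma trunc_near (al : R) n : 0 <= al ->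
  al * n%:R - 1 < (Num.truncn (al * n%:R))%:R <= al * n%:R.
Proof.
move=> al0; have /andP[h1 h2] := truncn_itv (mulr_ge0 al0 (ler0n R n)).
by rewrite h1 andbT; move: h2; rewrite -natr1; lra.
Qed.

Lemma coef_upper (al u e : R) : 0 <= al -> 0 < e ->
  \forall n \near U, a n (Num.truncn (al * n%:R)) <=
    expR (n%:R * (D n + Psi u - al * u + e)).
Proof.
move=> al0 e0; have e20 : 0 < e / 2 by rewrite divr_gt0.
have h1 : \forall n \near U, `|Psi u - L u n| <= e / 2.
  by have /cvgrPdist_le := @empirical_logmgf_cvg u; exact.
apply: filterS3 (near_gt 0) (near_gt (2 * `|u| / e)) h1 => n n0 nu.
rewrite ler_norml => /andP[h2 h3].
rewrite (le_trans (coef_le u _ _)) ?ler_expR//; first by rewrite -(ltr0n R).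
have /andP[k1 k2] := trunc_near n al0.
set k := (X in X - 1) in k1 k2; set K := (Num.truncn _)%:R in k1 k2 *.
have hu : (k - K) * u <= `|u|.
  rewrite (le_trans (ler_norm _))// normrM ger0_norm ?subr_ge0//.
  by rewrite ler_piMl//; lra.
have hn : `|u| <= n%:R * (e / 2).
  by move: nu; rewrite ltr_pdivrMr// => h; lra.
have hL : n%:R * L u n <= n%:R * (Psi u + e / 2) by rewrite ler_wpM2l//; lra.
have -> : n%:R * (D n + Psi u - al * u + e) =
  n%:R * D n + n%:R * (Psi u + e / 2) + n%:R * (e / 2) - k * u by rewrite /k; field.
by rewrite mulrDr; lra.
Qed.

Lemma subexponential (e : R) : 0 < e ->
  \forall n \near U, 2 * n.+1%:R <= expR (n%:R * e).
Proof.
move=> e0; (* exp(n e) is at least (n e / 2)^2, which exceeds 4 n once n > 16 / e^2. *)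
apply: filterS2 (near_gt 1) (near_gt (16 / e ^+ 2)) => n n1 ne.
have -> : n%:R * e = n%:R * e / 2 + n%:R * e / 2 by field.
have h : n%:R * e / 2 <= expR (n%:R * e / 2).
  by rewrite (le_trans _ (expR_ge1Dx _))// lerDr.
have n0 : 0 < n%:R :> R by lra.
rewrite expRD (le_trans _ (ler_pM _ _ h h)) ?divr_ge0 ?mulr_ge0 ?ltW//.
move: ne; rewrite ltr_pdivrMr ?exprn_gt0// => ne.
have : n%:R * 16 <= n%:R * (n%:R * e ^+ 2) by rewrite ler_wpM2l// ltW.
rewrite -natr1.
have -> : n%:R * e / 2 * (n%:R * e / 2) = n%:R * (n%:R * e ^+ 2) / 4 by field.
lra.
Qed.

(** Chebyshev's inequality for the tilted law: some coefficient with index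
    close to the tilted mean is exponentially as large as the whole sum. *)
Lemma coef_lower (u dl e : R) : 0 < dl -> 0 < e ->
  \forall n \near U, exists2 k, (k <= n)%N & `|k%:R - n%:R * A 1 u| < n%:R * dl /\
    expR (n%:R * (D n + Psi u - e) - k%:R * u) <= a n k.
Proof.
move=> dl0 e0; have e20 : 0 < e / 2 by rewrite divr_gt0.
have dl20 : 0 < dl / 2 by rewrite divr_gt0.
have h1 : \forall n \near U, `|Psi u - L u n| <= e / 2.
  by have /cvgrPdist_le := @empirical_logmgf_cvg u; exact.
have h2 : \forall n \near U,
    `|A 1 u - (\sum_(s <- S n) tilt (expR u) s ^+ 1) / n%:R| <= dl / 2.
  have /cvgrPdist_le := S_cvg (tilt_pow_continuous (k := 1) (expR_gt0 u)).
  exact.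
near=> n.
have n0 : 0 < n%:R :> R by near: n; exact: near_gt.
have n0' : (0 < n)%N by rewrite -(ltr0n R).
pose l := map (tilt (expR u)) (S n).
have hl : in01 l by apply: in01_tilt => //; exact: expR_gt0.
have sl : size l = n by rewrite size_map.
have hd : 0 < n%:R * dl by rewrite mulr_gt0.
have cheb : \sum_(s <- l) s * (1 - s) + (\sum_(s <- l) s - n%:R * A 1 u) ^+ 2
    < (n%:R * dl) ^+ 2 / 2.
  have v1 : \sum_(s <- l) s * (1 - s) <= n%:R.
    have -> : n%:R = \sum_(s <- l) 1 :> R.
      by rewrite big_const_seq count_predT sl iter_addr_0.
    rewrite !big_seq; apply: ler_sum => s /hl /andP[s0 s1]; nra.
  have v2 : (\sum_(s <- l) s - n%:R * A 1 u) ^+ 2 <= (n%:R * (dl / 2)) ^+ 2.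
    rewrite -[leLHS]real_normK ?num_real//; apply: lerXn2r.
    - by rewrite nnegrE.
    - by rewrite nnegrE mulr_ge0 ?ltW.
    have hn : `|A 1 u - (\sum_(s <- S n) tilt (expR u) s ^+ 1) / n%:R| <= dl / 2.
      by near: n.
    have -> : \sum_(s <- l) s = \sum_(s <- S n) tilt (expR u) s ^+ 1.
      by rewrite big_map; apply: eq_bigr.
    have -> : \sum_(s <- S n) tilt (expR u) s ^+ 1 - n%:R * A 1 u =
      - (n%:R * (A 1 u - (\sum_(s <- S n) tilt (expR u) s ^+ 1) / n%:R)).
      by field; rewrite gt_eqF.
    by rewrite normrN normrM (gtr0_norm n0) ler_pM2l.
  have nb : 4 / dl ^+ 2 < n%:R by near: n; exact: near_gt.
  move: nb; rewrite ltr_pdivrMr ?exprn_gt0// => nb.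
  have : n%:R * 4 < n%:R * (n%:R * dl ^+ 2) by rewrite ltr_pM2l.
  have -> : (n%:R * dl) ^+ 2 / 2 = n%:R * (n%:R * dl ^+ 2) / 2 by field.
  have e4 : (n%:R * (dl / 2)) ^+ 2 = n%:R * (n%:R * dl ^+ 2) / 4 by field.
  by rewrite e4 in v2; lra.
have [k kn [kd kw]] := bernoulli_gf_chebyshev hd hl cheb.
rewrite sl in kn kw; exists k => //; split=> //.
have se : 2 * n.+1%:R <= expR (n%:R * (e / 2)) by near: n; exact: subexponential.
have hn : `|Psi u - L u n| <= e / 2 by near: n.
rewrite expRD expRN -ler_pdivlMr ?invr_gt0 ?expR_gt0// invrK.
rewrite [expR (k%:R * u)]expRM_natl coef_tilt// -/l.
have w0 : 0 <= (bernoulli_gf l)`_k by exact: bernoulli_gf_coef_ge0.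
have kw2 : 1 <= expR (n%:R * (e / 2)) * (bernoulli_gf l)`_k.
  by rewrite (le_trans kw)// ler_wpM2r.
apply: (@le_trans _ _ (expR (n%:R * (D n + L u n)) * expR (- (n%:R * (e / 2))))).
  rewrite -expRD ler_expR.
  have : n%:R * (D n + Psi u - e) <= n%:R * (D n + L u n - e / 2).
    by apply: ler_wpM2l; [exact: ltW|]; move: hn; rewrite ler_norml => /andP[_ ?]; lra.
  by rewrite !mulrDr; lra.
rewrite ler_pM2l ?expR_gt0// expRN -[leLHS]mul1r ler_pdivrMr ?expR_gt0//.
by rewrite mulrC.
Unshelve. all: by end_near. Qed.

(** Unimodality of the tilted coefficients transfers the lower bound from the
    indices supplied by coef_lower to the prescribed one between them. *)
Lemma coef_lower_at (u e : R) : mass_at P X 1 < 1 - mass_at P X 0 -> 0 < e ->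
  \forall n \near U, expR (n%:R * (D n + Psi u - A 1 u * u - e)) <=
    a n (Num.truncn (A 1 u * n%:R)).
Proof.
move=> nd e0.
(* One quarter is lost in coef_lower, one in the exponent at the neighbouring
   log-parameters, one in logmgf there, and one in rounding the index. *)
have [et et0 eE] : exists2 et : R, 0 < et & e = 4 * et.
  by exists (e / 4); [rewrite divr_gt0|field].
have Ah := tilted_mean_homo mX X01 nd.
have [v1 v1E] : exists v, v = u - et by exists (u - et).
have [v2 v2E] : exists v, v = u + et by exists (u + et).
have A0 : 0 <= A 1 u.
  exact: le_trans (mass_at_ge0 P X 1) (tilted_mean_ge P mX X01 u).
have A1 : A 1 u <= 1.
  by apply: le_trans (tilted_mean_le P mX X01 u) _; rewrite gerBl; exact: mass_at_ge0.
have Av1 : A 1 v1 < A 1 u by apply: Ah; rewrite v1E gtrBl.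
have Av2 : A 1 u < A 1 v2 by apply: Ah; rewrite v2E ltrDl.
have c1 : Psi u + A 1 u * (v1 - u) <= Psi v1 by exact: logmgf_convex.
have c2 : Psi u + A 1 u * (v2 - u) <= Psi v2 by exact: logmgf_convex.
have gap (x y : R) : x < y -> exists2 dl, 0 < dl & y = x + 2 * dl.
  by move=> xy; exists ((y - x) / 2); [rewrite divr_gt0// subr_gt0|field].
have [d1 d10 d1E] := gap _ _ Av1; have [d2 d20 d2E] := gap _ _ Av2.
have H1 := coef_lower v1 d10 et0; have H2 := coef_lower v2 d20 et0.
clear Ah; move: (A 1 u) (A 1 v1) (A 1 v2) A0 A1 Av1 Av2 c1 c2 d1E d2E H1 H2.
move: (Psi u) (Psi v1) (Psi v2).
move=> pu p1 p2 al al1 al2 A0 A1 Av1 Av2 c1 c2 d1E d2E H1 H2.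
near=> n.
have n0 : 0 < n%:R :> R by near: n; exact: near_gt.
have n0' : (0 < n)%N by rewrite -(ltr0n R).
have [k1 k1n [k1d k1a]] : exists2 k, (k <= n)%N &
    `|k%:R - n%:R * al1| < n%:R * d1 /\
    expR (n%:R * (D n + p1 - et) - k%:R * v1) <= a n k by near: n.
have [k2 k2n [k2d k2a]] : exists2 k, (k <= n)%N &
    `|k%:R - n%:R * al2| < n%:R * d2 /\
    expR (n%:R * (D n + p2 - et) - k%:R * v2) <= a n k by near: n.
move: (D n) k1a k2a => Dn k1a k2a.
have /andP[t1 t2] := trunc_near n A0.
set k := Num.truncn _ in t1 t2 *.
have nd1 : d1^-1 < n%:R by near: n; exact: near_gt.
have nd1' : 1 < n%:R * d1 by rewrite -ltr_pdivrMr// div1r.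
have k1k : (k1 <= k)%N.
  rewrite -(ler_nat R) ltW//; move: k1d; rewrite ltr_norml => /andP[_].
  have nE : n%:R * al = n%:R * al1 + 2 * (n%:R * d1) by rewrite d1E; ring.
  by lra.
have kk2 : (k <= k2)%N.
  rewrite -(ler_nat R) ltW//; move: k2d; rewrite ltr_norml => /andP[h _].
  have nE : n%:R * al2 = n%:R * al + 2 * (n%:R * d2) by rewrite d2E; ring.
  by have := mulr_gt0 n0 d20; lra.
have bnd (v pv : R) (j : nat) : (j <= n)%N -> `|v - u| = et ->
   pu + al * (v - u) <= pv ->
   expR (n%:R * (Dn + pv - et) - j%:R * v) <= a n j ->
   expR (n%:R * (Dn + pu - 3 * et)) <= a n j * expR u ^+ j.
  move=> jn vu cv h; rewrite -expRM_natl -ler_pdivrMr ?expR_gt0//.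
  rewrite -expRN -expRD (le_trans _ h)// ler_expR.
  have jr : j%:R <= n%:R :> R by rewrite ler_nat.
  have b1 : j%:R * (v - u) <= n%:R * et.
    rewrite (le_trans (ler_norm _))// normrM vu ger0_norm//.
    by rewrite ler_wpM2r// ltW.
  have b2 : pu - et <= pv.
    rewrite (le_trans _ cv)// lerD2l lerNl -mulrN.
    rewrite (le_trans (ler_norm _))// normrM normrN vu.
    by rewrite ger0_norm// ler_piMl// ltW.
  have : n%:R * (Dn + pu - et) <= n%:R * (Dn + pv).
    by apply: ler_wpM2l; [exact: ltW|lra].
  by rewrite !mulrDr !mulrN; lra.
have b1 : expR (n%:R * (Dn + pu - 3 * et)) <= a n k1 * expR u ^+ k1.
  by apply: bnd k1a => //; rewrite v1E addrC addKr normrN gtr0_norm.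
have b2 : expR (n%:R * (Dn + pu - 3 * et)) <= a n k2 * expR u ^+ k2.
  by apply: bnd k2a => //; rewrite v2E addrC addKr gtr0_norm.
have : expR (n%:R * (Dn + pu - 3 * et)) <= a n k * expR u ^+ k.
  have kk : (k1 <= k <= k2)%N by rewrite k1k.
  have := bernoulli_gf_tilt_min (ltW (expR_gt0 u)) (S01 (n := n)) kk.
  rewrite /a -!mulrA in b1 b2 *.
  rewrite ge_min => /orP[h|h]; [apply: (le_trans b1)|apply: (le_trans b2)];
  by rewrite ler_pM2l.
rewrite -expRM_natl -ler_pdivrMr ?expR_gt0// => h; rewrite (le_trans _ h)//.
rewrite -expRN -expRD ler_expR.
have nu : `|u| / et < n%:R by near: n; exact: near_gt.
move: nu; rewrite ltr_pdivrMr// => nu.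
have : (k%:R - al * n%:R) * u <= `|u|.
  rewrite (le_trans (ler_norm _))// normrM ler_piMl//.
  by rewrite ler_norml; apply/andP; split; lra.
by rewrite eE !mulrDr !mulrN; lra.
Unshelve. all: by end_near. Qed.

End LargeDeviations.

(** * Comparison with the exponential profile *)

Lemma near_ex4 (U : set_system nat) (PU : ProperFilter U)
    (P1 P2 P3 P4 : nat -> Prop) : (\forall n \near U, P1 n) ->
  (\forall n \near U, P2 n) -> (\forall n \near U, P3 n) ->
  (\forall n \near U, P4 n) -> exists n, [/\ P1 n, P2 n, P3 n & P4 n].
Proof.
move=> h1 h2 h3 h4; near U => n.
by exists n; split; near: n.
Unshelve. all: by end_near. Qed.

Section ProfileIdentification.
Variables (R : realType) (d : measure_display) (T : measurableType d).
Variables (P : probability T R) (X : T -> R).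
Hypothesis mX : measurable_fun setT X.
Hypothesis X01 : forall w, 0 <= X w <= 1.
Variables (U : set_system nat) (S : nat -> seq R) (c : nat -> R).
Hypothesis UU : UltraFilter U.
Hypothesis sub_U : \oo `<=` U.
Hypothesis S01 : forall n, in01 (S n).
Hypothesis S_size : forall n, size (S n) = n.
Hypothesis c_gt0 : forall n, 0 < c n.
Hypothesis S_cvg : forall f : R -> R, {within `[(0 : R), 1], continuous f} ->
  (\sum_(s <- S n) f s) / n%:R @[n --> U] --> mean P X f.
Variables (m M : R) (g : R -> R).
Hypothesis m_ge0 : 0 <= m.
Hypothesis mM : m < M.
Hypothesis M_le1 : M <= 1.

Local Notation A := (tilted_moment P X).
Local Notation Psi := (logmgf P X).

Let a n k : R := c n * (bernoulli_gf (S n))`_k.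
Let D n : R := ln (c n) / n%:R.

Hypothesis prof_in : forall al e : R, m < al < M -> 0 < e ->
  \forall n \near U, expR (n%:R * (g al - e)) <= a n (Num.truncn (al * n%:R)) /\
    a n (Num.truncn (al * n%:R)) <= expR (n%:R * (g al + e)).
Hypothesis prof_out : forall al B : R, (0 <= al < m) || (M < al <= 1) ->
  \forall n \near U, a n (Num.truncn (al * n%:R)) <= expR (n%:R * B).

Let PU : ProperFilter U := ultra_proper.

Lemma coef_descend n i k j t : 0 <= t -> (i <= k <= j)%N ->
  a n k * t ^+ k < a n j * t ^+ j -> a n i * t ^+ i <= a n k * t ^+ k.
Proof.
move=> t0 ikj; have := bernoulli_gf_tilt_min t0 (S01 (n := n)) ikj.
rewrite /a -!mulrA ltr_pM2l// ler_pM2l// ge_min => /orP[//|h1 h2].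
by have := le_lt_trans h1 h2; rewrite ltxx.
Qed.

Lemma coef_ascend n i k j t : 0 <= t -> (i <= k <= j)%N ->
  a n k * t ^+ k < a n i * t ^+ i -> a n j * t ^+ j <= a n k * t ^+ k.
Proof.
move=> t0 ikj; have := bernoulli_gf_tilt_min t0 (S01 (n := n)) ikj.
rewrite /a -!mulrA ltr_pM2l// ler_pM2l// ge_min => /orP[h1 h2|//].
by have := le_lt_trans h1 h2; rewrite ltxx.
Qed.

(** Unimodality under a steep enough tilt bounds the coefficients on one side
    of an interior index by the one at that index. *)
Lemma coef_bound_left (al be : R) : m < al -> al < be -> be < M ->
  exists B, \forall n \near U, forall k, (k <= Num.truncn (al * n%:R))%N ->
    a n k <= expR (n%:R * B).
Proof.
move=> mal albe beM.
have alI : m < al < M by rewrite mal (lt_trans albe).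
have beI : m < be < M by rewrite beM (lt_trans mal).
have al0 : 0 <= al by rewrite ltW// (le_lt_trans m_ge0).
have be0 : 0 <= be by rewrite (le_trans al0)// ltW.
have ab0 : 0 < be - al by rewrite subr_gt0.
(* Tilting by exp v makes the coefficient at be exceed the one at al: the slope
   beats the profile, and the 3 absorbs two errors of 1 and the rounding. *)
pose v := (`|g al - g be| + 3) / (be - al).
have v0 : 0 < v by rewrite divr_gt0// ltr_wpDl.
exists (g al + 1 + v).
have p1 := prof_in alI ltr01; have p2 := prof_in beI ltr01.
near=> n => k kk1.
have n0 : 0 < n%:R :> R by near: n; exact: near_gt.
have [l1 u1] : expR (n%:R * (g al - 1)) <= a n (Num.truncn (al * n%:R)) /\
    a n (Num.truncn (al * n%:R)) <= expR (n%:R * (g al + 1)) by near: n.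
have [l2 u2] : expR (n%:R * (g be - 1)) <= a n (Num.truncn (be * n%:R)) /\
    a n (Num.truncn (be * n%:R)) <= expR (n%:R * (g be + 1)) by near: n.
have /andP[t1 t2] := trunc_near n al0; have /andP[t3 t4] := trunc_near n be0.
set k1 := Num.truncn (al * n%:R) in kk1 l1 u1 t1 t2 *.
set k2 := Num.truncn (be * n%:R) in l2 u2 t3 t4 *.
have k12 : (k1 <= k2)%N by apply: le_truncn; rewrite ler_wpM2r// ltW.
have nv : v < n%:R by near: n; exact: near_gt.
have lt12 : a n k1 * expR v ^+ k1 < a n k2 * expR v ^+ k2.
  rewrite -!expRM_natl.
  apply: (@le_lt_trans _ _ (expR (n%:R * (g al + 1)) * expR (k1%:R * v))).
    by rewrite ler_wpM2r// expR_ge0.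
  apply: (@lt_le_trans _ _ (expR (n%:R * (g be - 1)) * expR (k2%:R * v))); last first.
    by rewrite ler_wpM2r// expR_ge0.
  rewrite -!expRD ltr_expR.
  have h1 : v * ((be - al) * n%:R - 1) <= v * (k2%:R - k1%:R).
    by rewrite ler_wpM2l ?(ltW v0)//; lra.
  have h2 : v * ((be - al) * n%:R - 1) = n%:R * (`|g al - g be| + 3) - v.
    by rewrite /v; field; rewrite gt_eqF.
  have h3 : n%:R * (g al - g be) <= n%:R * `|g al - g be|.
    by rewrite ler_wpM2l ?(ltW n0)// ler_norm.
  by lra.
have kk : (k <= k1 <= k2)%N by rewrite kk1.
have := coef_descend (expR_ge0 v) kk lt12.
rewrite -!expRM_natl -ler_pdivlMr ?expR_gt0// => h; rewrite (le_trans h)//.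
rewrite -mulrA -expRN -expRD mulrDr [leRHS]expRD.
rewrite ler_pM ?expR_ge0//; last first.
  rewrite ler_expR -mulrBl ler_wpM2r ?(ltW v0)//.
  have k1n : k1%:R <= n%:R :> R.
    have al1 : al <= 1 by rewrite (le_trans (ltW albe))// (le_trans (ltW beM)).
    by apply: (le_trans t2); rewrite ler_piMl// ltW.
  by have := ler0n R k; lra.
by rewrite mulr_ge0 ?(ltW (c_gt0 n))// bernoulli_gf_coef_ge0.
Unshelve. all: by end_near. Qed.

Lemma coef_bound_right (al be : R) : m < al -> al < be -> be < M ->
  exists B, \forall n \near U, forall k, (Num.truncn (be * n%:R) <= k)%N ->
    (k <= n)%N -> a n k <= expR (n%:R * B).
Proof.
move=> mal albe beM.
have alI : m < al < M by rewrite mal (lt_trans albe).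
have beI : m < be < M by rewrite beM (lt_trans mal).
have al0 : 0 <= al by rewrite ltW// (le_lt_trans m_ge0).
have be0 : 0 <= be by rewrite (le_trans al0)// ltW.
have ab0 : 0 < be - al by rewrite subr_gt0.
pose v := (`|g al - g be| + 3) / (be - al).
have v0 : 0 < v by rewrite divr_gt0// ltr_wpDl.
exists (g be + 1 + v).
have p1 := prof_in alI ltr01; have p2 := prof_in beI ltr01.
near=> n => k kk1 kn.
have n0 : 0 < n%:R :> R by near: n; exact: near_gt.
have [l1 u1] : expR (n%:R * (g al - 1)) <= a n (Num.truncn (al * n%:R)) /\
    a n (Num.truncn (al * n%:R)) <= expR (n%:R * (g al + 1)) by near: n.
have [l2 u2] : expR (n%:R * (g be - 1)) <= a n (Num.truncn (be * n%:R)) /\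
    a n (Num.truncn (be * n%:R)) <= expR (n%:R * (g be + 1)) by near: n.
have /andP[t1 t2] := trunc_near n al0; have /andP[t3 t4] := trunc_near n be0.
set k1 := Num.truncn (al * n%:R) in l1 u1 t1 t2 *.
set k2 := Num.truncn (be * n%:R) in kk1 l2 u2 t3 t4 *.
have k12 : (k1 <= k2)%N by apply: le_truncn; rewrite ler_wpM2r// ltW.
have nv : v < n%:R by near: n; exact: near_gt.
have lt12 : a n k2 * expR (- v) ^+ k2 < a n k1 * expR (- v) ^+ k1.
  rewrite -!expRM_natl.
  apply: (@le_lt_trans _ _ (expR (n%:R * (g be + 1)) * expR (k2%:R * - v))).
    by rewrite ler_wpM2r// expR_ge0.
  apply: (@lt_le_trans _ _ (expR (n%:R * (g al - 1)) * expR (k1%:R * - v))); last first.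
    by rewrite ler_wpM2r// expR_ge0.
  rewrite -!expRD ltr_expR.
  have h1 : v * ((be - al) * n%:R - 1) <= v * (k2%:R - k1%:R).
    by rewrite ler_wpM2l ?(ltW v0)//; lra.
  have h2 : v * ((be - al) * n%:R - 1) = n%:R * (`|g al - g be| + 3) - v.
    by rewrite /v; field; rewrite gt_eqF.
  have h3 : n%:R * (g be - g al) <= n%:R * `|g al - g be|.
    by rewrite ler_wpM2l ?(ltW n0)// distrC ler_norm.
  by lra.
have kk : (k1 <= k2 <= k)%N by rewrite k12.
have := coef_ascend (expR_ge0 (- v)) kk lt12.
rewrite -!expRM_natl -ler_pdivlMr ?expR_gt0// => h; rewrite (le_trans h)//.
rewrite -mulrA -expRN -expRD mulrDr [leRHS]expRD.
rewrite ler_pM ?expR_ge0//; last first.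
  rewrite ler_expR !mulrN opprK addrC -mulrBl ler_wpM2r ?(ltW v0)//.
  have k1n : k%:R <= n%:R :> R by rewrite ler_nat.
  by have := ler0n R k2; lra.
by rewrite mulr_ge0 ?(ltW (c_gt0 n))// bernoulli_gf_coef_ge0.
Unshelve. all: by end_near. Qed.

(** Three interior points bound all coefficients, hence their sum, from above;
    one interior coefficient bounds the sum from below. *)
Lemma logmass_bounded : exists B, \forall n \near U, - B <= D n <= B.
Proof.
pose a1 := m + (M - m) / 4; pose a2 := m + (M - m) / 2; pose a3 := m + (M - m) * (3 / 4).
have Mm : 0 < M - m by rewrite subr_gt0.
have o1 : m < a1 by rewrite /a1; lra.
have o2 : a1 < a2 by rewrite /a1 /a2; lra.
have o3 : a2 < a3 by rewrite /a3 /a2; lra.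
have o4 : a3 < M by rewrite /a3; lra.
have [B1 h1] := coef_bound_left (lt_trans o1 o2) o3 o4.
have [B2 h2] := coef_bound_right o1 o2 (lt_trans o3 o4).
have a2I : m < a2 < M by rewrite (lt_trans o1 o2) (lt_trans o3 o4).
have a20 : 0 <= a2 by rewrite (le_trans m_ge0)// ltW// (lt_trans o1).
have p := prof_in a2I ltr01.
exists (Num.max (Num.max B1 B2 + 1) (`|g a2| + 1)).
near=> n.
have n0 : 0 < n%:R :> R by near: n; exact: near_gt.
have n0' : (0 < n)%N by rewrite -(ltr0n R).
have hB1 : forall k, (k <= Num.truncn (a2 * n%:R))%N ->
    a n k <= expR (n%:R * B1) by near: n.
have hB2 : forall k, (Num.truncn (a2 * n%:R) <= k)%N -> (k <= n)%N ->
    a n k <= expR (n%:R * B2) by near: n.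
have hB k : (k <= n)%N -> a n k <= expR (n%:R * Num.max B1 B2).
  move=> kn; have [/hB1|/ltnW/hB2 h] := leqP k (Num.truncn (a2 * n%:R)).
    by move=> /le_trans; apply; rewrite ler_expR ler_wpM2l// le_max lexx.
  by rewrite (le_trans (h kn))// ler_expR ler_wpM2l// le_max lexx orbT.
have [pl _] : expR (n%:R * (g a2 - 1)) <= a n (Num.truncn (a2 * n%:R)) /\
    a n (Num.truncn (a2 * n%:R)) <= expR (n%:R * (g a2 + 1)) by near: n.
have cE : c n = expR (n%:R * D n) by rewrite expR_logmass.
apply/andP; split.
  rewrite lerNl le_max; apply/orP; right.
  have : n%:R * (g a2 - 1) <= n%:R * D n.
    rewrite -ler_expR -cE (le_trans pl)// ger_pMr//.
    exact: bernoulli_gf_coef_le1.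
  by rewrite ler_pM2l// => h; have := ler_norm (- g a2); rewrite normrN; lra.
rewrite le_max; apply/orP; left.
rewrite -(ler_pM2l n0) -ler_expR -cE.
have -> : c n = \sum_(k < n.+1) a n k.
  have := bernoulli_gf_sum (S n); rewrite S_size => h.
  by rewrite -mulr_sumr h mulr1.
apply: (@le_trans _ _ (\sum_(k < n.+1) expR (n%:R * Num.max B1 B2))).
  by apply: ler_sum => k _; apply: hB; rewrite -ltnS.
rewrite sumr_const card_ord mulrDr expRD -[leLHS]mulr_natr ler_wpM2l ?expR_ge0//.
have : 2 * n.+1%:R <= expR (n%:R * 1) :> R by near: n; exact: subexponential.
by have := ler0n R n.+1; lra.
Unshelve. all: by end_near. Qed.

(** Chernoff's bound keeps the profile below every line of slope -u and height
    C + Psi u at 0, and coef_lower_at shows that the line is attained at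
    A 1 u. The end points of the interval follow because the first bound is
    -oo outside the range of the tilted mean, and the second is finite inside. *)
Theorem profile_identification : exists C : R,
  [/\ D @ U --> C, mass_at P X 1 = m, 1 - mass_at P X 0 = M,
      forall u, m < A 1 u < M &
      forall u, g (A 1 u) = C + Psi u - A 1 u * u].
Proof.
have mM' := mM.
have [B hB] := logmass_bounded.
have [C DC] := ultra_bounded_cvg UU hB.
have DCe (e : R) : 0 < e -> \forall n \near U, `|C - D n| <= e.
  by move=> e0; have /cvgrPdist_le := DC; exact.
set lo := mass_at P X 1; set hi := 1 - mass_at P X 0.
have up al u : m < al < M -> g al <= C + Psi u - al * u.
  move=> alI; apply/ler_addgt0Pr => e e0.
  have e30 : 0 < e / 3 by rewrite divr_gt0.
  have al0 : 0 <= al by have /andP[h _] := alI; rewrite (le_trans m_ge0)// ltW.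
  have h1 := coef_upper PU sub_U S01 c_gt0 S_cvg u al0 e30.
  have [n [q1 q2 q3 [q4 _]]] := near_ex4 PU (near_gt sub_U (0 : R)) h1 (DCe _ e30)
    (prof_in alI e30).
  have := le_trans q4 q2; rewrite ler_expR ler_pM2l//.
  move: q3; rewrite ler_norml /D => /andP[r1 r2]; lra.
(* Letting u tend to -oo in up, with Psi u <= u * lo. *)
have lo_le al : m < al < M -> lo <= al.
  move=> alI; rewrite leNgt; apply/negP => allo.
  have l0 : 0 < lo - al by rewrite subr_gt0.
  pose u := - ((`|g al - C| + 1) / (lo - al)).
  have u0 : u <= 0 by rewrite /u oppr_le0 divr_ge0 ?(ltW l0)// addr_ge0.
  have h1 := up al u alI; have h2 := logmgf_le_left P mX X01 u0.
  have h3 : u * (lo - al) = - (`|g al - C| + 1).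
    by rewrite /u; field; rewrite gt_eqF.
  have h4 := ler_norm (- (g al - C)); rewrite normrN in h4.
  rewrite -/lo in h2; lra.
have le_hi al : m < al < M -> al <= hi.
  move=> alI; rewrite leNgt; apply/negP => allo.
  have l0 : 0 < al - hi by rewrite subr_gt0.
  pose u := (`|g al - C| + 1) / (al - hi).
  have u0 : 0 <= u by rewrite /u divr_ge0 ?(ltW l0)// addr_ge0.
  have h1 := up al u alI; have h2 := logmgf_le_right P mX X01 u0.
  have h3 : u * (al - hi) = (`|g al - C| + 1).
    by rewrite /u; field; rewrite gt_eqF.
  have h4 := ler_norm (- (g al - C)); rewrite normrN in h4.
  rewrite -/hi in h2; lra.
have lom : lo <= m.
  rewrite leNgt; apply/negP => mlo.
  pose al := Num.min ((m + lo) / 2) ((m + M) / 2).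
  have : lo <= al.
    apply: lo_le; rewrite /al lt_min gt_min; apply/andP; split.
      by apply/andP; split; lra.
    by apply/orP; right; lra.
  by rewrite /al le_min => /andP[h _]; lra.
have Mhi : M <= hi.
  rewrite leNgt; apply/negP => hiM.
  pose al := Num.max ((M + hi) / 2) ((m + M) / 2).
  have : al <= hi.
    apply: le_hi; rewrite /al lt_max gt_max; apply/andP; split.
      by apply/orP; right; lra.
    by apply/andP; split; lra.
  by rewrite /al ge_max => /andP[h _]; lra.
have nd : lo < hi by lra.
have Ah := tilted_mean_homo mX X01 nd.
have Alo u : lo <= A 1 u by exact: tilted_mean_ge.
have Ahi u : A 1 u <= hi by exact: tilted_mean_le.
have A01 u : 0 <= A 1 u <= 1.
  have := Alo u; have := Ahi u; have := mass_at_ge0 P X 1; have := mass_at_ge0 P X 0.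
  by rewrite -/lo /hi => *; apply/andP; split; lra.
have low u e : 0 < e -> \forall n \near U,
    expR (n%:R * (D n + Psi u - A 1 u * u - e)) <= a n (Num.truncn (A 1 u * n%:R)).
  by move=> e0; apply: coef_lower_at.
(* Outside [m, M] the coefficients would be smaller than the lower bound. *)
have Acc u : m <= A 1 u <= M.
  apply/negPn/negP; rewrite negb_and -!ltNge => out.
  have /andP[A0 A1] := A01 u.
  have out' : (0 <= A 1 u < m) || (M < A 1 u <= 1).
    by case/orP: out => ->; rewrite ?A0 ?A1 ?orbT.
  have h1 := prof_out (C + Psi u - A 1 u * u - 3) out'.
  have [n [q1 q2 q3 q4]] := near_ex4 PU (near_gt sub_U (0 : R)) h1 (DCe 1 ltr01)
    (low u 1 ltr01).
  have := le_trans q4 q2; rewrite ler_expR ler_pM2l//.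
  move: q3; rewrite ler_norml => /andP[r1 r2]; lra.
(* Strict monotonicity turns the closed interval into the open one. *)
have Aoo u : m < A 1 u < M.
  have /andP[h1 _] := Acc (u - 1); have /andP[_ h2] := Acc (u + 1).
  have h3 : A 1 (u - 1) < A 1 u by apply: Ah; rewrite gtrBl.
  have h4 : A 1 u < A 1 (u + 1) by apply: Ah; rewrite ltrDl.
  by apply/andP; split; [exact: le_lt_trans h1 h3|exact: lt_le_trans h4 h2].
exists C; split => //.
- apply/eqP; rewrite eq_le lom/=; apply/ler_addgt0Pr => e e0.
  have [u hu] := tilted_mean_lim_left P mX X01 e0.
  by have /andP[h _] := Acc u; rewrite (le_trans h)// ltW.
- apply/eqP; rewrite eq_le Mhi andbT; apply/ler_addgt0Pr => e e0.
  have [u hu] := tilted_mean_lim_right P mX X01 e0.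
  by have /andP[_ h] := Acc u; rewrite -/hi in hu; lra.
move=> u; apply/eqP; rewrite eq_le up//=.
apply/ler_addgt0Pr => e e0; have e30 : 0 < e / 3 by rewrite divr_gt0.
have [n [q1 q2 q3 [_ q4]]] := near_ex4 PU (near_gt sub_U (0 : R)) (low u _ e30)
  (DCe _ e30) (prof_in (Aoo u) e30).
have := le_trans q2 q4; rewrite ler_expR ler_pM2l//.
move: q3; rewrite ler_norml => /andP[r1 r2]; lra.
Qed.

End ProfileIdentification.

(** * Factorisation over the roots *)

Section Factorization.
Variable R : realType.
Implicit Types (p : {poly R}) (z : R[i]) (x : R).

Lemma complex_le0 z : z <= 0 -> z = (complex.Re z)%:C%C /\ complex.Re z <= 0.
Proof.
by case: z => a b; rewrite lecE /= => /andP[/eqP <- ->].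
Qed.

(** The parameter attached to a root: the image of the root under the order
    isomorphism of [-oo, 0] with [0, 1]. *)
Definition root_param z : R := (1 - complex.Re z)^-1.

Lemma zerosE p : embedC p = (real_complex R (lead_coef p)) *:
  \prod_(z <- zeros p) ('X - z%:P).
Proof.
rewrite {1}(svalP (closed_field_poly_normal (embedC p))) -/(zeros p).
by rewrite /embedC lead_coef_map.
Qed.

Lemma size_zeros p : p != 0 -> size (zeros p) = (size p).-1.
Proof.
move=> p0; have lp0 : real_complex R (lead_coef p) != 0.
  by rewrite fmorph_eq0 lead_coef_eq0.
have <- : size (embedC p) = size p by rewrite size_map_poly.
by rewrite zerosE size_scale// size_prod_XsubC.
Qed.

Lemma root_zeros p z : p != 0 -> z \in zeros p -> root (embedC p) z.
Proof.
move=> p0 zp; rewrite zerosE rootZ ?root_prod_XsubC//.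
by rewrite fmorph_eq0 lead_coef_eq0.
Qed.

Lemma nonpos_rootedE p : p != 0 -> nonpos_rooted p ->
  p = lead_coef p *: \prod_(z <- zeros p) ('X - (complex.Re z)%:P).
Proof.
move=> p0 pr; apply: (map_poly_inj (real_complex R)).
rewrite -[LHS]/(embedC p) zerosE map_polyZ rmorph_prod.
congr (_ *: _); rewrite !big_seq; apply: eq_bigr => z zp.
rewrite rmorphB /= map_polyX map_polyC /=.
have [zE _] := complex_le0 (pr z (root_zeros p0 zp)).
by rewrite [in LHS]zE.
Qed.

(** The factor of the parameter 1 / (1 - x) is the linear factor with zero x,
    normalised to take the value 1 at 1. *)
Lemma bernoulli_factor x : x <= 0 ->
  (1 - (1 - x)^-1)%:P + (1 - x)^-1 *: 'X = (1 - x)^-1 *: ('X - x%:P).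
Proof.
move=> x0; have d0 : 1 - x != 0 by rewrite gt_eqF//; lra.
rewrite scalerBr addrC; congr (_ + _).
rewrite -mul_polyC -polyCM -polyCN; congr (_%:P).
by field.
Qed.

Lemma root_param01 x : x <= 0 -> 0 < (1 - x)^-1 <= 1.
Proof.
move=> x0; have d0 : 1 <= 1 - x by lra.
rewrite invr_gt0 (lt_le_trans ltr01 d0)/=.
by rewrite invf_le1// (lt_le_trans ltr01).
Qed.

(** The zeros at infinity get the parameter 0. Sorting makes the sequence a
    table of the quantile function. *)
Definition params n p : seq R :=
  sort <=%R (map root_param (zeros p) ++ nseq (n - (size p).-1) 0).

Lemma size_params n p : p != 0 -> (size p <= n.+1)%N -> size (params n p) = n.
Proof.
move=> p0 pn; rewrite size_sort size_cat size_map size_nseq size_zeros// subnKC//.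
by rewrite -ltnS prednK// lt0n size_poly_eq0.
Qed.

Lemma sorted_params n p : sorted <=%R (params n p).
Proof. exact/sort_sorted/le_total. Qed.

Lemma params01 n p : p != 0 -> nonpos_rooted p -> in01 (params n p).
Proof.
move=> p0 pr s; rewrite mem_sort mem_cat => /orP[/mapP[z zp ->]|].
  have [_ h] := complex_le0 (pr z (root_zeros p0 zp)).
  by have /andP[/ltW h0 h1] := root_param01 h; rewrite h0.
by rewrite mem_nseq => /andP[_ /eqP ->]; rewrite lexx ler01.
Qed.

Lemma sum_params n p (f : R -> R) :
  \sum_(s <- params n p) f s =
  \sum_(z <- zeros p) f (root_param z) + (n - (size p).-1)%:R * f 0.
Proof.
rewrite (perm_big _ (permEl (perm_sort _ _))) big_cat big_map /=.
by rewrite big_nseq iter_addr_0 mulr_natl.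
Qed.

Lemma bernoulli_gf_params n p : p != 0 -> nonpos_rooted p ->
  bernoulli_gf (params n p) =
  (\prod_(z <- zeros p) root_param z) *:
    \prod_(z <- zeros p) ('X - (complex.Re z)%:P).
Proof.
move=> p0 pr; rewrite /bernoulli_gf.
rewrite (perm_big _ (permEl (perm_sort _ _))) big_cat big_map /= big_nseq.
rewrite subr0 scale0r addr0.
have -> k : iter k ( *%R (1%:P : {poly R})) 1 = 1.
  by elim: k => //= k ->; rewrite mulr1.
rewrite mulr1 -scaler_prod !big_seq; apply: eq_bigr => z zp.
have [_ h] := complex_le0 (pr z (root_zeros p0 zp)).
exact: bernoulli_factor.
Qed.

Lemma poly_bernoulli_gf n p : p != 0 -> nonpos_rooted p ->
  p = p.[1] *: bernoulli_gf (params n p).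
Proof.
move=> p0 pr; pose pi := \prod_(z <- zeros p) root_param z.
have pi0 : pi != 0.
  rewrite prodf_seq_neq0; apply/allP => z zp /=.
  have [_ h] := complex_le0 (pr z (root_zeros p0 zp)).
  by have /andP[/lt0r_neq0] := root_param01 h.
have e : p = (lead_coef p / pi) *: bernoulli_gf (params n p).
  rewrite bernoulli_gf_params// scalerA divfK//.
  exact: nonpos_rootedE.
have -> : p.[1] = lead_coef p / pi.
  by rewrite {1}e hornerZ bernoulli_gf1 mulr1.
exact: e.
Qed.

Lemma horner1_gt0 p : p != 0 -> nonpos_rooted p -> (forall k, 0 <= p`_k) ->
  0 < p.[1].
Proof.
move=> p0 pr pge0; rewrite lt_neqAle; apply/andP; split.
  apply/eqP => e; have := p0; rewrite (poly_bernoulli_gf 0 p0 pr) -e scale0r.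
  by rewrite eqxx.
rewrite horner_coef; apply: sumr_ge0 => i _.
by rewrite expr1n mulr1.
Qed.

End Factorization.

(** * The change of variable between [-oo, 0] and [0, 1] *)

Section ExtendedLine.
Variable R : realType.
Implicit Types (x : \bar R) (s r : R).

Local Notation I01 := (`[(0:R), 1]%classic).

(** The map z |-> 1 / (1 - z) identifies the compact interval [-oo, 0] with
    [0, 1], sending -oo to 0; it is extended by 1 to positive arguments. *)
Definition to01 (x : \bar R) : R :=
  match x with
  | r%:E => if r <= 0 then (1 - r)^-1 else 1
  | +oo%E => 1
  | -oo%E => 0
  end.

Definition from01 (s : R) : \bar R := if 0 < s then (1 - s^-1)%:E else -oo%E.

Lemma to01_itv x : 0 <= to01 x <= 1.
Proof.
case: x => [r||] /=; rewrite ?lexx ?ler01//.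
have [r0|_] := leP r 0; last by rewrite lexx ler01.
by have /andP[/ltW-> ->] := root_param01 r0.
Qed.

Lemma from01_le0 s : s <= 1 -> (from01 s <= 0)%E.
Proof.
rewrite /from01; case: ltP => // s0 s1.
by rewrite lee_fin subr_le0 invf_ge1.
Qed.

Lemma from01K s : 0 <= s <= 1 -> to01 (from01 s) = s.
Proof.
move=> /andP[]; rewrite le_eqVlt => /predU1P[<- _|s0 s1].
  by rewrite /from01 ltxx.
by rewrite /from01 s0 /= subr_le0 invf_ge1// s1 opprB addrC subrK invrK.
Qed.

Lemma to01K x : (x <= 0)%E -> from01 (to01 x) = x.
Proof.
case: x => [r|//|] /=; last by rewrite /from01 ltxx.
rewrite lee_fin => r0; rewrite r0 /from01.
have /andP[-> _] := root_param01 r0.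
by rewrite invrK opprB addrC subrK.
Qed.

Lemma le_invr_sym (a b : R) : 0 < a -> 0 < b -> (a <= b^-1) = (b <= a^-1).
Proof. by move=> a0 b0; rewrite -[a in LHS]invrK lef_pV2 ?posrE ?invr_gt0. Qed.

Lemma measurable_to01 : measurable_fun [set: \bar R] to01.
Proof.
apply: (measurability (@RGenCInfty.G R)) => [|/= _ [_] [r] -> <-].
  exact: RGenCInfty.measurableE.
rewrite setTI; have [r0|r0] := leP r 0.
  rewrite (_ : _ @^-1` _ = setT)//; apply/seteqP; split => // x _.
  by rewrite /= in_itv/= andbT (le_trans r0)//; have /andP[] := to01_itv x.
have [r1|r1] := ltP 1 r.
  rewrite (_ : _ @^-1` _ = set0)//; apply/seteqP; split => // x.
  rewrite /= in_itv/= andbT => h; have /andP[_ h1] := to01_itv x.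
  by have := lt_le_trans (lt_le_trans r1 h) h1; rewrite ltxx.
rewrite (_ : _ @^-1` _ = [set x | ((1 - r^-1)%:E <= x)%E]).
  rewrite (_ : [set x | _] = `[(1 - r^-1)%:E, +oo%E]%classic); last first.
    by apply/seteqP; split => x /=; rewrite in_itv/= leey andbT.
  exact: emeasurable_itv.
have h0 : 1 - r^-1 <= 0 by rewrite subr_le0 invf_ge1.
apply/seteqP; split => [[s||]|[s||]] //=; rewrite !in_itv/= ?andbT ?lee_fin ?leey//.
- have [s0|s0] := leP s 0; last first.
    by move=> _; rewrite (le_trans h0)// ltW.
  by rewrite le_invr_sym//; lra.
- by rewrite leNgt r0.
- move=> h; have [s0|//] := leP s 0.
  by rewrite le_invr_sym//; lra.
Qed.

Lemma measurable_from01 : measurable_fun [set: R] from01.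
Proof.
apply: (measurability _ (ErealGenCInfty.measurableE R)) => /= _ [_] [r] -> <-.
rewrite setTI; have [r1|r1] := leP 1 r.
  rewrite (_ : _ @^-1` _ = set0)//; apply/seteqP; split => // s.
  rewrite /= /from01; case: ltP => s0; rewrite in_itv/= ?andbT// lee_fin.
  by have := invr_gt0 s; rewrite s0 => h; lra.
have d0 : 0 < 1 - r by rewrite subr_gt0.
rewrite (_ : _ @^-1` _ = `[(1 - r)^-1, +oo[%classic)//.
apply/seteqP; split => s /=; rewrite /from01; case: ltP => s0; rewrite !in_itv/= ?andbT// ?lee_fin.
- by move=> h; rewrite -[leRHS]invrK le_invr_sym ?invr_gt0// invrK; lra.
- by move=> h; have := h; rewrite -[s in X in X -> _]invrK le_invr_sym ?invr_gt0// invrK; lra.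
- move=> h; have h1 : 0 < (1 - r)^-1 by rewrite invr_gt0.
  by have := lt_le_trans h1 (le_trans h s0); rewrite ltxx.
Qed.

(** Continuity at 0 is the convergence of 1 - 1/s to -oo. *)
Lemma from01_within_continuous (f : \bar R -> R) :
  {within @nonpos R, continuous f} -> {within I01, continuous (f \o from01)}.
Proof.
move=> /subspace_continuousP cf; apply/subspace_continuousP => s.
rewrite /= in_itv/= => /andP[s0 s1].
have fs0 : @nonpos R (from01 s) by exact: from01_le0.
apply: cvg_trans (cf _ fs0).
suff h : from01 @ within I01 (nbhs s) --> within (@nonpos R) (nbhs (from01 s)).
  by move=> B hB; exact: (h _ hB).
move=> B hB; change (\forall x \near from01 s, @nonpos R x -> B x) in hB.
change (\forall t \near s, I01 t -> B (from01 t)).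
suff h : \forall t \near s, I01 t -> (@nonpos R (from01 t) -> B (from01 t)).
  apply: filterS h => t h It; apply: h => //.
  by apply: from01_le0; move: It; rewrite /= in_itv/= => /andP[].
move: s0; rewrite le_eqVlt => /predU1P[s0|s0].
  move: hB; rewrite -s0 /from01 ltxx => -[A [Ar hA]].
  have : \forall t \near (0 : R), t < (1 + `|A|)^-1.
    by apply: (cvgr_lt (0 : R) cvg_id); rewrite invr_gt0 ltr_pwDl.
  apply: filterS => t tA It; apply: hA.
  have [t0|_] := ltP (0 : R) t; last by rewrite ltNyr.
  rewrite lte_fin; have : 1 + `|A| < t^-1.
    by rewrite -[ltLHS]invrK ltf_pV2 ?posrE ?invr_gt0 ?ltr_pwDl.
  by have := ler_norm (- A); rewrite normrN; lra.
move: hB; rewrite /from01 s0 => hB.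
have c : (fun t : R => 1 - t^-1) @ s --> 1 - s^-1.
  apply: cvgB; first exact: cvg_cst.
  by apply: cvgV; [rewrite gt_eqF|exact: cvg_id].
have h : (fun t : R => (1 - t^-1)%:E) @ s --> (1 - s^-1)%:E.
  by apply: cvg_EFin; [exact: nearW|exact: c].
have h2 := h _ hB.
have h3 : \forall t \near s, 0 < t by exact: (cvgr_gt s cvg_id).
near=> t => _; have t0 : 0 < t by near: t.
rewrite t0; near: t; exact: h2.
Unshelve. all: by end_near. Qed.

End ExtendedLine.

(** * Zero distributions and integral transforms *)

Section ZeroDistribution.
Variable R : realType.

Local Notation I01 := (`[(0:R), 1]%classic).
Local Notation D := (@nonpos R).

Lemma nonposE : D = `]-oo, 0%E]%classic.
Proof. by apply/seteqP; split=> x /=; rewrite in_itv. Qed.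

Lemma measurable_nonpos : measurable D.
Proof. rewrite nonposE; exact: emeasurable_itv. Qed.

(** Up to the change of variable this is the measurability of a function that is
    continuous on [0, 1]. *)
Lemma nonpos_measurable_fun (f : \bar R -> R) :
  {within D, continuous f} -> measurable_fun D f.
Proof.
move=> cf; have cg := from01_within_continuous cf.
have mg := subspace_continuous_measurable_fun (measurable_itv `[(0:R), 1]) cg.
have h := measurable_comp01 (@measurable_to01 R) (@to01_itv R) mg.
apply: (eq_measurable_fun (fun x => (f \o @from01 R) (to01 x))).
  by move=> x; rewrite inE => Dx /=; rewrite to01K.
exact: measurable_funTS.
Qed.

Lemma zero_distribution_ge0_integral n (p : {poly R}) (h : \bar R -> \bar R) :
  p != 0 -> nonpos_rooted p -> measurable_fun D h ->
  (forall x, D x -> (0 <= h x)%E) ->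
  (\int[zero_distribution n p]_(x in D) h x =
   (n%:R^-1)%:E * \sum_(i < size (zeros p))
      h (complex.Re (nth 0%R (zeros p) i))%:E +
   ((n - (size p).-1)%:R / n%:R)%:E * h -oo)%E.
Proof.
move=> p0 pr mh h0; have mD := measurable_nonpos.
rewrite /zero_distribution ge0_integral_measure_add//.
rewrite !ge0_integral_mscale// ge0_integral_measure_sum//.
congr (_ * _ + _ * _)%E.
  apply: eq_bigr => i _; rewrite integral_dirac// diracE mem_set ?mul1e//.
  have zi : nth 0 (zeros p) i \in zeros p by exact: mem_nth.
  by have [_] := complex_le0 (pr _ (root_zeros p0 zi)); rewrite /nonpos /= lee_fin.
by rewrite integral_dirac// diracE mem_set ?mul1e//= /nonpos /= leNye.
Qed.

Lemma zero_distribution_Rintegral n (p : {poly R}) (f : \bar R -> R) :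
  (0 < n)%N -> p != 0 -> nonpos_rooted p -> measurable_fun D f ->
  (\int[zero_distribution n p]_(x in D) f x)%R =
  (\sum_(s <- params n p) f (from01 s)) / n%:R.
Proof.
move=> n0 p0 pr mf; rewrite /Rintegral integralE.
have mEf : measurable_fun D (EFin \o f) by exact/measurable_EFinP.
rewrite !zero_distribution_ge0_integral//; try exact: measurable_funepos;
  try exact: measurable_funeneg.
pose fp x := Num.max (f x) 0; pose fn x := Num.max (- f x) 0.
have pE x : ((EFin \o f)^\+ x = (fp x)%:E)%E by rewrite funeposE /fp /= EFin_max.
have nE x : ((EFin \o f)^\- x = (fn x)%:E)%E by rewrite funenegE /fn /= EFin_max EFinN.
rewrite !pE !nE; under eq_bigr do rewrite pE.
under [X in (_ - (_ * X + _))%E]eq_bigr do rewrite nE.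
rewrite !sumEFin -!EFinM -!EFinD /=.
have fE x : f x = fp x - fn x.
  rewrite /fp /fn; case: (leP (f x) 0) => h.
    by rewrite max_l ?oppr_ge0// opprK add0r.
  by rewrite max_r ?subr0// oppr_le0 ltW.
rewrite sum_params mulrDl.
have sE (k : \bar R -> R) : \sum_(z <- zeros p) k (from01 (root_param z)) =
    \sum_(i < size (zeros p)) k (complex.Re (nth 0 (zeros p) i))%:E.
  rewrite (big_nth 0) big_mkord; apply: eq_bigr => i _.
  have zi : nth 0 (zeros p) i \in zeros p by exact: mem_nth.
  have [_ x0] := complex_le0 (pr _ (root_zeros p0 zi)).
  have -> : root_param (nth 0 (zeros p) i) =
      to01 (complex.Re (nth 0 (zeros p) i))%:E by rewrite /= x0.
  by rewrite to01K.
rewrite (sE f) /from01 ltxx.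
under [X in _ = X / _ + _]eq_bigr do rewrite fE.
by rewrite sumrB fE; ring.
Qed.

Lemma zero_distribution_mass n (p : {poly R}) (A : set (\bar R)) :
  (0 < n)%N -> p != 0 -> (size p <= n.+1)%N -> nonpos_rooted p -> D `<=` A ->
  zero_distribution n p A = 1%E.
Proof.
move=> n0 p0 pn pr DA; rewrite /zero_distribution [LHS]measure_addE /= /mscale /msum /=.
transitivity ((n%:R^-1)%:E * ((size p).-1%:R)%:E +
    ((n - (size p).-1)%:R / n%:R)%:E * 1 : \bar R)%E.
  congr (_ * _ + _ * _)%E; last first.
    by rewrite diracE mem_set//; apply: DA; rewrite /nonpos /= leNye.
  transitivity (\sum_(k < size (zeros p))
      \d_((complex.Re (nth 0%R (zeros p) k))%:E : \bar R) A : \bar R)%E => //.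
  rewrite (eq_bigr (fun=> 1%:E)); first by rewrite sumEFin sumr_const card_ord size_zeros.
  move=> i _; rewrite diracE mem_set//; apply: DA.
  have zi : nth 0 (zeros p) i \in zeros p by exact: mem_nth.
  by have [_] := complex_le0 (pr _ (root_zeros p0 zi)); rewrite /nonpos /= lee_fin.
rewrite mule1 -EFinM -EFinD; congr EFin.
have dn : ((size p).-1 <= n)%N by rewrite -ltnS prednK// lt0n size_poly_eq0.
rewrite natrB// mulrC -mulrDl addrC subrK divff// pnatr_eq0 -lt0n//.
Qed.

End ZeroDistribution.

Section Transforms01.
Variable R : realType.
Variable nu : probability (\bar R) R.
Hypothesis nu1 : nu (@nonpos R) = 1%E.

Local Notation T01 := (@to01 R).
Local Notation F := (@fin_nonpos R).

Let mT := @measurable_to01 R.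
Let T01i := @to01_itv R.

Let posE : [set x : \bar R | (0 < x)%E] = ~` @nonpos R.
Proof. by apply/seteqP; split=> x; rewrite /nonpos /= ltNge => /negP. Qed.

Lemma pos_null : nu [set x | (0 < x)%E] = 0%E.
Proof.
rewrite posE probability_setC; last exact: measurable_nonpos.
by rewrite nu1 subee.
Qed.

Lemma measurable_fin_nonpos : measurable F.
Proof.
rewrite (_ : F = `]-oo%E, 0%E]%classic); first exact: emeasurable_itv.
by apply/seteqP; split=> x /=; rewrite in_itv.
Qed.

(** The point -oo, sent to 0, contributes H 0 = 0, and the positive half-line
    is a null set. *)
Lemma fin_nonpos_Rintegral (h : \bar R -> R) (H : R -> R) :
  mean_integrable nu T01 H -> H 0 = 0 -> (forall x, F x -> h x = H (to01 x)) ->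
  (\int[nu]_(x in F) h x)%R = mean nu T01 H.
Proof.
move=> okH H0 hH; have mF := measurable_fin_nonpos.
have mP : measurable [set x : \bar R | (0 < x)%E].
  by rewrite posE; apply: measurableC; exact: measurable_nonpos.
have mN : measurable [set -oo%E : \bar R] by exact: emeasurable_set1.
rewrite (@eq_Rintegral _ _ _ nu _ (fun x => H (to01 x))); last first.
  by move=> x; rewrite inE => Fx; exact: hH.
have FNE : F `|` [set -oo%E] = @nonpos R.
  apply/seteqP; split=> [x [/andP[]//|->]|x]; first by rewrite /nonpos /= leNye.
  rewrite /nonpos /fin_nonpos /= => x0; case: (x =P -oo%E) => [->|/eqP xn]; first by right.
  by left; rewrite x0 andbT ltNye.
have TE : setT = (F `|` [set -oo%E]) `|` [set x : \bar R | (0 < x)%E].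
  by rewrite FNE posE setUCr.
have okS A : measurable A -> nu.-integrable A (EFin \o (H \o T01)).
  by move=> mA; apply: (integrableS measurableT mA) => //; exact: okH.
rewrite /mean TE Rintegral_setU//; last 3 first.
- exact: measurableU.
- by apply: okS; rewrite -TE.
- by apply/disj_setPS => x []; rewrite FNE posE.
rewrite Rintegral_setU//; last 2 first.
- by apply: okS; exact: measurableU.
- by apply/disj_setPS => x [/= /andP[xN _] e]; rewrite e ltxx in xN.
have -> : (\int[nu]_(x in [set -oo%E]) H (to01 x))%R = 0.
  rewrite (@eq_Rintegral _ _ _ nu _ (fun=> 0)); first by rewrite Rintegral_cst// mul0r.
  by move=> x; rewrite inE => -> /=.
have -> : (\int[nu]_(x in [set x | (0 < x)%E]) H (to01 x))%R = 0.
  rewrite /Rintegral null_set_integral//; last exact: pos_null.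
  by have := measurable_int _ (okS _ mP).
by rewrite !addr0.
Qed.

Lemma nonpos_Rintegral (f : \bar R -> R) :
  {within @nonpos R, continuous f} ->
  (\int[nu]_(x in @nonpos R) f x)%R = mean nu T01 (f \o @from01 R).
Proof.
move=> cf; have mD := @measurable_nonpos R.
have okH := mean_integrable_continuous nu mT T01i (from01_within_continuous cf).
have mP : measurable [set x : \bar R | (0 < x)%E].
  by rewrite posE; exact: measurableC.
have okS A : measurable A -> nu.-integrable A (EFin \o ((f \o @from01 R) \o T01)).
  by move=> mA; apply: (integrableS measurableT mA) => //; exact: okH.
rewrite (@eq_Rintegral _ _ _ nu _ (fun x => (f \o @from01 R) (to01 x))); last first.
  by move=> x; rewrite inE => Dx; rewrite /= to01K.
have TE : setT = @nonpos R `|` [set x : \bar R | (0 < x)%E] by rewrite posE setUCr.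
rewrite /mean TE Rintegral_setU//; last 2 first.
- by apply: okS; rewrite -TE.
- by apply/disj_setPS => x []; rewrite posE.
have -> : (\int[nu]_(x in [set x | (0 < x)%E]) (f \o @from01 R) (to01 x))%R = 0.
  rewrite /Rintegral null_set_integral//; last exact: pos_null.
  by have := measurable_int _ (okS _ mP).
by rewrite addr0.
Qed.

Lemma cauchy_transform_tilt t : 0 < t ->
  t * cauchy_transform nu t = tilted_moment nu T01 1 (ln t).
Proof.
move=> t0; rewrite /tilted_moment lnK ?posrE//.
have okf : mean_integrable nu T01 (fun x => tilt t x ^+ 1).
  by apply: mean_integrable_continuous => //; exact: tilt_pow_continuous.
rewrite (_ : (fun x => _) = fun x => t * (t^-1 * tilt t x ^+ 1)); last first.
  by apply/funext => x; rewrite mulrA divff ?mul1r// gt_eqF.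
rewrite meanZ//; last exact: mean_integrableZ.
congr (_ * _); apply: fin_nonpos_Rintegral.
- exact: mean_integrableZ.
- by rewrite expr1 tilt0 mulr0.
case=> [r||]//=; rewrite /fin_nonpos /= ?ltxx// lee_fin => /andP[_ r0]; rewrite r0 /tilt expr1.
have h1 : 1 - r != 0 by rewrite gt_eqF//; lra.
have h2 : t - r != 0 by rewrite gt_eqF//; lra.
have h3 : 1 + (t - 1) * (1 - r)^-1 = (t - r) / (1 - r) by field.
by rewrite h3; field; rewrite h1 h2 gt_eqF.
Qed.

Lemma Psi_logmgf u : Psi nu (expR u) = logmgf nu T01 u.
Proof.
have e0 := expR_gt0 u.
apply: fin_nonpos_Rintegral.
- by apply: mean_integrable_continuous => //; exact: ln_tilt_den_continuous.
- by rewrite mulr0 addr0 ln1.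
case=> [r||]//=; rewrite /fin_nonpos /= ?ltxx// lee_fin => /andP[_ r0]; rewrite r0.
have h1 : 1 - r != 0 by rewrite gt_eqF//; lra.
by congr ln; field.
Qed.

Lemma mass_at1 : nu [set 0%E] = (mass_at nu T01 1)%:E.
Proof.
rewrite /mass_at fineK; last by apply: fin_num_measure; exact: measurable_fiber.
have mP : measurable [set x : \bar R | (0 < x)%E].
  by rewrite posE; apply: measurableC; exact: measurable_nonpos.
have mZ : measurable [set 0%E : \bar R] by exact: emeasurable_set1.
have -> : T01 @^-1` [set 1] = [set 0%E] `|` [set x : \bar R | (0 < x)%E].
  apply/seteqP; split=> [[r||]|[r||]] /=; rewrite ?lee_fin ?lte_fin ?ltry//.
  - case: leP => [r0 h|]; last by right.
    left; congr EFin; have := congr1 GRing.inv h; rewrite invrK invr1; lra.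
  - by right.
  - by move=> /esym/eqP; rewrite oner_eq0.
  - case=> [[->]|r0]; first by rewrite lexx subr0 invr1.
    by rewrite leNgt r0.
  - by case.
have l1 : (nu ([set 0%E] `|` [set x | (0 < x)%E]) <= nu [set 0%E] + nu [set x | (0 < x)%E])%E.
  exact: measureU2.
rewrite pos_null adde0 in l1.
apply/eqP; rewrite eq_le l1 andbT; apply: le_measure; rewrite ?inE//.
exact: measurableU.
Qed.

Lemma mass_at0 : nu [set -oo%E] = (mass_at nu T01 0)%:E.
Proof.
rewrite /mass_at fineK; last by apply: fin_num_measure; exact: measurable_fiber.
congr (nu _); apply/seteqP; split=> [[r||]|[r||]] //=.
- case: leP => [r0 h|_ /eqP]; last by rewrite oner_eq0.
  by have := root_param01 r0; rewrite h ltxx.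
- by move=> /eqP; rewrite oner_eq0.
Qed.

End Transforms01.

(** * Uniqueness of the limit law *)

Section MomentUniqueness.
Variables (R : realType).
Variables (d1 d2 : measure_display) (T1 : measurableType d1) (T2 : measurableType d2).
Variables (P1 : probability T1 R) (X1 : T1 -> R).
Variables (P2 : probability T2 R) (X2 : T2 -> R).
Hypothesis mX1 : measurable_fun setT X1.
Hypothesis X1i : forall w, 0 <= X1 w <= 1.
Hypothesis mX2 : measurable_fun setT X2.
Hypothesis X2i : forall w, 0 <= X2 w <= 1.
Hypothesis tilted_mean_eq :
  forall u, tilted_moment P1 X1 1 u = tilted_moment P2 X2 1 u.

(** The logistic equation expresses the moment of order k + 1 through the
    moment of order k and its derivative, so the first one determines all. *)
Lemma tilted_moment_eq k u :
  tilted_moment P1 X1 k.+1 u = tilted_moment P2 X2 k.+1 u.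
Proof.
elim: k u => [//|k IH] u.
have e : tilted_moment P1 X1 k.+1 = tilted_moment P2 X2 k.+1.
  by apply/funext => v; exact: IH.
have h1 := is_derive1E (is_derive_tilted_moment P1 mX1 X1i k.+1 u).
have h2 := is_derive1E (is_derive_tilted_moment P2 mX2 X2i k.+1 u).
rewrite -e h1 e in h2.
have k0 : k.+1%:R != 0 :> R by rewrite pnatr_eq0.
by have := mulfI k0 h2 => /addrI/oppr_inj.
Qed.

Lemma mean_eq (f : R -> R) : {within `[(0 : R), 1], continuous f} ->
  mean P1 X1 f = mean P2 X2 f.
Proof.
move=> cf; apply/eqP; rewrite -subr_eq0 -normr_le0; apply/ler_addgt0Pr => e e0.
rewrite add0r; have e20 : 0 < e / 2 by rewrite divr_gt0.
have [p hp] := weierstrass_approx cf e20.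
have mp : mean P1 X1 (fun x => p.[x]) = mean P2 X2 (fun x => p.[x]).
  rewrite !mean_horner//; apply: eq_bigr => i _; congr (_ * _).
  case: (nat_of_ord i) => [|k].
    rewrite -[LHS](@eq_mean _ _ _ P1 X1 X1i (fun=> 1))//.
    rewrite -[RHS](@eq_mean _ _ _ P2 X2 X2i (fun=> 1))//.
    by rewrite !mean_cst.
  by rewrite -!tilted_moment0// tilted_moment_eq.
have ok1 := mean_integrable_continuous P1 mX1 X1i cf.
have ok2 := mean_integrable_continuous P2 mX2 X2i cf.
have okp1 := mean_integrable_horner P1 mX1 X1i p.
have okp2 := mean_integrable_horner P2 mX2 X2i p.
have n1 : `|mean P1 X1 f - mean P1 X1 (fun x => p.[x])| <= e / 2.
  by rewrite -meanB//; apply: mean_norm_le => //; exact: mean_integrableB.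
have n2 : `|mean P2 X2 f - mean P2 X2 (fun x => p.[x])| <= e / 2.
  by rewrite -meanB//; apply: mean_norm_le => //; exact: mean_integrableB.
rewrite mp in n1; move: n1 n2; rewrite !ler_norml => /andP[? ?] /andP[? ?].
by apply/andP; split; lra.
Qed.

End MomentUniqueness.

Section Tails.
Variables (R : realType) (d : measure_display) (T : measurableType d).
Variables (P : probability T R) (X : T -> R).
Hypothesis mX : measurable_fun setT X.
Hypothesis X01 : forall w, 0 <= X w <= 1.

(** Powers of a ramp: continuous, and decreasing to the indicator of a ray. *)
Definition ramp_pow (a : R) n (x : R) : R := Num.min 1 (x / a) ^+ n.

Lemma ramp_pow_continuous a n : continuous (ramp_pow a n).
Proof.
move=> x; rewrite /ramp_pow.
have c : {for x, continuous (fun x : R => Num.min 1 (x / a))}.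
  apply: (@continuous_min _ _ (fun=> 1) (fun x : R => x / a) x).
    exact: cvg_cst.
  by apply: cvgM; [exact: cvg_id|exact: cvg_cst].
exact: (continuous_comp c (@exprn_continuous _ n _)).
Qed.

Lemma ramp_pow_cvg a : 0 < a ->
  mean P X (ramp_pow a n) @[n --> \oo] --> fine (P (X @^-1` `[a, +oo[)).
Proof.
move=> a0.
have ok : mean_integrable P X (\1_(`[a, +oo[%classic : set R) : R -> R).
  apply: (@mean_integrable_bounded _ _ _ P X mX X01 _ 1) => //.
  by move=> x _; rewrite indicE; case: (_ \in _); rewrite ?normr1 ?normr0.
have <- : mean P X (\1_(`[a, +oo[%classic : set R) : R -> R) =
    fine (P (X @^-1` `[a, +oo[)).
  rewrite /mean /Rintegral.
  rewrite (eq_integral (fun w => (\1_(X @^-1` `[a, +oo[%classic) w)%:E)).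
    rewrite integral_indic ?setIT//.
    by rewrite -[X in measurable X]setTI; exact: mX.
  by move=> w _; rewrite !indicE; congr ((nat_of_bool _)%:R%:E); apply/idP/idP; rewrite !inE.
have r01 x : 0 <= x <= 1 -> 0 <= Num.min 1 (x / a) <= 1.
  by move=> /andP[x0 _]; rewrite le_min ler01 divr_ge0 ?(ltW a0)//= ge_min lexx.
apply: (mean_dominated_cvg mX X01 (B := 1)) => //.
- move=> n; apply: mean_integrable_continuous => //; apply: continuous_subspaceT.
  exact: ramp_pow_continuous.
- move=> n x /r01/andP[h0 h1]; rewrite /ramp_pow ger0_norm ?exprn_ge0//.
  by rewrite exprn_ile1.
move=> x x01; have [ax|xa] := leP a x.
  rewrite indicE mem_set; last by rewrite /= in_itv/= ax.
  rewrite (_ : (fun n => _) = fun=> 1); first exact: cvg_cst.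
  apply/funext => n; rewrite /ramp_pow min_l ?expr1n//.
  by rewrite ler_pdivlMr// mul1r.
rewrite indicE memNset; last by rewrite /= in_itv/= andbT leNgt xa.
apply: cvg_expr; have /andP[h0 _] := r01 x x01.
by rewrite ger0_norm// gt_min ltr_pdivrMr// mul1r xa orbT.
Qed.

End Tails.

Section MeasureUniqueness.
Variable R : realType.
Variables nu1 nu2 : probability (\bar R) R.
Hypothesis h1 : nu1 (@nonpos R) = 1%E.
Hypothesis h2 : nu2 (@nonpos R) = 1%E.
Hypothesis mean_tilt_eq : forall u,
  tilted_moment nu1 (@to01 R) 1 u = tilted_moment nu2 (@to01 R) 1 u.

Local Notation T01 := (@to01 R).

Let ray_eq (r : R) : nu1 [set x | (r%:E <= x)%E] = nu2 [set x | (r%:E <= x)%E].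
Proof.
have mray : measurable [set x : \bar R | (r%:E <= x)%E].
  rewrite (_ : [set x | _] = `[r%:E, +oo%E]%classic); first exact: emeasurable_itv.
  by apply/seteqP; split => x /=; rewrite in_itv/= leey andbT.
have [r0|r0] := ltP 0 r.
  have sub : [set x | (r%:E <= x)%E] `<=` [set x : \bar R | (0 < x)%E].
    by move=> x /=; apply: lt_le_trans; rewrite lte_fin.
  have mP : measurable [set x : \bar R | (0 < x)%E].
    rewrite (_ : [set x | _] = `]0%E, +oo%E]%classic); first exact: emeasurable_itv.
    by apply/seteqP; split => x /=; rewrite in_itv/= leey andbT.
  rewrite (subset_measure0 mray mP sub (pos_null h1)).
  by rewrite (subset_measure0 mray mP sub (pos_null h2)).
have /andP[a0 a1] := root_param01 r0; set a := (1 - r)^-1 in a0 a1.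
have -> : [set x | (r%:E <= x)%E] = T01 @^-1` `[a, +oo[.
  apply/seteqP; split=> x /=; rewrite in_itv/= andbT.
    case: x => [s||] //=; rewrite lee_fin => rs; have [s0|//] := leP s 0.
    by rewrite /a lef_pV2 ?posrE; lra.
  case: x => [s||] /=; rewrite ?leey// ?lee_fin.
    have [s0|s0] := leP s 0; last by move=> _; rewrite (le_trans r0)// ltW.
    by rewrite /a lef_pV2 ?posrE; lra.
  by rewrite leNgt a0.
have m1 := @measurable_to01 R; have t01 := @to01_itv R.
have mA : measurable (T01 @^-1` `[a, +oo[).
  by rewrite -[X in measurable X]setTI; exact: m1.
rewrite -[LHS]fineK ?fin_num_measure// -[RHS]fineK ?fin_num_measure//.
congr EFin.
have c1 := @ramp_pow_cvg _ _ _ nu1 _ m1 t01 _ a0; have c2 := @ramp_pow_cvg _ _ _ nu2 _ m1 t01 _ a0.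
have e : (fun n => mean nu1 T01 (ramp_pow a n)) = (fun n => mean nu2 T01 (ramp_pow a n)).
  apply/funext => n; apply: mean_eq => //; apply: continuous_subspaceT.
  exact: ramp_pow_continuous.
rewrite -e in c2.
exact: (cvg_unique _ c1 c2).
Qed.

(** Equal tilted means give equal moments, hence equal expectations of continuous
    functions, hence equal masses of the closed rays, which generate the
    sigma-algebra. *)
Theorem probability_nonpos_unique (A : set (\bar R)) : measurable A -> nu1 A = nu2 A.
Proof.
pose G := [set B : set (\bar R) | exists c : \bar R, B = [set x | (c <= x)%E]].
have mG (c : \bar R) : measurable [set x : \bar R | (c <= x)%E].
  rewrite (_ : [set x | _] = `[c, +oo%E]%classic); first exact: emeasurable_itv.
  by apply/seteqP; split => x /=; rewrite in_itv/= leey andbT.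
apply: (measure_unique G (fun=> setT)) => //.
- apply/seteqP; split.
    rewrite -[X in X `<=` _]/(emeasurable (@ocitv R)) ErealGenCInfty.measurableE.
    apply: smallest_sub => [|B [r ->]]; first exact: smallest_sigma_algebra.
    apply: sub_sigma_algebra; exists r%:E.
    by apply/seteqP; split => x /=; rewrite in_itv/= andbT.
  apply: smallest_sub => [|B [c ->]]; last exact: mG.
  exact: sigma_algebra_measurable.
- move=> B C [b ->] [c ->]; exists (Order.max b c).
  by apply/seteqP; split => x /=; rewrite ge_max => /andP.
- by move=> _; exists -oo%E; apply/seteqP; split => x //= _; rewrite leNye.
- by rewrite bigcup_const.
- move=> B [[r||] ->]; first exact: ray_eq.
    have -> : [set x | (+oo <= x)%E] = \bigcap_n [set x : \bar R | (n%:R%:E <= x)%E].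
      apply/seteqP; split => x /=.
        by rewrite leye_eq => /eqP -> n _ /=; rewrite leey.
      case: x => [s||]//=; last by move=> /(_ 0%N Logic.I).
      move=> /(_ (Num.truncn s).+1 Logic.I) /=; rewrite lee_fin.
      by rewrite leNgt truncnS_gt.
    have nul (nu : probability (\bar R) R) : nu (@nonpos R) = 1%E ->
       nu (\bigcap_n [set x : \bar R | (n%:R%:E <= x)%E]) = 0%E.
      move=> nuD; apply: (subset_measure0 _ _ _ (pos_null nuD)).
      - by apply: bigcapT_measurable.
      - rewrite (_ : [set x | _] = `]0%E, +oo%E]%classic); first exact: emeasurable_itv.
        by apply/seteqP; split => x /=; rewrite in_itv/= leey andbT.
      - move=> x /(_ 1%N Logic.I) /=; apply: lt_le_trans; by rewrite lte_fin.
    exact: etrans (nul _ h1) (esym (nul _ h2)).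
  have -> : [set x : \bar R | (-oo <= x)%E] = setT.
    by apply/seteqP; split => x //= _; rewrite leNye.
  exact: etrans (probability_setT nu1) (esym (probability_setT nu2)).
- by move=> _; rewrite (le_lt_trans (probability_le1 nu1 measurableT))// ltry.
Qed.

End MeasureUniqueness.

(** * Calculus of the profile *)

Section StrictConcavity.
Variable R : realType.

(** Compare the mean slopes on the two sides of the intermediate point. *)
Lemma decreasing_derivative_strictly_concave (a b : R) (F F' : R -> R) :
  (forall x, a < x < b -> is_derive x 1 F (F' x)) ->
  (forall x y, a < x -> x < y -> y < b -> F' y < F' x) ->
  strictly_concave_on `]a, b[ F.
Proof.
move=> dF dec.
have mvt x y : a < x -> x < y -> y < b ->
    exists2 c, x < c < y & F y - F x = F' c * (y - x).
  move=> ax xy yb.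
  have I z : x <= z <= y -> a < z < b.
    by move=> /andP[xz zy]; rewrite (lt_le_trans ax xz) (le_lt_trans zy yb).
  have [c cxy e] : exists2 c, c \in `]x, y[%R & F y - F x = F' c * (y - x).
    apply: MVT => //.
      by move=> z; rewrite in_itv/= => /andP[/ltW xz /ltW zy]; apply: dF; apply: I; rewrite xz.
    apply: continuous_in_subspaceT => z; rewrite inE/= in_itv/= => /I/dF.
    exact: is_derive_continuous.
  by exists c => //; move: cxy; rewrite in_itv.
have key x y s : a < x -> x < y -> y < b -> 0 < s < 1 ->
    s * F x + (1 - s) * F y < F (s * x + (1 - s) * y).
  move=> ax xy yb /andP[s0 s1]; set z := s * x + (1 - s) * y.
  have s10 : 0 < 1 - s by rewrite subr_gt0.
  have yx0 : 0 < y - x by rewrite subr_gt0.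
  have zx : z - x = (1 - s) * (y - x) by rewrite /z; ring.
  have yz : y - z = s * (y - x) by rewrite /z; ring.
  have xz : x < z by rewrite -subr_gt0 zx mulr_gt0.
  have zy : z < y by rewrite -subr_gt0 yz mulr_gt0.
  have [c1 /andP[xc1 c1z] e1] := mvt x z ax xz (lt_trans zy yb).
  have [c2 /andP[zc2 c2y] e2] := mvt z y (lt_trans ax xz) zy yb.
  have h : F' c2 < F' c1.
    by apply: dec; [exact: lt_trans ax _|exact: lt_trans zc2|exact: lt_trans c2y _].
  rewrite -subr_gt0.
  have -> : F z - (s * F x + (1 - s) * F y) =
      s * (F z - F x) - (1 - s) * (F y - F z) by ring.
  rewrite e1 e2 zx yz.
  have -> : s * (F' c1 * ((1 - s) * (y - x))) - (1 - s) * (F' c2 * (s * (y - x))) =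
     (F' c1 - F' c2) * (s * ((1 - s) * (y - x))) by ring.
  by rewrite !mulr_gt0// subr_gt0.
move=> x y; rewrite !in_itv/= => /andP[ax xb] /andP[ay yb] xy s s01.
have [xy'|yx|e] := ltgtP x y; first exact: key.
- have [s0 s1] := andP s01; have := @key y x (1 - s) ay yx xb.
  rewrite subr_gt0 s1 ltrBlDr ltrDl s0 => /(_ isT).
  have -> : 1 - (1 - s) = s by ring.
  by rewrite addrC (addrC _ (s * x)).
- by rewrite e eqxx in xy.
Qed.

End StrictConcavity.

Section LegendreInverse.
Variables (R : realType) (d : measure_display) (T : measurableType d).
Variables (P : probability T R) (X : T -> R).
Hypothesis mX : measurable_fun setT X.
Hypothesis X01 : forall w, 0 <= X w <= 1.

Local Notation A := (tilted_moment P X).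
Local Notation Psi := (logmgf P X).

Variables (m M : R) (g : R -> R) (C : R).
Hypothesis m_ge0 : 0 <= m.
Hypothesis mM : m < M.
Hypothesis mass1 : mass_at P X 1 = m.
Hypothesis mass0 : 1 - mass_at P X 0 = M.
Hypothesis A_itv : forall u, m < A 1 u < M.
Hypothesis gA : forall u, g (A 1 u) = C + Psi u - A 1 u * u.

Let nd : mass_at P X 1 < 1 - mass_at P X 0.
Proof. by rewrite mass1 mass0. Qed.

Let A_inc : {homo A 1 : u v / u < v} := tilted_mean_homo mX X01 nd.

Let V u := A 1 u - A 2 u.
Let V_gt0 u : 0 < V u. Proof. exact: tilted_variance_gt0. Qed.

Let dA (u : R) : is_derive u 1 (A 1) (V u).
Proof.
by have := is_derive_tilted_moment P mX X01 1 u; rewrite mul1r.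
Qed.

Lemma tilted_mean_surj al : m < al < M -> exists u, A 1 u = al.
Proof.
move=> /andP[mal alM].
have e1 : 0 < al - m by rewrite subr_gt0.
have e2 : 0 < M - al by rewrite subr_gt0.
have [u hu] := tilted_mean_lim_left P mX X01 e1.
have [v hv] := tilted_mean_lim_right P mX X01 e2.
rewrite mass1 addrC subrK in hu.
have {}hv : al < A 1 v by move: hv; rewrite mass0 opprB addrC subrK.
have uv : u <= v.
  rewrite leNgt; apply/negP => /A_inc h.
  by have := lt_trans (lt_trans h hu) hv; rewrite ltxx.
have cA : {within `[u, v], continuous (A 1)}.
  by apply: continuous_subspaceT => z; exact: is_derive_continuous (dA z).
have [|c _ <-] := IVT uv cA (v := al); last by exists c.
move: (ltW hu) (ltW hv); move: (A 1 u) (A 1 v) => a b aal alb.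
by rewrite ge_min le_max aal alb orbT.
Qed.

(** The inverse of the tilted mean on ]m, M[, where the default 0 is never
    taken. *)
Definition conj_param (al : R) : R := xget 0 [set u | A 1 u = al].
Local Notation w := conj_param.

Lemma conj_paramK al : m < al < M -> A 1 (w al) = al.
Proof. by move=> /tilted_mean_surj[u hu]; exact: (@xgetI _ 0 [set u | A 1 u = al] u hu). Qed.

Lemma tilted_meanK u : w (A 1 u) = u.
Proof.
have e := conj_paramK (A_itv u).
have [h|h|//] := ltgtP (w (A 1 u)) u; have := A_inc h; rewrite e ltxx//.
Qed.

Lemma conj_param_inc al be : m < al -> al < be -> be < M -> w al < w be.
Proof.
move=> mal albe beM.
have ea : A 1 (w al) = al by apply: conj_paramK; rewrite mal (lt_trans albe).
have eb : A 1 (w be) = be by apply: conj_paramK; rewrite beM (lt_trans mal).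
have [//|h|h] := ltgtP (w al) (w be).
  by have := A_inc h; rewrite ea eb ltNge (ltW albe).
by move: albe; rewrite -ea -eb h ltxx.
Qed.

Lemma is_derive_conj_param al : m < al < M -> is_derive al 1 w (V (w al))^-1.
Proof.
move=> alI; rewrite -{1}(conj_paramK alI).
apply: (@is_derive_inverse R (A 1)).
- by near=> u; exact: tilted_meanK.
- by near=> u; exact: is_derive_continuous (dA u).
- exact: dA.
- by rewrite gt_eqF.
Unshelve. all: by end_near. Qed.

Let near_itv al : m < al < M -> \forall be \near al, m < be < M.
Proof.
move=> alI; have := @near_in_itvoo R m M al; rewrite in_itv/= => /(_ alI).
by apply: filterS => be; rewrite in_itv.
Qed.

Lemma profileE al : m < al < M -> g al = C + Psi (w al) - al * w al.
Proof. by move=> alI; rewrite -{1}(conj_paramK alI) gA conj_paramK. Qed.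

(** The profile is, up to a constant and a sign, the Legendre transform of the
    log-moment generating function, so its slope is minus the conjugate
    parameter. *)
Lemma is_derive_profile al : m < al < M -> is_derive al 1 g (- w al).
Proof.
move=> alI; have dw := is_derive_conj_param alI.
have dPsi : is_derive (w al) 1 Psi (A 1 (w al)) by exact: is_derive_logmgf.
have h1 := is_derive_comp dPsi dw.
have h2 := is_derive_mul (is_derive_id al 1) dw.
have h := is_derive_sub (is_derive_add (is_derive_cst C al 1) h1) h2.
apply: (near_eq_is_derive (f := fun be => C + Psi (w be) - be * w be)).
- by apply: filterS (near_itv alI) => be /profileE ->.
apply: (is_derive_eq h); rewrite conj_paramK//; ring.
Qed.

Lemma derive1_profile al : m < al < M -> derive1 g al = - w al.
Proof. by move=> /is_derive_profile/is_derive1E. Qed.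

Lemma derive1_profile_mean u : derive1 g (A 1 u) = - u.
Proof. by rewrite derive1_profile// tilted_meanK. Qed.

(** An algebra of functions stable under differentiation. Since the derivative
    of f \o w is (f' / V) \o w, where w inverts the tilted mean and 1 / V lies in
    the algebra, all the derivatives of w are again of the form h \o w. *)
Inductive tilt_algebra : (R -> R) -> Prop :=
| tilt_algebra_cst c : tilt_algebra (fun=> c)
| tilt_algebra_moment k : tilt_algebra (A k)
| tilt_algebra_invV : tilt_algebra (fun u => (V u)^-1)
| tilt_algebra_add f1 f2 : tilt_algebra f1 -> tilt_algebra f2 ->
    tilt_algebra (fun u => f1 u + f2 u)
| tilt_algebra_mul f1 f2 : tilt_algebra f1 -> tilt_algebra f2 ->
    tilt_algebra (fun u => f1 u * f2 u).

Lemma tilt_algebra_derive f : tilt_algebra f ->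
  exists2 f', tilt_algebra f' & forall u : R, is_derive u 1 f (f' u).
Proof.
have dAk k : exists2 f', tilt_algebra f' & forall u : R, is_derive u 1 (A k) (f' u).
  exists (fun u => k%:R * (A k u + -1 * A k.+1 u)).
    apply: tilt_algebra_mul; first exact: tilt_algebra_cst.
    apply: tilt_algebra_add; first exact: tilt_algebra_moment.
    by apply: tilt_algebra_mul; [exact: tilt_algebra_cst|exact: tilt_algebra_moment].
  by move=> u; rewrite mulN1r; exact: is_derive_tilted_moment.
elim=> [c|k||f1 f2 _ [g1 t1 h1] _ [g2 t2 h2]|f1 f2 s1 [g1 t1 h1] s2 [g2 t2 h2]].
- by exists (fun=> 0); [exact: tilt_algebra_cst|move=> u; exact: is_derive_cst].
- exact: dAk.
- have [a1 t1 h1] := dAk 1%N; have [a2 t2 h2] := dAk 2%N.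
  exists (fun u => -1 * ((V u)^-1 * (V u)^-1) * (a1 u + -1 * a2 u)).
    apply: tilt_algebra_mul.
      by do ! [exact: tilt_algebra_cst|exact: tilt_algebra_invV|apply: tilt_algebra_mul].
    apply: tilt_algebra_add => //; apply: tilt_algebra_mul => //.
    exact: tilt_algebra_cst.
  move=> u; have hV : is_derive u 1 V (a1 u - a2 u) by exact: is_derive_sub.
  apply: (is_derive_eq (is_derive_inv (lt0r_neq0 (V_gt0 u)) hV)).
  by rewrite !mulN1r expr2 invfM.
- exists (fun u => g1 u + g2 u); first exact: tilt_algebra_add.
  by move=> u; exact: is_derive_add.
- exists (fun u => g1 u * f2 u + f1 u * g2 u).
    by apply: tilt_algebra_add; exact: tilt_algebra_mul.
  by move=> u; exact: is_derive_mul.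
Qed.

Let derive_comp_w (F : R -> R) (f : R -> R) : tilt_algebra f ->
  (forall al, m < al < M -> F al = f (w al)) ->
  exists2 h, tilt_algebra h & forall al, m < al < M -> is_derive al 1 F (h (w al)).
Proof.
move=> tf Ff; have [f' tf' df] := tilt_algebra_derive tf.
exists (fun u => f' u * (V u)^-1).
  by apply: tilt_algebra_mul => //; exact: tilt_algebra_invV.
move=> al alI; apply: (near_eq_is_derive (f := fun be => f (w be))).
- by apply: filterS (near_itv alI) => be /Ff ->.
exact: is_derive_comp (df _) (is_derive_conj_param alI).
Qed.

Lemma derive1n_profile k : exists2 h, tilt_algebra h &
  forall al, m < al < M -> derive1n k.+2 g al = h (w al).
Proof.
elim: k => [|k [f tf Ff]].
  exists (fun u => -1 * (V u)^-1).
    by apply: tilt_algebra_mul; [exact: tilt_algebra_cst|exact: tilt_algebra_invV].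
  move=> al alI; rewrite derive1nS derive1n1; apply: is_derive1E.
  apply: (near_eq_is_derive (f := fun be => -1 * w be)).
  - by apply: filterS (near_itv alI) => be /derive1_profile ->; rewrite mulN1r.
  apply: (is_derive_eq (is_derive_mul (is_derive_cst (-1 : R) al 1) (is_derive_conj_param alI))).
  by rewrite mul0r add0r.
have [h th hF] := derive_comp_w tf Ff.
by exists h => // al alI; rewrite derive1nS; apply: is_derive1E; exact: hF.
Qed.

Lemma profile_smooth : smooth_on `]m, M[ g.
Proof.
case=> [|[|k]] al; rewrite in_itv/= => alI.
- by have [] := is_derive_profile alI.
- suff : is_derive al 1 (derive1 g) (-1 * (V (w al))^-1) by case.
  apply: (near_eq_is_derive (f := fun be => -1 * w be)).
  - by apply: filterS (near_itv alI) => be /derive1_profile ->; rewrite mulN1r.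
  apply: (is_derive_eq (is_derive_mul (is_derive_cst (-1 : R) al 1) (is_derive_conj_param alI))).
  by rewrite mul0r add0r.
have [f tf Ff] := derive1n_profile k.
have [h th hF] := derive_comp_w tf Ff.
by have [] := hF al alI.
Qed.

Lemma profile_strictly_concave : strictly_concave_on `]m, M[ g.
Proof.
apply: (decreasing_derivative_strictly_concave (F' := fun al => - w al)).
  by move=> al; exact: is_derive_profile.
by move=> x y mx xy yM; rewrite ltrN2; exact: conj_param_inc.
Qed.

Lemma tilted_mean_gt0 u : 0 < A 1 u.
Proof. by have /andP[h _] := A_itv u; exact: le_lt_trans h. Qed.

(** Cauchy-Schwarz, integrated from p^2 >= 2 c p - c^2 with c the mean of p. *)
Lemma tilted_moment2_gt0 u : 0 < A 2 u.
Proof.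
have okA k : mean_integrable P X (fun x => tilt (expR u) x ^+ k).
  by apply: mean_integrable_continuous => //; apply: tilt_pow_continuous; exact: expR_gt0.
set c := A 1 u; have c0 : 0 < c by exact: tilted_mean_gt0.
apply: (@lt_le_trans _ _ (mean P X (fun x => 2 * c * tilt (expR u) x ^+ 1 - c ^+ 2))).
  rewrite meanB//; [|exact: mean_integrableZ|exact: mean_integrable_cst].
  rewrite (meanZ _ (okA 1%N)) mean_cst -/(A 1 u) -/c.
  have -> : 2 * c * c - c ^+ 2 = c * c by ring.
  exact: mulr_gt0.
rewrite /tilted_moment; apply: le_mean => //.
  by apply: mean_integrableB; [exact: (mean_integrableZ _ (okA 1%N))|exact: mean_integrable_cst].
move=> x _; rewrite expr1 -subr_ge0.
have -> : tilt (expR u) x ^+ 2 - (2 * c * tilt (expR u) x - c ^+ 2) =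
   (tilt (expR u) x - c) ^+ 2 by ring.
exact: sqr_ge0.
Qed.

(** In the variable t = exp u this is the strict decrease of the logarithm of the
    Cauchy transform; the derivative in u is minus the ratio of the second
    tilted moment to the first. *)
Lemma ln_tilted_mean_dec u v : u < v -> ln (A 1 v) - v < ln (A 1 u) - u.
Proof.
move=> uv; rewrite -ltrN2.
apply: (is_derive_gt0_homo (f := fun u => - (ln (A 1 u) - u))
  (f' := fun u => A 2 u / A 1 u)) uv => {u v} u; last first.
  by rewrite divr_gt0 ?tilted_moment2_gt0 ?tilted_mean_gt0.
have h1 := is_derive_comp (is_derive1_ln (tilted_mean_gt0 u)) (dA u).
have h2 := is_derive_sub h1 (is_derive_id u 1).
apply: (is_derive_eq (is_deriveN h2)).
by rewrite /V; field; rewrite gt_eqF// tilted_mean_gt0.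
Qed.

Lemma profile_entropy_strictly_concave :
  strictly_concave_on `]m, M[ (fun al => g al + al * ln al).
Proof.
apply: (decreasing_derivative_strictly_concave
  (F' := fun al => - w al + (ln al + 1))).
  move=> al alI.
  have al0 : 0 < al by case/andP: alI => h _; exact: le_lt_trans h.
  have h := is_derive_mul (is_derive_id al 1) (is_derive1_ln al0).
  apply: (is_derive_eq (is_derive_add (is_derive_profile alI) h)).
  by rewrite mul1r divff// gt_eqF.
move=> x y mx xy yM; have := ln_tilted_mean_dec (conj_param_inc mx xy yM).
rewrite !conj_paramK ?mx ?yM ?(lt_trans xy) ?(lt_trans mx)//; lra.
Qed.

Lemma logmgf_tangent u v : Psi u + A 1 u * (v - u) <= Psi v.
Proof. exact: logmgf_convex. Qed.

(** The tangent inequality at w al, evaluated at 0 where logmgf vanishes. *)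
Lemma profile_le al : m < al < M -> g al <= C.
Proof.
move=> alI; rewrite profileE//.
by have := logmgf_tangent (w al) 0; rewrite conj_paramK// logmgf0//; lra.
Qed.

Lemma profile_max : g (A 1 0) = C.
Proof. by rewrite gA logmgf0// mulr0 addr0 subr0. Qed.

Lemma has_sup_profile : has_sup (g @` `]m, M[%classic).
Proof.
split; first by exists (g (A 1 0)), (A 1 0) => //; rewrite /= in_itv/=.
by exists C => _ [al + <-]; rewrite /= in_itv/=; exact: profile_le.
Qed.

Lemma sup_profile : sup (g @` `]m, M[%classic) = C.
Proof.
apply/eqP; rewrite eq_le; apply/andP; split.
  apply: ge_sup; first by case: has_sup_profile.
  by move=> _ [al + <-]; rewrite /= in_itv/=; exact: profile_le.
rewrite -{1}profile_max; apply: ub_le_sup; first by case: has_sup_profile.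
by exists (A 1 0) => //; rewrite /= in_itv/=.
Qed.

Lemma legendre_logmgf al : m < al < M -> (C - g al)%:E = legendre Psi al.
Proof.
move=> alI; apply/eqP; rewrite eq_le; apply/andP; split.
  apply: ereal_sup_ubound; exists (w al) => //.
  by congr EFin; rewrite profileE//; ring.
apply: ub_ereal_sup => _ [u _ <-]; rewrite lee_fin profileE//.
have := logmgf_tangent (w al) u; rewrite conj_paramK//.
by move: (Psi (w al)) (Psi u) (w al) => a b c; lra.
Qed.

Lemma profile_inf al : m < al < M ->
  (g al)%:E = (C%:E + ereal_inf (range (fun u => (Psi u - al * u)%:E)))%E.
Proof.
move=> alI.
have -> : ereal_inf (range (fun u => (Psi u - al * u)%:E)) =
    (Psi (w al) - al * w al)%:E.
  apply/eqP; rewrite eq_le; apply/andP; split.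
    by apply: ereal_inf_lbound; exists (w al).
  apply: le_ereal_inf_tmp => _ [u _ <-]; rewrite lee_fin.
  have := logmgf_tangent (w al) u; rewrite conj_paramK//.
by move: (Psi (w al)) (Psi u) (w al) => a b c; lra.
by rewrite -EFinD profileE// addrA.
Qed.

End LegendreInverse.

(** * The limit law along an ultrafilter *)

Section LimitMeasure.
Variable R : realType.

Lemma exponential_rate_in (a : nat -> R) (l e : R) : (forall n, (0 < n)%N -> 0 <= a n) ->
  ((n%:R^-1)%:E * lne (a n)%:E)%E @[n --> \oo] --> l%:E -> 0 < e ->
  \forall n \near \oo, expR (n%:R * (l - e)) <= a n /\ a n <= expR (n%:R * (l + e)).
Proof.
move=> a0 /fine_cvgP[fin /cvgrPdist_le cvg] e0.
have h := cvg e e0; have n1 : \forall n \near \oo, (0 < n)%N by exists 1%N.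
apply: filterS3 n1 fin h => n n0 fn; rewrite /=.
have nr0 : 0 < n%:R :> R by rewrite ltr0n.
move: fn; rewrite /lne; have [an0|an0] := leP (a n) 0.
  by rewrite gt0_muleNy// lte_fin invr_gt0.
move=> _; rewrite -EFinM /= ler_norml => /andP[h1 h2].
have aE : a n = expR (n%:R * (n%:R^-1 * ln (a n))).
  by rewrite mulrA divff ?gt_eqF// mul1r lnK.
by split; rewrite aE ler_expR ler_pM2l//; lra.
Qed.

Lemma exponential_rate_out (a : nat -> R) (B : R) :
  ((n%:R^-1)%:E * lne (a n)%:E)%E @[n --> \oo] --> -oo%E ->
  \forall n \near \oo, a n <= expR (n%:R * B).
Proof.
move=> /cvgeNyPle/(_ B) h; have n1 : \forall n \near \oo, (0 < n)%N by exists 1%N.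
apply: filterS2 n1 h => n n0.
have nr0 : 0 < n%:R :> R by rewrite ltr0n.
rewrite /lne; have [an0 _|an0] := leP (a n) 0.
  exact: le_trans an0 (expR_ge0 _).
rewrite -EFinM lee_fin ler_pdivrMl// => h1.
by rewrite -[leLHS]lnK ?posrE// ler_expR.
Qed.

(** If a neighbourhood of l were missed infinitely often, some ultrafilter would
    live on the indices that miss it. *)
Lemma ultra_cvg (x : nat -> R) (l : R) :
  (forall U, UltraFilter U -> \oo `<=` U -> x @ U --> l) -> x @ \oo --> l.
Proof.
move=> h V Vl; apply: contrapT => nV.
pose F := within (~` (x @^-1` V)) \oo.
have FP : ProperFilter F.
  split; last exact: within_filter.
  rewrite /F /within /= => hF; apply: nV; apply: filterS hF => n h1.
  by apply: contrapT => h2; exact: (h1 h2).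
have [U [UU FU]] := ultraFilterLemma FP.
have oU : \oo `<=` U by move=> B hB; apply: FU; exact: filterS hB => n.
have h1 : U (x @^-1` V) := h U UU oU V Vl.
have h2 : U (~` (x @^-1` V)) by apply: FU; apply: nearW.
by have [n [n1 n2]] := filter_ex (filterI h1 h2).
Qed.

Lemma ultra_exists : exists U : set_system nat, UltraFilter U /\ \oo `<=` U.
Proof. by have [U [UU oU]] := ultraFilterLemma eventually_filter; exists U. Qed.

(** The law on [-oo, 0] with a given quantile function, seen in [0, 1]. *)
Lemma law_of_quantile (q : R -> R) : measurable_fun setT q ->
  (forall y, 0 <= q y <= 1) ->
  exists mu : probability (\bar R) R, mu (@nonpos R) = 1%E /\
    forall f : R -> R, {within `[(0 : R), 1], continuous f} ->
      mean mu (@to01 R) f = mean (@unif01 R) q f.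
Proof.
move=> mq q01; pose Y : measurableTypeR R -> \bar R := @from01 R \o q.
have mY : measurable_fun setT Y.
  by apply: measurableT_comp => //; exact: measurable_from01.
pose Yf : {mfun measurableTypeR R >-> \bar R} := HB.pack Y (isMeasurableFun.Build _ _ _ _ Y mY).
exists (distribution (@unif01 R) Yf); split.
  rewrite /distribution /= /pushforward.
  have -> : Y @^-1` @nonpos R = setT.
    apply/seteqP; split=> // y _; rewrite /Y /nonpos /=.
    by apply: from01_le0; have /andP[] := q01 y.
  exact: probability_setT.
move=> f cf; rewrite /mean /Rintegral.
have mf := subspace_continuous_measurable_fun (measurable_itv `[(0:R), 1]) cf.
have mfT := measurable_comp01 (@measurable_to01 R) (@to01_itv R) mf.
have E y : f (to01 (Y y)) = f (q y) by rewrite /Y /= from01K.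
have okq := mean_integrable_continuous (@unif01 R) mq q01 cf.
rewrite integral_distribution/=; [|exact/measurable_EFinP|].
- by congr fine; apply: eq_integral => y _; rewrite /= E.
- by move: okq; rewrite /mean_integrable; under eq_fun do rewrite -E.
Qed.

Variables (P : nat -> {poly R}) (m M : R) (g : R -> R).
Hypothesis P_neq0 : forall n, (0 < n)%N -> P n != 0.
Hypothesis P_deg : forall n, (0 < n)%N -> (size (P n) <= n.+1)%N.
Hypothesis P_ge0 : forall n k, (0 < n)%N -> 0 <= (P n)`_k.
Hypothesis P_prof : exponential_profile P m M g.
Hypothesis P_roots : \forall n \near \oo, nonpos_rooted (P n).

(** The weak limit along an ultrafilter exists by compactness, in the form of the
    limiting quantile function; profile_identification then ties it to g. *)
Theorem limit_measure (U : set_system nat) : UltraFilter U -> \oo `<=` U ->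
  exists2 mu : probability (\bar R) R, mu (@nonpos R) = 1%E /\
    (forall f : \bar R -> R, {within @nonpos R, continuous f} ->
      (\int[zero_distribution n (P n)]_(x in @nonpos R) f x)%R @[n --> U]
        --> (\int[mu]_(x in @nonpos R) f x)%R) &
    exists C : R, [/\ ln (P n).[1] / n%:R @[n --> U] --> C,
      mass_at mu (@to01 R) 1 = m, 1 - mass_at mu (@to01 R) 0 = M,
      (forall u, m < tilted_moment mu (@to01 R) 1 u < M) &
      forall u, g (tilted_moment mu (@to01 R) 1 u) =
        C + logmgf mu (@to01 R) u - tilted_moment mu (@to01 R) 1 u * u].
Proof.
move=> UU oU.
have [[m0 mM M1] pin pout] := P_prof.
(* The finitely many n without the factorisation get a dummy one. *)
pose good n := `[< (0 < n)%N /\ nonpos_rooted (P n) >].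
pose S n := if good n then params n (P n) else sort <=%R (nseq n (0 : R)).
pose c n := if good n then (P n).[1] else 1.
have near_good : \forall n \near U, (0 < n)%N /\ nonpos_rooted (P n).
  have n1 : \forall n \near \oo, (0 < n)%N by exists 1%N.
  by apply: oU; apply: filterS2 n1 P_roots => n; split.
have S01 n : in01 (S n).
  rewrite /S /good; case: asboolP => [[n0 h]|_]; first exact: params01 (P_neq0 n0) h.
  by move=> s; rewrite mem_sort mem_nseq => /andP[_ /eqP ->]; rewrite lexx ler01.
have S_sorted n : sorted <=%R (S n).
  by rewrite /S; case: ifP => _; [exact: sorted_params|exact/sort_sorted/le_total].
have S_size n : size (S n) = n.
  rewrite /S /good; case: asboolP => [[n0 h]|_].
    exact: size_params (P_neq0 n0) (P_deg n0).
  by rewrite size_sort size_nseq.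
have c_gt0 n : 0 < c n.
  rewrite /c /good; case: asboolP => [[n0 h]|//].
  by apply: horner1_gt0 => //; [exact: P_neq0|move=> k; exact: P_ge0].
have coefE n k : (0 < n)%N /\ nonpos_rooted (P n) ->
    c n * (bernoulli_gf (S n))`_k = (P n)`_k.
  move=> h; have [n0 pr] := h; rewrite /c /S /good; case: asboolP => // _.
  by rewrite [in RHS](poly_bernoulli_gf n (P_neq0 n0) pr) coefZ.
have [q [qnd q01 qlim]] := quantile_limit UU oU S01 S_sorted S_size.
have mq : measurable_fun setT q by exact: nondecreasing_measurable.
have [mu [mu1 muE]] := law_of_quantile mq q01.
have m01 := @measurable_to01 R; have t01 := @to01_itv R.
have S_cvg (f : R -> R) : {within `[(0 : R), 1], continuous f} ->
    (\sum_(s <- S n) f s) / n%:R @[n --> U] --> mean mu (@to01 R) f.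
  by move=> cf; rewrite muE//; exact: qlim.
exists mu; first split=> // f cf.
  rewrite (nonpos_Rintegral mu1 cf).
  apply: cvg_trans (S_cvg _ (from01_within_continuous cf)).
  apply: near_eq_cvg; apply: filterS near_good => n h; have [n0 pr] := h.
  rewrite zero_distribution_Rintegral//; last 2 first.
  - exact: P_neq0.
  - exact: nonpos_measurable_fun.
  by rewrite /S /good; case: asboolP.
have prof_in (al e : R) : m < al < M -> 0 < e -> \forall n \near U,
    expR (n%:R * (g al - e)) <= c n * (bernoulli_gf (S n))`_(Num.truncn (al * n%:R)) /\
    c n * (bernoulli_gf (S n))`_(Num.truncn (al * n%:R)) <= expR (n%:R * (g al + e)).
  move=> alI e0; have alI' : al \in `]m, M[ by rewrite in_itv.
  have := exponential_rate_in (fun n n0 => P_ge0 _ n0) (pin al alI') e0.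
  by move=> /oU; apply: filterS2 near_good => n h; rewrite coefE.
have prof_out (al B : R) : (0 <= al < m) || (M < al <= 1) -> \forall n \near U,
    c n * (bernoulli_gf (S n))`_(Num.truncn (al * n%:R)) <= expR (n%:R * B).
  move=> alO; have := exponential_rate_out B (pout al alO).
  by move=> /oU; apply: filterS2 near_good => n h; rewrite coefE.
have [C [DC h1 h2 h3 h4]] := profile_identification m01 t01 UU oU S01 S_size
  c_gt0 S_cvg m0 mM M1 prof_in prof_out.
exists C; split=> //; apply: cvg_trans DC.
apply: near_eq_cvg; apply: filterS near_good => n h.
by rewrite /c /good; case: asboolP.
Qed.

End LimitMeasure.

(** * The theorem *)

Section Identification.
Variables (R : realType) (m M : R) (g : R -> R) (C : R).
Variable mu : probability (\bar R) R.
Hypothesis mM : m < M.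
Hypothesis mass1 : mass_at mu (@to01 R) 1 = m.
Hypothesis mass0 : 1 - mass_at mu (@to01 R) 0 = M.
Hypothesis A_itv : forall u, m < tilted_moment mu (@to01 R) 1 u < M.
Hypothesis gA : forall u, g (tilted_moment mu (@to01 R) 1 u) =
  C + logmgf mu (@to01 R) u - tilted_moment mu (@to01 R) 1 u * u.
Hypothesis mu1 : mu (@nonpos R) = 1%E.

Local Notation A := (tilted_moment mu (@to01 R) 1).

(** A law on [-oo, 0] whose tilted mean inverts the slope of the profile has
    the same tilted means as mu, hence equals mu. *)
Lemma profile_determines_law (nu : probability (\bar R) R) :
  nu (@nonpos R) = 1%E ->
  (forall u, m < tilted_moment nu (@to01 R) 1 u < M /\
     derive1 g (tilted_moment nu (@to01 R) 1 u) = - u) ->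
  forall B, measurable B -> nu B = mu B.
Proof.
move=> nu1 h B mB; apply: probability_nonpos_unique => // u.
have [nI dnu] := h u.
have m01 := @measurable_to01 R; have t01 := @to01_itv R.
have [v hv] := tilted_mean_surj m01 t01 mM mass1 mass0 nI.
have dmu := derive1_profile_mean m01 t01 mM mass1 mass0 A_itv gA v.
by rewrite -hv; congr (A _); apply: oppr_inj; rewrite -dmu -dnu hv.
Qed.

Lemma tilted_mean_inverse :
  inverse_on `]0, +oo[ `]m, M[ (fun t => t * cauchy_transform mu t)
    (fun al => expR (- derive1 g al)).
Proof.
have m01 := @measurable_to01 R; have t01 := @to01_itv R.
split=> [t|al|t|al].
- by rewrite /= !in_itv/= andbT => t0; rewrite cauchy_transform_tilt.
- by rewrite /= !in_itv/= andbT expR_gt0.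
- rewrite inE/= in_itv/= andbT => t0; rewrite cauchy_transform_tilt//.
  by rewrite (derive1_profile_mean m01 t01 mM mass1 mass0 A_itv gA) opprK lnK.
- rewrite inE/= in_itv/= => alI; rewrite cauchy_transform_tilt ?expR_gt0// expRK.
  rewrite (derive1_profile m01 t01 mM mass1 mass0 A_itv gA alI) opprK.
  exact: (conj_paramK m01 t01 mM mass1 mass0 alI).
Qed.

End Identification.

Theorem theorem2p2 (R : realType) (P : nat -> {poly R}) (m M : R) (g : R -> R)
    (P_neq0 : forall n, (0 < n)%N -> P n != 0)
    (P_deg : forall n, (0 < n)%N -> (size (P n) <= n.+1)%N)
    (P_ge0 : forall n k, (0 < n)%N -> 0 <= (P n)`_k)
    (P_prof : exponential_profile P m M g)
    (P_roots : \forall n \near \oo, nonpos_rooted (P n)) :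
  exists mu : probability (\bar R) R,
    mu (@nonpos R) = 1%E /\
    let tG (nu : probability (\bar R) R) (t : R) :=
      t * cauchy_transform nu t in
    let Mg := sup (g @` `]m, M[) in
    [/\ (* (a) *)
        (\forall n \near \oo,
           zero_distribution n (P n) setT = 1%E /\
           zero_distribution n (P n) (@nonpos R) = 1%E) /\
        weak_cvg_nonpos (fun n => zero_distribution n (P n)) mu,
        (* (b) *)
        [/\ inverse_on `]0, +oo[ `]m, M[
              (tG mu) (fun alpha => expR (- derive1 g alpha)),
            (forall nu : probability (\bar R) R,
               nu (@nonpos R) = 1%E ->
               inverse_on `]0, +oo[ `]m, M[
                 (tG nu) (fun alpha => expR (- derive1 g alpha)) ->
               forall A : set (\bar R), measurable A -> nu A = mu A),
            {in `]0, +oo[ &, {homo tG mu : s t / s < t}},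
            {in `]0, +oo[, continuous (tG mu)} &
            set_bij `]0, +oo[ `]m, M[ (tG mu)],
        (* (c) *)
        [/\ has_sup (g @` `]m, M[),
            ln (P n).[1] / n%:R @[n --> \oo] --> Mg,
            {in `]m, M[, forall alpha,
               (Mg - g alpha)%:E
               = legendre (fun u => Psi mu (expR u)) alpha} &
            {in `]m, M[, forall alpha,
               (g alpha)%:E
               = (Mg%:E + ereal_inf
                   (range (fun u : R =>
                      (Psi mu (expR u) - alpha * u)%:E)))%E}],
        (* (d) *)
        [/\ smooth_on `]m, M[ g,
            strictly_concave_on `]m, M[ g &
            strictly_concave_on `]m, M[
              (fun alpha => g alpha + alpha * ln alpha)] &
        (* (e) *)
        mu [set 0%E] = m%:E /\ mu [set -oo%E] = (1 - M)%:E].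
Proof.
have [[m_ge0 mM M_le1] _ _] := P_prof.
have m01 := @measurable_to01 R; have t01 := @to01_itv R.
have LM := limit_measure P_neq0 P_deg P_ge0 P_prof P_roots.
have [U0 [UU0 oU0]] := ultra_exists.
have [mu [mu1 _] [C [_ mass1 mass0 A_itv gA]]] := LM U0 UU0 oU0.
exists mu; split=> // tG Mg.
have nd : mass_at mu (@to01 R) 1 < 1 - mass_at mu (@to01 R) 0.
  by rewrite mass1 mass0.
have A_inc := tilted_mean_homo m01 t01 nd.
have MgE : Mg = C := sup_profile m01 t01 mM mass1 mass0 A_itv gA.
have tGE t : 0 < t -> tG mu t = tilted_moment mu (@to01 R) 1 (ln t).
  exact: cauchy_transform_tilt.
have PsiE : (fun u => Psi mu (expR u)) = logmgf mu (@to01 R).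
  by apply/funext => u; exact: Psi_logmgf.
have inv := tilted_mean_inverse mM mass1 mass0 A_itv gA mu1.
have tG_homo : {in `]0, +oo[ &, {homo tG mu : s t / s < t}}.
  move=> s t; rewrite !in_itv/= !andbT => s0 t0 st; rewrite !tGE//.
  by apply: A_inc; rewrite ltr_ln.
split.
- split.
    have n1 : \forall n \near \oo, (0 < n)%N by exists 1%N.
    apply: filterS2 n1 P_roots => n n0 pr.
    by split; exact: (zero_distribution_mass n0 (P_neq0 _ n0) (P_deg _ n0) pr).
  move=> f cf; apply: ultra_cvg => U UU oU.
  have [nu [nu1 nuI] [C' [_ nmass1 nmass0 nA_itv ngA]]] := LM U UU oU.
  have -> : (\int[mu]_(x in @nonpos R) f x)%R = (\int[nu]_(x in @nonpos R) f x)%R.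
    congr fine; apply: eq_measure_integral => B mB _; apply/esym.
    apply: (profile_determines_law mM mass1 mass0 A_itv gA mu1 nu1) => // u.
    split; first exact: nA_itv.
    exact: (derive1_profile_mean m01 t01 mM nmass1 nmass0 nA_itv ngA).
  exact: nuI.
- split=> //.
  + move=> nu nu1 [nuf _ nufK _] B mB.
    apply: (profile_determines_law mM mass1 mass0 A_itv gA mu1 nu1) => // u.
    have e0 : `]0, +oo[%classic (expR u) by rewrite /= in_itv/= andbT expR_gt0.
    have := nuf _ e0; have := nufK _ (mem_set e0).
    rewrite /tG cauchy_transform_tilt ?expR_gt0// expRK => h.
    rewrite /= in_itv/= => hI; split=> //.
    by apply: oppr_inj; apply: expR_inj; rewrite opprK.
  + move=> t; rewrite in_itv/= andbT => t0.
    have h : (fun s => tilted_moment mu (@to01 R) 1 (ln s)) @ t --> tG mu t.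
      rewrite tGE//; apply: (@continuous_comp _ _ _ (@ln R) (tilted_moment mu (@to01 R) 1)).
        exact: continuous_ln.
      exact: is_derive_continuous (is_derive_tilted_moment mu m01 t01 1 (ln t)).
    apply: cvg_trans h; apply: near_eq_cvg.
    have : \forall s \near t, 0 < s by exact: (cvgr_gt t cvg_id).
    by apply: filterS => s s0; rewrite tGE.
  + have [h1 h2 h3 h4] := inv; split=> //.
      move=> s t hs ht e.
      by rewrite -(h3 _ hs) -(h3 _ ht); congr (expR (- derive1 g _)).
    move=> al hal; exists (expR (- derive1 g al)); first exact: h2.
    by apply: h4; exact: mem_set.
- split.
  + exact: (has_sup_profile m01 t01 mM mass1 mass0 A_itv gA).
  + apply: ultra_cvg => U UU oU.
    have [nu _ [C' [hC' nmass1 nmass0 nA_itv ngA]]] := LM U UU oU.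
    by rewrite /Mg (sup_profile m01 t01 mM nmass1 nmass0 nA_itv ngA).
  + move=> al; rewrite in_itv/= => alI; rewrite PsiE MgE.
    exact: (legendre_logmgf m01 t01 mM mass1 mass0 gA alI).
  + move=> al; rewrite in_itv/= => alI; rewrite MgE.
    rewrite (profile_inf m01 t01 mM mass1 mass0 gA alI).
    by congr (_ + ereal_inf _)%E; rewrite -PsiE.
- split.
  + exact: (profile_smooth m01 t01 mM mass1 mass0 A_itv gA).
  + exact: (profile_strictly_concave m01 t01 mM mass1 mass0 A_itv gA).
  + exact: (profile_entropy_strictly_concave m01 t01 m_ge0 mM mass1 mass0 A_itv gA).
- split; first by rewrite mass_at1// mass1.
  by rewrite mass_at0 -mass0 subKr.
Qed.
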